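(* Let $B$ be a centered, sample continuous Gaussian process on $\mathbb{R}$ with stationary increments and variance function $\sigma^2(t)=\mathrm{Var}(B(t))$, and let $W(t)=B(t)-\sigma^2(t)/2$, $t\in\mathbb{R}$, with $W(0)=0$ almost surely. Suppose that there are an ultimately monotone, non-decreasing function $\ell:[0,\infty)\to[0,\infty)$ and a constant $c\in(0,1]$ with $c^2+8c-8>0$ such that for all $t$ large $$c\,\ell(t)\le\sigma^2(t)\le\ell(t),\qquad\text{where}\qquad \lim_{t\to\infty}\frac{\ell(t)}{\ell(t+k)}=1\quad\text{for all }k\in\mathbb{N}.$$ If further $$\liminf_{t\to\infty}\frac{\ell(t)}{\ln t}>\frac{8}{c^2+8c-8},$$ then $$\mathcal{H}_W^\delta=\mathbb{E}\left\{\frac{M^\delta}{S^\eta}\right\}\in(0,\infty),$$ which is valid for $\delta=0$ and any $\eta\ge0$, and for $\delta>0$ and $\eta=k\delta$ with any $k\in\mathbb{N}$.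
   Context: For $\delta\ge0$, with the convention $\delta\mathbb{Z}=\mathbb{R}$ if $\delta=0$, the generalized Pickands constant is $$\mathcal{H}_W^\delta=\lim_{T\to\infty}\frac1T\,\mathbb{E}\Big\{\sup_{t\in\delta\mathbb{Z}\cap[0,T]}e^{W(t)}\Big\}$$ (the limit exists and is finite in this setting). Moreover $$M^\delta=\sup_{t\in\delta\mathbb{Z}}e^{W(t)}\ (\delta\ge 0),\qquad S^\eta=\eta\sum_{t\in\eta\mathbb{Z}}e^{W(t)}\ (\eta>0),\qquad S^0=\int_{\mathbb{R}}e^{W(t)}\,dt.$$ Here $\mathbb{N}=\{1,2,\dots\}$. *)

(* Defs.v *)
From HB Require Import structures.
From mathcomp Require Import all_boot all_order all_algebra.
From mathcomp Require Import all_classical all_reals all_analysis.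

Set Implicit Arguments.
Unset Strict Implicit.
Unset Printing Implicit Defensive.
Import Order.TTheory GRing.Theory Num.Theory.
Import numFieldNormedType.Exports.

Local Open Scope classical_set_scope.
Local Open Scope ring_scope.

(* [normal_prob m 0] is the uniform law on [0, 1], not a point mass: the
   degenerate Gaussian law has to be given separately. *)
Definition gaussian_law (R : realType) (m s : R) (A : set R) : \bar R :=
  if s == 0 then dirac m A else normal_prob m s A.

Definition gaussian_variable (d : measure_display) (T : measurableType d)
    (R : realType) (P : probability T R) (X : T -> R) : Prop :=
  exists m s : R, forall A : set R, measurable A ->
    pushforward P X A = gaussian_law m s A.

Definition gaussian_process (d : measure_display) (T : measurableType d)
    (R : realType) (P : probability T R) (B : R -> T -> R) : Prop :=
  forall (n : nat) (a t : 'I_n -> R),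
    gaussian_variable P (fun w => \sum_(i < n) a i * B (t i) w).

Definition centered (d : measure_display) (T : measurableType d)
    (R : realType) (P : probability T R) (B : R -> T -> R) : Prop :=
  forall t : R, ('E_P[B t] = 0)%E.

Definition sample_continuous (d : measure_display) (T : measurableType d)
    (R : realType) (P : probability T R) (B : R -> T -> R) : Prop :=
  {ae P, forall w, continuous (fun t : R => B t w)}.

Definition increments (T : Type) (R : realType) (B : R -> T -> R) (n : nat)
    (s t : 'I_n -> R) (h : R) (w : T) : n.-tuple R :=
  [tuple B (t i + h) w - B (s i + h) w | i < n].

Definition stationary_increments (d : measure_display) (T : measurableType d)
    (R : realType) (P : probability T R) (B : R -> T -> R) : Prop :=
  forall (n : nat) (s t : 'I_n -> R) (h : R) (A : set (n.-tuple R)),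
    measurable A ->
    pushforward P (increments B s t h) A = pushforward P (increments B s t 0) A.

Definition variance_function (d : measure_display) (T : measurableType d)
    (R : realType) (P : probability T R) (B : R -> T -> R) (t : R) : R :=
  fine ('V_P[B t])%E.

Definition drifted (d : measure_display) (T : measurableType d)
    (R : realType) (P : probability T R) (B : R -> T -> R) (t : R) (w : T) : R :=
  B t w - variance_function P B t / 2.

(* The lattice delta Z, with the convention 0 Z = R. *)
Definition lattice (R : realType) (delta : R) : set R :=
  [set t | delta = 0 \/ exists z : int, t = delta * z%:~R].

Definition path_sup (T : Type) (R : realType) (W : R -> T -> R)
    (A : set R) (w : T) : \bar R :=
  ereal_sup [set (expR (W t w))%:E | t in A].

Definition path_sum (T : Type) (R : realType) (W : R -> T -> R)
    (eta : R) (w : T) : \bar R :=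
  if eta == 0 then (\int[lebesgue_measure]_t (expR (W t w))%:E)%E
  else (eta%:E * \esum_(t in lattice eta) (expR (W t w))%:E)%E.

Definition pickands_ratio (d : measure_display) (T : measurableType d)
    (R : realType) (P : probability T R) (W : R -> T -> R) (delta u : R) :
    \bar R :=
  ((u^-1)%:E * \int[P]_w path_sup W (lattice delta `&` `[0%R, u]) w)%E.

Definition pickands_constant (d : measure_display) (T : measurableType d)
    (R : realType) (P : probability T R) (W : R -> T -> R) (delta : R) :
    \bar R :=
  lim (pickands_ratio P W delta u @[u --> +oo]).

(* Main.v *)
(** Let [Q] be the law of the path [W]. Comparing Laplace transforms of
    finite-dimensional marginals gives the tilting identity
    [E (e^W(h) F(W(. + h) - W(h))) = E F(W)]. If [F] is homogeneous,
    [F(x + c) = e^c F(x)], it yields, for any spacing [b > 0],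
    [E F(W) = E ((sum_(t in b Z) F(W(. + t))) / sum_(t in b Z) e^W(t))].
    Take for [F] the excess of the supremum of [e^W] over [[0, b[] above its
    supremum over the negative half-line: the sum telescopes to the global
    supremum [M]. On the other hand, [E sup_[0, nb[ e^W] grows at each step by
    the expected excess over a finite past, which converges to [E F(W)] by
    dominated convergence, so that averaging gives the limit of the ratios.
    For the integral [S^0], transport [(int_0^1 e^W) M / S^0] instead, and
    compute its expectation by Fubini. Finiteness of the sums comes from
    [E e^(W(t)/2) = e^(- sigma^2(t) / 8)] and the logarithmic growth of
    [sigma^2]; that of local suprema from Fernique's argument. *)

Require Import Defs.
From HB Require Import structures.
From mathcomp Require Import all_boot all_order all_algebra.
From mathcomp Require Import all_classical all_reals all_analysis.
From mathcomp Require Import measurable_realfun.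
From mathcomp Require Import ring lra.

Set Implicit Arguments.
Unset Strict Implicit.
Unset Printing Implicit Defensive.
Import Order.TTheory GRing.Theory Num.Theory.
Import numFieldNormedType.Exports.

Local Open Scope classical_set_scope.
Local Open Scope ring_scope.

(** * Elementary real bounds *)

Section real_bounds.
Variable R : realType.
Implicit Types x y : R.

(** Laplace uniqueness is proved for weighted laws because it serves twice: for the density [e^W(h)]
    of the tilted path and, in Fernique's argument, for the independence of two rotated copies,
    where an event on one copy becomes a weight for the other. Suprema over uncountable time sets
    need not be measurable on the original space, so all the work is done on a space of continuous
    paths, compared with the process outside a null set. The drifted path is continuous only once
    [sigma^2] is, and that continuity itself rests on Fernique's bound; hence the bound is
    established for the centered path. Transport also yields finiteness: applied to the supremum
    over one block, it bounds the expected sum of all block suprema divided by a finite lattice sum,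
    without estimating suprema far away. The relation [eta = k delta] makes [delta Z] invariant
    under translations of [eta Z]. Finally [c^2 + 8c - 8 <= c], since [(c + 8)(1 - c) >= 0]; the
    growth condition then gives [sigma^2(t) >= 8 (1 + e) ln t] for some [e > 0], exactly what
    summing [e^(- sigma^2(t) / 8)] asks for. *)

Lemma expRB1_le x : expR x - 1 <= x * expR x.
Proof.
have := expR_ge1Dx (- x); rewrite expRN => h.
have e0 := expR_gt0 x.
rewrite -(ler_pM2l e0) mulfV ?gt_eqF// in h; nra.
Qed.

Lemma norm_expRB1Bx_le x : `|expR x - 1 - x| <= x ^+ 2 * expR `|x|.
Proof.
have h1 := expR_ge1Dx x; have h2 := expRB1_le x; have h0 := expR_gt0 x.
rewrite ger0_norm; last by lra.
have [x0|x0] := leP 0 x.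
  rewrite ger0_norm//; have : 0 <= x * (x * expR x - (expR x - 1)).
    by rewrite mulr_ge0// subr_ge0.
  have : x * (1 - expR x) + x ^+ 2 * expR x >= 0 by nra.
  by nra.
have e1 : 1 <= expR `|x| by rewrite -expR0 ler_expR.
have : x ^+ 2 <= x ^+ 2 * expR `|x| by rewrite ler_peMr// sqr_ge0.
have : expR x <= 1 by rewrite -expR0 ler_expR ltW.
nra.
Qed.

Lemma norm_expRB1_le x : `|expR x - 1| <= `|x| * expR `|x|.
Proof.
have h1 := expR_ge1Dx x; have h2 := expRB1_le x.
have [x0|x0] := leP 0 x.
  by rewrite !ger0_norm; lra.
have e1 : 1 <= expR `|x| by rewrite -expR0 ler_expR.
have : expR x <= 1 by rewrite -expR0 ler_expR ltW.
move=> ?; rewrite ler0_norm ?(ltr0_norm x0)//; last by lra.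
rewrite (ltr0_norm x0) in e1; nra.
Qed.

Lemma expR_norm_le x : expR `|x| <= expR x + expR (- x).
Proof.
by have [x0|x0] := ger0P x; rewrite ?lerDl ?lerDr expR_ge0.
Qed.

Lemma norm_exp_le_expR x k : `|x| ^+ k <= k`!%:R * expR `|x|.
Proof.
case: k => [|k].
  by rewrite expr0 fact0 mul1r -expR0 ler_expR.
have := @expR_ge1Dxn _ `|x| k (normr_ge0 _).
have f0 : 0 < k.+1`!%:R :> R by rewrite ltr0n fact_gt0.
rewrite -(ler_pM2l f0) mulrDr mulrCA mulfV ?gt_eqF// !mulr1.
by apply: le_trans; rewrite lerDr ltW.
Qed.

Lemma bernoulli_ge (y : R) n : 0 <= y <= 1 -> 1 - n%:R * y <= (1 - y) ^+ n.
Proof.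
move=> /andP[y0 y1]; elim: n => [|n IH]; first by rewrite expr0 mul0r subr0.
rewrite exprS.
have h : (1 - n%:R * y) * (1 - y) <= (1 - y) ^+ n * (1 - y).
  by rewrite ler_wpM2r// subr_ge0.
rewrite [leRHS]mulrC; apply: le_trans h.
have : 0 <= (n%:R : R) by [].
by rewrite -natr1; nra.
Qed.

(** The left side is a sum of [n] copies of [x ^ n], each at most [x ^ i] with [i < n]; the
    geometric sum does the rest. *)
Lemma natr_exp_le (x : R) n : 0 <= x < 1 -> n%:R * x ^+ n <= (1 - x)^-1.
Proof.
move=> /andP[x0 x1]; rewrite -[leRHS]mul1r ler_pdivlMr ?subr_gt0//.
have -> : n%:R * x ^+ n * (1 - x) = \sum_(i < n) x ^+ n * (1 - x).
  by rewrite sumr_const card_ord -[RHS]mulr_natl mulrA.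
have : \sum_(i < n) x ^+ n * (1 - x) <= \sum_(i < n) x ^+ i * (1 - x).
  apply: ler_sum => i _; apply: ler_wpM2r; first by rewrite subr_ge0 ltW.
  by apply: ler_wiXn2l => //; [exact: ltW|exact/ltnW/ltn_ord].
move/le_trans; apply.
suff -> : \sum_(i < n) x ^+ i * (1 - x) = 1 - x ^+ n by rewrite gerBl exprn_ge0.
elim: n => [|n IH]; first by rewrite big_ord0 expr0 subrr.
by rewrite big_ord_recr/= IH exprS; ring.
Qed.

(* These polynomials stay in [0, 1], so dominated convergence applies to them. *)
Lemma half_cutoff_cvg (u : R) : 0 <= u <= 1 ->
  (1 - u ^+ (2 * n)) ^+ (n * 4 ^ n) @[n --> \oo] --> ((u < 1/2)%R%:R : R).
Proof.
move=> /andP[u0 u1].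
have un n : 0 <= u ^+ n <= 1 by rewrite exprn_ge0//= exprn_ile1.
(* The exponents are tuned so that [n * 4 ^ n * u ^ (2 * n)] is [n * (2 * u) ^ (2 * n)]: it tends to
   0 below 1/2 and is at least [n] from 1/2 on. Bernoulli's inequality and [1 - v <= e^(- v)]
   transfer this to the power. *)
have [uh|uh] := ltP u (1/2).
  pose x := 2 * u; have x01 : 0 <= x < 1 by rewrite /x; lra.
  apply: (@squeeze_cvgr _ _ _ _ (fun n => 1 - (1 - x)^-1 * x ^+ n) (cst 1)).
  - near=> n; apply/andP; split; last first.
      rewrite exprn_ile1 ?subr_ge0 ?gerBl; by case/andP: (un (2 * n)%N).
    apply: le_trans (bernoulli_ge _ (un _)); rewrite lerD2l lerN2.
    rewrite (_ : _%:R * _ = n%:R * x ^+ n * x ^+ n).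
      by rewrite ler_wpM2r ?natr_exp_le// exprn_ge0//; case/andP: x01.
    rewrite natrM natrX -mulrA -[RHS]mulrA -exprD addnn -mul2n /x; congr (_ * _).
    by rewrite exprMn (_ : 4 = 2 ^+ 2)// ?exprM// expr2 -natrM.
  - rewrite -[X in _ --> X]subr0; apply: cvgB; first exact: cvg_cst.
    rewrite -[X in _ --> X](mulr0 (1 - x)^-1); apply: cvgMr.
    apply: cvg_expr; rewrite ger0_norm; case/andP: x01 => //.
  - exact: cvg_cst.
apply: (@squeeze_cvgr _ _ _ _ (cst 0) (fun n => expR (- n%:R))).
- near=> n; apply/andP; split; first by rewrite exprn_ge0// subr_ge0; case/andP: (un (2 * n)%N).
  apply: (@le_trans _ _ (expR (- (u ^+ (2 * n))) ^+ (n * 4 ^ n))).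
    rewrite lerXn2r ?nnegrE ?expR_ge0 ?expR_ge1Dx// subr_ge0; by case/andP: (un (2 * n)%N).
  rewrite -expRM_natl ler_expR mulrN lerN2 natrM natrX -mulrA.
  rewrite -[X in X <= _]mulr1 ler_wpM2l//.
  rewrite (_ : 4 = 2 ^+ 2); last by rewrite expr2 -natrM.
  by rewrite -exprM -exprMn -[X in X <= _](expr1n _ (2*n)) lerXn2r ?nnegrE//; lra.
- exact: cvg_cst.
- exact: cvgn_expR.
Unshelve. all: by end_near. Qed.

End real_bounds.

(** * Uniqueness of two-sided Laplace transforms *)

Section laplace_uniqueness.
Context (R : realType) d1 d2 (T1 : measurableType d1) (T2 : measurableType d2).
Variables (m1 : {measure set T1 -> \bar R}) (m2 : {measure set T2 -> \bar R}).
Variables (w1 g1 : T1 -> R) (w2 g2 : T2 -> R).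

(** The class of test functions on which two weighted real laws agree. The weights will carry
    densities, exponentials of other coordinates and indicators of events already treated. *)
Definition same_integral (f : R -> R) : Prop :=
  [/\ m1.-integrable setT (fun x => (w1 x * f (g1 x))%:E),
      m2.-integrable setT (fun x => (w2 x * f (g2 x))%:E) &
      (\int[m1]_x (w1 x * f (g1 x))%:E = \int[m2]_x (w2 x * f (g2 x))%:E)%E].

Lemma same_integral_ext (f g : R -> R) : f =1 g -> same_integral f -> same_integral g.
Proof. by move=> /funext ->. Qed.

Lemma same_integralD (f g : R -> R) : same_integral f -> same_integral g ->
  same_integral (fun x => f x + g x).
Proof.
move=> [f1 f2 fE] [h1 h2 hE].
have E (T : Type) (w h : T -> R) : (fun x => (w x * (f (h x) + g (h x)))%:E) =
    ((fun x => (w x * f (h x))%:E) \+ (fun x => (w x * g (h x))%:E))%E.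
  by apply/funext => x/=; rewrite mulrDr EFinD.
split; rewrite !E; [exact: integrableD|exact: integrableD|].
by rewrite !integralD//= fE hE.
Qed.

Lemma same_integralZ (k : R) (f : R -> R) : same_integral f ->
  same_integral (fun x => k * f x).
Proof.
move=> [f1 f2 fE].
have E (T : Type) (w h : T -> R) : (fun x => (w x * (k * f (h x)))%:E) =
    (fun x => k%:E * (w x * f (h x))%:E)%E.
  by apply/funext => x/=; rewrite -EFinM mulrCA.
split; rewrite !E; [exact: integrableZl|exact: integrableZl|].
by rewrite !integralZl//= fE.
Qed.

Lemma same_integralB (f g : R -> R) : same_integral f -> same_integral g ->
  same_integral (fun x => f x - g x).
Proof.
move=> sf /(same_integralZ (-1)) sg.
by apply: same_integral_ext (same_integralD sf sg) => x; rewrite mulN1r.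
Qed.

Lemma same_integral_sum n (f : nat -> R -> R) : same_integral (fun=> 0) ->
  (forall k, same_integral (f k)) ->
  same_integral (fun x => \sum_(0 <= k < n) f k x).
Proof.
move=> s0 sf; elim: n => [|n IH].
  by apply: same_integral_ext s0 => x; rewrite big_nil.
apply: same_integral_ext (same_integralD IH (sf n)) => x.
by rewrite big_nat_recr.
Qed.

(** Dominated convergence on both sides at once: asking that the bound [h] be in the class supplies
    its integrability under both weighted laws. *)
Lemma same_integral_lim (f : nat -> R -> R) (F h : R -> R) :
  (forall x, 0 <= w1 x) -> (forall x, 0 <= w2 x) ->
  (forall n, same_integral (f n)) -> same_integral h ->
  (forall n x, `|f n x| <= h x) -> (forall x, f n x @[n --> \oo] --> F x) ->
  same_integral F.
Proof.
move=> w10 w20 sf [h1 h2 _] fh fF.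
have conv d (T : measurableType d) (m : {measure set T -> \bar R}) (w g : T -> R) :
    (forall x, 0 <= w x) ->
    m.-integrable setT (fun x => (w x * h (g x))%:E) ->
    (forall n, m.-integrable setT (fun x => (w x * f n (g x))%:E)) ->
    m.-integrable setT (fun x => (w x * F (g x))%:E) /\
    (\int[m]_x (w x * f n (g x))%:E @[n --> \oo] --> \int[m]_x (w x * F (g x))%:E)%E.
  move=> w0 ih ifn.
  have mf n : measurable_fun setT (fun x => (w x * f n (g x))%:E).
    exact: measurable_int (ifn n).
  have lim x : setT x -> (w x * f n (g x))%:E @[n --> \oo] --> (w x * F (g x))%:E.
    by move=> _; apply: cvg_EFin; [exact: nearW|apply: cvgMr; exact: fF].
  have bnd n x : setT x -> (`|(w x * f n (g x))%:E| <= (w x * h (g x))%:E)%E.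
    by move=> _; rewrite abse_EFin lee_fin normrM (ger0_norm (w0 x)) ler_wpM2l.
  have mF := emeasurable_fun_cvg _ _ mf lim.
  have lim' : {ae m, forall x, setT x -> (w x * f n (g x))%:E @[n --> \oo] --> (w x * F (g x))%:E}.
    exact: aeW.
  have bnd' : {ae m, forall x n, setT x -> (`|(w x * f n (g x))%:E| <= (w x * h (g x))%:E)%E}.
    by apply: aeW => x n; exact: bnd.
  by have [] := dominated_convergence measurableT mf mF lim' ih bnd'.
have [i1 c1] := conv _ _ m1 w1 g1 w10 h1 (fun n => let: And3 a _ _ := sf n in a).
have [i2 c2] := conv _ _ m2 w2 g2 w20 h2 (fun n => let: And3 _ a _ := sf n in a).
split=> //.
have E : (fun n => (\int[m1]_x (w1 x * f n (g1 x))%:E)%E) =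
         (fun n => (\int[m2]_x (w2 x * f n (g2 x))%:E)%E).
  by apply/funext => n; case: (sf n).
by rewrite E in c1; exact: (cvg_unique _ c1 c2).
Qed.

Hypotheses (w1_ge0 : forall x, 0 <= w1 x) (w2_ge0 : forall x, 0 <= w2 x).
Hypothesis laplace : forall a, same_integral (fun x => expR (a * x)).

(** Differentiation in the Laplace parameter [a]: each further power of [x] is the limit of
    difference quotients of step [1 / (n + 1)]. *)
Lemma same_integral_moment k a : same_integral (fun x => x ^+ k * expR (a * x)).
Proof.
elim: k a => [|k IH] a.
  by apply: same_integral_ext (laplace a) => x; rewrite expr0 mul1r.
pose f n x := n.+1%:R * (x ^+ k * expR ((a + n.+1%:R^-1) * x) - x ^+ k * expR (a * x)).
have fE n x : f n x = x ^+ k * expR (a * x) * (n.+1%:R * (expR (x / n.+1%:R) - 1)).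
  by rewrite /f mulrDl expRD [_^-1 * x]mulrC; ring.
(* The quotient is bounded by [|x| e^|x|], and [|x| ^ (k + 1)] costs another [(k + 1)! e^|x|]; the
   resulting [e^(2 |x|)] explains the parameters [a + 2] and [a - 2]. *)
apply: (@same_integral_lim f _ (fun x => k.+1`!%:R *
   (expR ((a + 2) * x) + expR ((a - 2) * x)))) => //.
- by move=> n; apply: same_integralZ; apply: same_integralB; exact: IH.
- by apply: same_integralZ; apply: same_integralD; exact: laplace.
- move=> n x; rewrite fE normrM normrM normrX (ger0_norm (expR_ge0 _)).
  have n0 : 0 < n.+1%:R :> R by [].
  have xn : `|x / n.+1%:R| <= `|x|.
    rewrite normrM normfV (@ger0_norm _ n.+1%:R)//.
    by rewrite ler_piMr// invf_le1// ler1n.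
  have h1 : `|n.+1%:R * (expR (x / n.+1%:R) - 1)| <= `|x| * expR `|x|.
    rewrite normrM (@ger0_norm _ n.+1%:R)//.
    apply: (@le_trans _ _ (n.+1%:R * (`|x / n.+1%:R| * expR `|x|))).
      rewrite ler_wpM2l//; apply: le_trans (norm_expRB1_le _) _.
      by rewrite ler_wpM2l// ler_expR.
    by rewrite normrM normfV (@ger0_norm _ n.+1%:R)// mulrA mulrCA divff ?mulr1// gt_eqF.
  apply: (@le_trans _ _ (`|x| ^+ k * expR (a * x) * (`|x| * expR `|x|))).
    by rewrite ler_wpM2l// mulr_ge0// ?expR_ge0// exprn_ge0.
  rewrite (_ : _ * _ = `|x| ^+ k.+1 * (expR `|x| * expR (a * x))); last first.
    by rewrite exprS; ring.
  apply: (@le_trans _ _ (k.+1`!%:R * expR `|x| * (expR `|x| * expR (a * x)))).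
    by rewrite ler_wpM2r ?norm_exp_le_expR// mulr_ge0 ?expR_ge0.
  rewrite -!mulrA ler_wpM2l// mulrA -expRD.
  rewrite (_ : `|x| + `|x| = `|2 * x|); last by rewrite normrM ger0_norm//; ring.
  have -> : (a + 2) * x = a * x + 2 * x by ring.
  have -> : (a - 2) * x = a * x + - (2 * x) by ring.
  by rewrite [leLHS]mulrC !expRD -mulrDr ler_wpM2l ?expR_ge0// expR_norm_le.
- move=> x.
  suff h : n.+1%:R * (expR (x / n.+1%:R) - 1) @[n --> \oo] --> x.
    under eq_fun do rewrite fE.
    by rewrite exprSr mulrAC; apply: cvgMr.
  have c0 : n.+1%:R^-1 @[n --> \oo] --> (0 : R) by exact: cvg_harmonic.
  apply/subr_cvg0.
  apply: (@squeeze_cvgr _ _ _ _ (fun n => - (x ^+ 2 * expR `|x| * n.+1%:R^-1))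
    (fun n => x ^+ 2 * expR `|x| * n.+1%:R^-1)).
  + near=> n; rewrite -ler_norml.
    have n0 : 0 < n.+1%:R :> R by [].
    have -> : n.+1%:R * (expR (x / n.+1%:R) - 1) - x =
        n.+1%:R * (expR (x / n.+1%:R) - 1 - x / n.+1%:R) by field; rewrite gt_eqF.
    rewrite normrM (@ger0_norm _ n.+1%:R)//.
    apply: (@le_trans _ _ (n.+1%:R * ((x / n.+1%:R) ^+ 2 * expR `|x|))).
      rewrite ler_wpM2l//; apply: le_trans (norm_expRB1Bx_le _) _.
      rewrite ler_wpM2l ?sqr_ge0// ler_expR normrM normfV (@ger0_norm _ n.+1%:R)//.
      by rewrite ler_piMr// invf_le1// ler1n.
    rewrite le_eqVlt; apply/orP; left; apply/eqP; field.
    by rewrite gt_eqF.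
  + by rewrite -[X in _ --> X](oppr0) -(mulr0 (x ^+ 2 * expR `|x|)); apply: cvgN; apply: cvgMr.
  + by rewrite -(mulr0 (x ^+ 2 * expR `|x|)); apply: cvgMr.
Unshelve. all: by end_near. Qed.

End laplace_uniqueness.

(** * Half-line indicators as bounded limits of trigonometric polynomials *)

Section laplace_indicator.
Context (R : realType) d1 d2 (T1 : measurableType d1) (T2 : measurableType d2).
Variables (m1 : {measure set T1 -> \bar R}) (m2 : {measure set T2 -> \bar R}).
Variables (w1 g1 : T1 -> R) (w2 g2 : T2 -> R).
Hypotheses (w1_ge0 : forall x, 0 <= w1 x) (w2_ge0 : forall x, 0 <= w2 x).

Local Notation same_integral := (same_integral m1 m2 w1 g1 w2 g2).

Hypothesis laplace : forall a, same_integral (fun x => expR (a * x)).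

Lemma same_integral_cst c : same_integral (fun=> c).
Proof.
apply: same_integral_ext (same_integralZ c (laplace 0)) => x.
by rewrite mul0r expR0 mulr1.
Qed.

(** Coefficients bounded by those of the exponential keep all partial sums below [e^|b x|], hence
    below [e^(b x) + e^(- b x)], which is in the class. *)
Lemma same_integral_entire (a : nat -> R) (F : R -> R) (b : R) :
  (forall k, `|a k| <= (k`!%:R)^-1) ->
  (forall x, \sum_(0 <= k < n) a k * x ^+ k @[n --> \oo] --> F x) ->
  same_integral (fun x => F (b * x)).
Proof.
move=> ak aF.
apply: (@same_integral_lim _ _ _ _ _ _ _ _ _ _ _
  (fun n x => \sum_(0 <= k < n) (a k * b ^+ k) * x ^+ k) _
  (fun x => expR (b * x) + expR (- b * x))) => //.
- move=> n; apply: same_integral_sum => [|k]; first exact: same_integral_cst.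
  apply: same_integralZ.
  apply: same_integral_ext (same_integral_moment w1_ge0 w2_ge0 laplace k 0) => x.
  by rewrite mul0r expR0 mulr1.
- by apply: same_integralD; exact: laplace.
- move=> n x; rewrite mulNr; apply: le_trans (expR_norm_le _).
  apply: (@le_trans _ _ (series (exp_coeff `|b * x|) n)).
    rewrite /series/=; apply: le_trans (ler_norm_sum _ _ _) _.
    apply: ler_sum => k _; rewrite -mulrA -exprMn normrM normrX mulrC.
    by rewrite ler_wpM2l// exprn_ge0.
  apply: nondecreasing_cvgn_le; last exact: is_cvg_series_exp_coeff.
  by apply: nondecreasing_series => k _ _; exact: exp_coeff_ge0.
- move=> x; under eq_fun do under eq_bigr do rewrite -mulrA -exprMn.
  exact: aF.
Qed.

Lemma same_integral_cosM b : same_integral (fun x => cos (b * x)).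
Proof.
apply: (@same_integral_entire (fun k => (~~ odd k)%:R * (-1) ^+ k./2 * (k`!%:R)^-1)).
  move=> k; rewrite !normrM normrX normrN1 expr1n mulr1 normfV !normr_nat.
  by case: (odd k); rewrite /= ?mul0r ?mul1r ?invr_ge0.
move=> x; rewrite cos.unlock.
have := @is_cvg_series_cos_coeff R x; rewrite /series/= => h.
under eq_fun do under eq_bigr do rewrite mulrAC.
exact: h.
Qed.

Lemma same_integral_sinM b : same_integral (fun x => sin (b * x)).
Proof.
apply: (@same_integral_entire (fun k => (odd k)%:R * (-1) ^+ k.-1./2 * (k`!%:R)^-1)).
  move=> k; rewrite !normrM normrX normrN1 expr1n mulr1 normfV !normr_nat.
  by case: (odd k); rewrite /= ?mul0r ?mul1r ?invr_ge0.
move=> x; rewrite sin.unlock.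
have := @is_cvg_series_sin_coeff R x; rewrite /series/= => h.
under eq_fun do under eq_bigr do rewrite mulrAC.
exact: h.
Qed.

Lemma same_integral_cos b c : same_integral (fun x => cos (b * x + c)).
Proof.
apply: (@same_integral_ext _ _ _ _ _ _ _ _ _ _ _
  (fun x => cos c * cos (b * x) - sin c * sin (b * x))).
  by move=> x; rewrite cosD [cos c * _]mulrC [sin c * _]mulrC.
apply: same_integralB; apply: same_integralZ.
  exact: same_integral_cosM.
exact: same_integral_sinM.
Qed.

(* Multiplying by an arbitrary cosine makes the class stable under products
   with trigonometric polynomials. *)
Let trig (f : R -> R) := forall b c, same_integral (fun x => f x * cos (b * x + c)).

Let trigB f g : trig f -> trig g -> trig (fun x => f x - g x).
Proof.
move=> tf tg b c; apply: same_integral_ext (same_integralB (tf b c) (tg b c)) => x.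
by rewrite mulrBl.
Qed.

(** By the product-to-sum formula, the new factor only shifts the frequency and phase of the cosine
    that is carried along. *)
Let trigM f p q : trig f -> trig (fun x => f x * ((1 + cos (p * x + q)) / 2)).
Proof.
move=> tf b c.
apply: (@same_integral_ext _ _ _ _ _ _ _ _ _ _ _ (fun x =>
  2^-1 * (f x * cos (b * x + c)) + 4^-1 * (f x * cos ((b + p) * x + (c + q)) +
    f x * cos ((b - p) * x + (c - q))))).
  move=> x; rewrite (_ : (b + p) * x + (c + q) = (b * x + c) + (p * x + q)); last by ring.
  rewrite (_ : (b - p) * x + (c - q) = (b * x + c) - (p * x + q)); last by ring.
  by move: (b * x + c) (p * x + q) => y z; rewrite cosD cosB; field.
apply: same_integralD; apply: same_integralZ; first exact: tf.
by apply: same_integralD; exact: tf.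
Qed.

Let trigXM f p q k : trig f -> trig (fun x => f x * ((1 + cos (p * x + q)) / 2) ^+ k).
Proof.
elim: k f => [|k IH] f tf.
  by move=> b c; apply: same_integral_ext (tf b c) => x; rewrite expr0 mulr1.
move=> b c; apply: same_integral_ext (IH _ (trigM p q tf) b c) => x.
by rewrite exprS; ring.
Qed.

Let trigX p q k m : trig (fun x => (1 - ((1 + cos (p * x + q)) / 2) ^+ k) ^+ m).
Proof.
elim: m => [|m IH].
  by move=> b c; apply: same_integral_ext (same_integral_cos b c) => x; rewrite expr0 mul1r.
move=> b c; apply: same_integral_ext (trigB IH (trigXM p q k IH) b c) => x.
by rewrite exprSr; ring.
Qed.

(** With [u = (1 + cos) / 2] in [0, 1], a negative cosine means [u < 1/2], and the cutoff
    polynomials in [u] are trigonometric polynomials. *)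
Let same_integral_cos_lt0 p q :
  same_integral (fun x => (cos (p * x + q) < 0)%R%:R).
Proof.
pose u x := (1 + cos (p * x + q)) / 2.
have u01 x : 0 <= u x <= 1.
  by have := cos_geN1 (p * x + q); have := cos_le1 (p * x + q); rewrite /u; lra.
apply: (@same_integral_lim _ _ _ _ _ _ _ _ _ _ _
  (fun n x => (1 - u x ^+ (2 * n)) ^+ (n * 4 ^ n)) _ (fun=> 1)) => //.
- move=> n; apply: same_integral_ext (trigX p q (2 * n) (n * 4 ^ n) 0 0) => x.
  by rewrite mul0r addr0 cos0 mulr1.
- exact: same_integral_cst.
- move=> n x; have /andP[u0 u1] := u01 x.
  have : 0 <= 1 - u x ^+ (2 * n) <= 1.
    by rewrite subr_ge0 exprn_ile1// gerBl exprn_ge0.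
  by move=> /andP[v0 v1]; rewrite ger0_norm ?exprn_ge0// exprn_ile1.
- move=> x; have := half_cutoff_cvg (u01 x).
  rewrite (_ : (u x < 1 / 2) = (cos (p * x + q) < 0))//.
  by rewrite /u ltr_pM2r// gtrDl.
Qed.

(** The shifted cosine is [sin (p (x - z))], whose sign is that of [x - z] as long as
    [p |x - z| < pi]. Letting the frequency [p] tend to 0 widens this window to the whole line. *)
Theorem same_integral_lt z : same_integral (fun x => (x < z)%R%:R).
Proof.
pose p n : R := n.+1%:R^-1.
apply: (@same_integral_lim _ _ _ _ _ _ _ _ _ _ _
  (fun n x => (cos (p n * x + (- (p n * z) - pi / 2)) < 0)%R%:R) _ (fun=> 1)) => //.
- exact: same_integral_cst.
- by move=> n x; rewrite ger0_norm ?ler0n//; case: (_ < 0).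
move=> x; apply: cvg_near_cst; near=> n; congr (_%:R); congr (nat_of_bool _).
rewrite addrA cosBpihalf -mulrBr.
have pn0 : 0 < p n by rewrite invr_gt0.
have pi1 : 1 < pi :> R by apply: lt_le_trans (pi_ge2 R); rewrite ltr1n.
have pn : `|p n * (x - z)| < pi.
  apply: lt_trans pi1; rewrite normrM gtr0_norm// mulrC ltr_pdivrMr// mul1r.
  near: n; exists (Num.truncn `|x - z|) => // n /= hn.
  by apply: lt_le_trans (truncnS_gt _) _; rewrite ler_nat.
rewrite ltr_norml in pn; case/andP: pn => pn1 pn2.
have [xz|xz|->] := ltgtP x z.
- rewrite -oppr_gt0 -sinN sin_gt0_pi// ltrNl pn1 andbT -mulrN mulr_gt0//.
  by rewrite oppr_gt0 subr_lt0.
- by apply/negbTE; rewrite -leNgt ltW// sin_gt0_pi// pn2 andbT mulr_gt0// subr_gt0.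
- by rewrite subrr mulr0 sin0 ltxx.
Unshelve. all: by end_near. Qed.

End laplace_indicator.

(** * Laws on the space of continuous paths *)

Section weighted_law.
Import HBSimple HBNNSimple.
Context (R : realType) d1 d2 d0 (T1 : measurableType d1) (T2 : measurableType d2)
  (T0 : measurableType d0).
Variables (m1 : {measure set T1 -> \bar R}) (m2 : {measure set T2 -> \bar R}).
Variables (w1 : T1 -> R) (w2 : T2 -> R) (X1 : T1 -> T0) (X2 : T2 -> T0).
Hypotheses (w1_ge0 : forall x, 0 <= w1 x) (w2_ge0 : forall x, 0 <= w2 x).
Hypotheses (mw1 : measurable_fun setT w1) (mw2 : measurable_fun setT w2).
Hypotheses (mX1 : measurable_fun setT X1) (mX2 : measurable_fun setT X2).

(** Simple functions increase to [F], and their integrals are combinations of weighted masses of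
    preimages. Laws given by a density are covered as well, the density being the weight. *)
Lemma eq_weighted_integral (F : T0 -> \bar R) :
  (forall A, measurable A ->
    (\int[m1]_(x in X1 @^-1` A) (w1 x)%:E = \int[m2]_(x in X2 @^-1` A) (w2 x)%:E)%E) ->
  measurable_fun setT F -> (forall x, (0 <= F x)%E) ->
  (\int[m1]_x ((w1 x)%:E * F (X1 x)) = \int[m2]_x ((w2 x)%:E * F (X2 x)))%E.
Proof.
move=> eqA mF F0.
have [g [gnd gF]] := approximation measurableT mF (fun x _ => F0 x).
have conv d (T : measurableType d) (m : {measure set T -> \bar R}) (w : T -> R)
    (X : T -> T0) : (forall x, 0 <= w x) -> measurable_fun setT w ->
    measurable_fun setT X ->
    (\int[m]_x ((w x)%:E * (g n (X x))%:E) @[n --> \oo] --> \int[m]_x ((w x)%:E * F (X x)))%E /\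
    forall n, (\int[m]_x ((w x)%:E * (g n (X x))%:E) = \sum_(y \in range (g n))
      (y%:E * \int[m]_(x in X @^-1` (g n @^-1` [set y])) (w x)%:E))%E.
  move=> w0 mw mX.
  have mgX n : measurable_fun setT (fun x => ((w x)%:E * (g n (X x))%:E)%E).
    apply: emeasurable_funM => //; apply/measurable_EFinP => //.
    by apply: measurableT_comp => //; exact: measurable_funPT.
  split.
    have -> : (fun x => ((w x)%:E * F (X x))%E) =
              (fun x => limn (fun n => ((w x)%:E * (g n (X x))%:E)%E)).
      apply/funext => x; apply/esym/cvg_lim => //.
      by apply: cvgeZl => //; exact: gF.
    apply: cvg_monotone_convergence => //.
    - by move=> n x _; rewrite mule_ge0// lee_fin// fun_ge0.
    - by move=> x _ a b ab; rewrite -!EFinM lee_fin ler_wpM2l//; exact/lefP/gnd.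
  move=> n.
  have mpre y : measurable (X @^-1` (g n @^-1` [set y])).
    rewrite -[X in measurable X]setTI; apply: mX => //.
  transitivity (\int[m]_x (\sum_(y \in range (g n))
      (y%:E * ((w x)%:E * (\1_(X @^-1` (g n @^-1` [set y])) x)%:E))))%E.
    apply: eq_integral => x _; rewrite [in LHS]fimfunE.
    rewrite -fsumEFin; last exact: fimfunP.
    rewrite ge0_mule_fsumr; last first.
      move=> y; rewrite lee_fin indicE; case: (boolP (_ \in _)); last by rewrite mulr0.
      by rewrite inE/= => <-; rewrite mulr1 fun_ge0.
    by apply: eq_fsbigr => y _; rewrite EFinM muleCA.
  rewrite ge0_integral_fsum//=.
  - apply: eq_fsbigr => y; rewrite inE => -[z _ <-].
    have mI : measurable_fun setT (fun x : T => (w x)%:E * (\1_(X @^-1` (g n @^-1` [set g n z])) x)%:E)%E.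
      by apply: emeasurable_funM => //; exact/measurable_EFinP.
    rewrite ge0_integralZl_EFin//=.
      congr (_ * _)%E; rewrite [RHS]integral_mkcond.
      apply: eq_integral => x _; rewrite patchE indicE.
      by case: ifP => _; rewrite ?mule1 ?mule0.
    by move=> x _; rewrite mule_ge0// lee_fin.
  - move=> y; apply: emeasurable_funM => //; apply: emeasurable_funM => //.
      exact/measurable_EFinP.
    exact/measurable_EFinP.
  - move=> y x _; rewrite muleCA mule_ge0 ?lee_fin//.
    rewrite indicE; case: (boolP (_ \in _)); last by rewrite mulr0.
    by rewrite inE/= => <-; rewrite mulr1 fun_ge0.
have [c1 e1] := conv _ _ m1 w1 X1 w1_ge0 mw1 mX1.
have [c2 e2] := conv _ _ m2 w2 X2 w2_ge0 mw2 mX2.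
suff E : (fun n => \int[m1]_x ((w1 x)%:E * (g n (X1 x))%:E))%E =
         (fun n => \int[m2]_x ((w2 x)%:E * (g n (X2 x))%:E))%E.
  by rewrite E in c1; exact: (cvg_unique _ c1 c2).
apply/funext => n; rewrite e1 e2; apply: eq_fsbigr => y _; congr (_ * _)%E.
exact/eqA/measurable_funPTI.
Qed.

End weighted_law.

Section path_space.
Variable R : realType.

(** Continuity is built into the points of the space, so that countably many evaluations decide
    suprema over arbitrary time sets. *)
Record path := Path { path_fun :> R -> R ; path_continuous : continuous path_fun }.

HB.instance Definition _ := gen_eqMixin path.
HB.instance Definition _ := gen_choiceMixin path.

Lemma path0_continuous : continuous (fun _ : R => 0 : R).
Proof. by move=> x; exact: cvg_cst. Qed.

HB.instance Definition _ := isPointed.Build path (Path path0_continuous).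

Lemma pathP (x y : path) : x =1 y -> x = y.
Proof.
case: x y => [x cx] [y cy] /= /funext xy; rewrite xy in cx *.
by congr Path; exact: Prop_irrelevance.
Qed.

(** Each pair is (bound, time). With lists, intersection is concatenation, which makes these sets a
    pi-system. *)
Definition cylinder (s : seq (R * R)) : set path :=
  [set x | all (fun c => x c.2 < c.1) s].

Definition cylinders : set (set path) := range cylinder.

Let sigmaC (A : set path) : <<s cylinders >> A -> <<s cylinders >> (~` A).
Proof. by move=> sA; rewrite -setTD; exact: sigma_algebraCD. Qed.

HB.instance Definition _ := @isMeasurable.Build (sigma_display cylinders) path
  <<s cylinders >> (@sigma_algebra0 _ setT cylinders) sigmaC
  (@sigma_algebra_bigcup _ setT cylinders).

Lemma measurable_cylinder s : measurable (cylinder s).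
Proof. by apply: sub_sigma_algebra; exists s. Qed.

Lemma measurable_eval t : measurable_fun setT (fun x : path => x t).
Proof.
apply: (measurability _ (RGenInftyO.measurableE R)) => //.
move=> _ [_ [z ->] <-]; rewrite setTI.
rewrite (_ : _ @^-1` _ = cylinder [:: (z, t)]); first exact: measurable_cylinder.
by apply/seteqP; split => x /=; rewrite /cylinder/= in_itv/= andbT.
Qed.

Lemma measurable_path d (T : measurableType d) (X : T -> path) :
  (forall t, measurable_fun setT (fun w => X w t)) -> measurable_fun setT X.
Proof.
move=> mX; apply: (@measurability _ _ _ _ _ _ cylinders) => // _ [_ [s _ <-] <-].
rewrite setTI; elim: s => [|c s IH].
  rewrite (_ : _ @^-1` _ = setT)//.
  by apply/seteqP; split.
rewrite (_ : _ @^-1` _ = (fun w => X w c.2) @^-1` `]-oo, c.1[ `&` X @^-1` cylinder s).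
  apply: measurableI => //; rewrite -[X in measurable X]setTI; exact: mX.
apply/seteqP; split => x /=; rewrite /cylinder/= in_itv/=.
  by move=> /andP.
by move=> [-> ->].
Qed.

End path_space.
Arguments path : clear implicits.

(** * Path laws determined by finite-dimensional Laplace transforms *)

Section path_uniqueness.
Context (R : realType) d1 d2 (T1 : measurableType d1) (T2 : measurableType d2).
Variables (m1 : {measure set T1 -> \bar R}) (m2 : {measure set T2 -> \bar R}).
Variables (w1 : T1 -> R) (w2 : T2 -> R) (X1 : T1 -> path R) (X2 : T2 -> path R).
Hypotheses (w1_ge0 : forall x, 0 <= w1 x) (w2_ge0 : forall x, 0 <= w2 x).
Hypotheses (mw1 : measurable_fun setT w1) (mw2 : measurable_fun setT w2).
Hypotheses (mX1 : measurable_fun setT X1) (mX2 : measurable_fun setT X2).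

(** Each pair is (coefficient, time); the integrals of [e^(linear_form e)] are the Laplace
    transforms of the finite-dimensional marginals. *)
Definition linear_form (e : seq (R * R)) (x : path R) : R :=
  \sum_(p <- e) p.1 * x p.2.

Hypothesis laplace : forall e : seq (R * R),
  [/\ m1.-integrable setT (fun x => (w1 x * expR (linear_form e (X1 x)))%:E),
      m2.-integrable setT (fun x => (w2 x * expR (linear_form e (X2 x)))%:E) &
      (\int[m1]_x (w1 x * expR (linear_form e (X1 x)))%:E =
       \int[m2]_x (w2 x * expR (linear_form e (X2 x)))%:E)%E].

Let ind (s : seq (R * R)) (x : path R) : R := (x \in cylinder s)%:R.

(** One constraint is added at a time by the one-dimensional theorem, the earlier constraints
    sitting in the weight. The free form [e] is what the induction needs: prepending [(a, t)] to it
    produces the Laplace transform in the coordinate [t]. *)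
Let laplace_cylinder s e :
  [/\ m1.-integrable setT (fun x => (w1 x * ind s (X1 x) * expR (linear_form e (X1 x)))%:E),
      m2.-integrable setT (fun x => (w2 x * ind s (X2 x) * expR (linear_form e (X2 x)))%:E) &
      (\int[m1]_x (w1 x * ind s (X1 x) * expR (linear_form e (X1 x)))%:E =
       \int[m2]_x (w2 x * ind s (X2 x) * expR (linear_form e (X2 x)))%:E)%E].
Proof.
elim: s e => [|c s IH] e.
  have E T (w : T -> R) (X : T -> path R) :
      (fun x => (w x * ind [::] (X x) * expR (linear_form e (X x)))%:E) =
      (fun x => (w x * expR (linear_form e (X x)))%:E).
    by apply/funext => x; rewrite /ind mem_set// mulr1.
  by rewrite !E; exact: laplace.
have E T (w : T -> R) (X : T -> path R) :
    (fun x => (w x * ind (c :: s) (X x) * expR (linear_form e (X x)))%:E) =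
    (fun x => (w x * ind s (X x) * expR (linear_form e (X x)) * (X x c.2 < c.1)%R%:R)%:E).
  apply/funext => x; congr (_%:E).
  rewrite -!mulrA; congr (_ * _); rewrite mulrCA mulrC; congr (_ * _).
  rewrite /ind -natrM mulnb; congr (_%:R); congr nat_of_bool.
  apply/idP/idP; rewrite inE /cylinder/=.
    by move=> /andP[-> ?]; rewrite mem_set.
  by move=> /andP[]; rewrite inE => ? ->.
have := @same_integral_lt _ _ _ _ _ m1 m2
  (fun x => w1 x * ind s (X1 x) * expR (linear_form e (X1 x))) (fun x => X1 x c.2)
  (fun x => w2 x * ind s (X2 x) * expR (linear_form e (X2 x))) (fun x => X2 x c.2).
rewrite !E; apply.
- by move=> x; rewrite !mulr_ge0// ?expR_ge0// ler0n.
- by move=> x; rewrite !mulr_ge0// ?expR_ge0// ler0n.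
move=> a; have := IH ((a, c.2) :: e); rewrite /same_integral.
have E' T (w : T -> R) (X : T -> path R) :
    (fun x => (w x * ind s (X x) * expR (linear_form ((a, c.2) :: e) (X x)))%:E) =
    (fun x => (w x * ind s (X x) * expR (linear_form e (X x)) * expR (a * X x c.2))%:E).
  apply/funext => x; congr (_%:E); rewrite -!mulrA; congr (_ * (_ * _)).
  by rewrite /linear_form big_cons addrC expRD.
by rewrite !E'.
Qed.

Let int_w : (m1.-integrable setT (fun x => (w1 x)%:E) /\
  m2.-integrable setT (fun x => (w2 x)%:E)) /\
  (\int[m1]_x (w1 x)%:E = \int[m2]_x (w2 x)%:E)%E.
Proof.
have E T (w : T -> R) (X : T -> path R) :
    (fun x => (w x * expR (linear_form [::] (X x)))%:E) = (fun x => (w x)%:E).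
  by apply/funext => x; rewrite /linear_form big_nil expR0 mulr1.
by have := laplace [::]; rewrite !E => -[].
Qed.

Lemma setI_closed_cylinders : setI_closed (@cylinders R).
Proof.
move=> _ _ [s _ <-] [s' _ <-]; exists (s ++ s') => //.
by apply/seteqP; split => x; rewrite /cylinder/= all_cat => /andP.
Qed.

(** Dynkin's argument from the pi-system of cylinders; the empty linear form shows that both weights
    have finite and equal total mass, as complements require. *)
Let law_eq (A : set (path R)) : measurable A ->
  (\int[m1]_(x in X1 @^-1` A) (w1 x)%:E = \int[m2]_(x in X2 @^-1` A) (w2 x)%:E)%E.
Proof.
have [[iw1 iw2] iE] := int_w.
move: A; apply: (@dynkin_induction _ (path R) (@cylinders R) (fun A =>
  \int[m1]_(x in X1 @^-1` A) (w1 x)%:E = \int[m2]_(x in X2 @^-1` A) (w2 x)%:E)%E) => //.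
- exact: setI_closed_cylinders.
- move=> _ [s _ <-].
  have E d (T : measurableType d) (m : {measure set T -> \bar R}) (w : T -> R) (X : T -> path R) :
      (\int[m]_(x in X @^-1` cylinder s) (w x)%:E =
       \int[m]_x (w x * ind s (X x) * expR (linear_form [::] (X x)))%:E)%E.
    rewrite integral_mkcond; apply: eq_integral => x _.
    rewrite patchE /ind /linear_form big_nil expR0 mulr1.
    rewrite (_ : (x \in _) = (X x \in cylinder s)).
      by case: ifP => _; rewrite ?mulr1 ?mulr0.
    by apply/idP/idP; rewrite !inE.
  by rewrite !E; case: (laplace_cylinder s [::]).
- move=> S mS h.
  have E d (T : measurableType d) (m : {measure set T -> \bar R}) (w : T -> R) (X : T -> path R) :
      (forall x, 0 <= w x) ->
      measurable_fun setT X -> m.-integrable setT (EFin \o w) ->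
      (\int[m]_(x in X @^-1` (~` S)) (w x)%:E =
       \int[m]_x (w x)%:E - \int[m]_(x in X @^-1` S) (w x)%:E)%E.
    move=> w0 mX iw.
    have mXS : measurable (X @^-1` S) by rewrite -[X in measurable X]setTI; exact: mX.
    rewrite -preimage_setC -(setUv (X @^-1` S)) ge0_integral_setU//=.
    + rewrite [X in (_ = X - _)%E]addeC addeK//; apply: integrable_fin_num => //.
      exact: integrableS iw.
    + exact: measurableC.
    + by rewrite setUv; exact: measurable_int iw.
    + by move=> x _; rewrite lee_fin.
    + by apply/disj_setPS; rewrite setICr.
  rewrite !E//; congr (_ - _)%E => //.
- move=> F mF tF h.
  have E d (T : measurableType d) (m : {measure set T -> \bar R}) (w : T -> R) (X : T -> path R) :
      (forall x, 0 <= w x) ->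
      measurable_fun setT X -> measurable_fun setT w ->
      (\int[m]_(x in X @^-1` (\bigcup_k F k)) (w x)%:E =
       \sum_(k <oo) \int[m]_(x in X @^-1` F k) (w x)%:E)%E.
    move=> w0 mX mw.
    rewrite preimage_bigcup ge0_integral_bigcup//=.
    + by move=> k; rewrite -[X in measurable X]setTI; exact: mX.
    + by apply/measurable_funTS/measurable_EFinP.
    + by move=> x _; rewrite lee_fin.
    + by apply/trivIsetP => i j _ _ ij; rewrite -preimage_setI; move/trivIsetP: tF => ->//; exact: preimage_set0.
  by rewrite !E//; apply: eq_eseriesr => k _; exact: h.
Qed.

Theorem path_law_unique (F : path R -> \bar R) :
  measurable_fun setT F -> (forall x, (0 <= F x)%E) ->
  (\int[m1]_x ((w1 x)%:E * F (X1 x)) = \int[m2]_x ((w2 x)%:E * F (X2 x)))%E.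
Proof. by move=> mF F0; apply: eq_weighted_integral. Qed.

End path_uniqueness.

(** * Measurable functionals of a path *)

Section countable_esum.
Context (R : realType).

(** One enumeration serves every family [a], so a sum depending on a path becomes a series for all
    paths simultaneously, and measurability and Tonelli for series apply. *)
Lemma esum_countable (J : set R) : countable J ->
  exists (e : nat -> R) (P : pred nat), forall a : R -> \bar R,
    (forall t, 0 <= a t)%E ->
    (\esum_(t in J) a t = \sum_(k <oo) (if P k then a (e k) else 0))%E.
Proof.
move=> /countable_bijP[B]; rewrite card_eq_sym => /card_set_bijP[e bij].
exists e, (mem B) => a a0.
rewrite (@reindex_esum _ _ _ _ _ _ _ bij) nneseries_esumT; last by move=> n; case: ifP.
by rewrite esum_mkcond; apply: eq_esum => i _; rewrite inE.
Qed.

Context d (T : measurableType d) (mu : {measure set T -> \bar R}).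
Variables (J : set R) (f : R -> T -> \bar R).
Hypotheses (cJ : countable J) (f0 : forall t x, (0 <= f t x)%E)
  (mf : forall t, measurable_fun setT (f t)).

Lemma measurable_esum : measurable_fun setT (fun x => \esum_(t in J) f t x)%E.
Proof.
have [e [P eP]] := esum_countable cJ.
under eq_fun do rewrite eP//.
apply: ge0_emeasurable_sum => [k x _ _|k _]; first by case: ifP.
by case: (P k) => //; exact: mf.
Qed.

Lemma integral_esum :
  (\int[mu]_x (\esum_(t in J) f t x) = \esum_(t in J) \int[mu]_x f t x)%E.
Proof.
have [e [P eP]] := esum_countable cJ.
under eq_integral do rewrite eP//.
rewrite integral_nneseries//; first last.
  by move=> k x _; case: ifP.
  by move=> k; case: (P k) => //; exact: mf.
rewrite eP; last by move=> t; exact: integral_ge0.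
by apply: eq_eseriesr => k _; case: ifP => // _; rewrite integral0.
Qed.

End countable_esum.

Section lattices.
Context (R : realType).
Implicit Types (b t : R) (a : R -> \bar R).

Lemma lattice_countable b : b != 0 -> countable (lattice b).
Proof.
move=> b0; apply: (@sub_countable _ _ _ [set b * z%:~R | z in [set: int]]).
  apply: subset_card_le => t [/eqP|[z ->]]; first by rewrite (negbTE b0).
  by exists z.
by apply: (sub_countable (card_image_le _ _)); exact: countableP.
Qed.

Lemma latticeD b s t : lattice b s -> lattice b t -> lattice b (s + t).
Proof.
move=> [->|[z ->]]; first by left.
by move=> [->|[z' ->]]; [left|right; exists (z + z'); rewrite intrD mulrDr].
Qed.

Lemma latticeN b t : lattice b t -> lattice b (- t).
Proof. by move=> [->|[z ->]]; [left|right; exists (- z); rewrite intrN mulrN]. Qed.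

Lemma lattice0 b : lattice b 0.
Proof. by right; exists 0; rewrite mulr0. Qed.

Lemma esum_latticeD b t a : lattice b t ->
  (\esum_(s in lattice b) a (s + t)%R = \esum_(s in lattice b) a s)%E.
Proof.
move=> bt; apply/esym; apply: (@reindex_esum _ _ _ _ _ (fun s => s + t)).
split.
- by move=> s bs; exact: latticeD.
- by move=> s s' _ _; exact: addIr.
- by move=> s bs /=; exists (s - t); [apply: latticeD => //; exact: latticeN|rewrite subrK].
Qed.

Lemma esum_latticeN b a :
  (\esum_(s in lattice b) a (- s)%R = \esum_(s in lattice b) a s)%E.
Proof.
apply/esym; apply: (@reindex_esum _ _ _ _ _ (fun s => - s)).
split.
- by move=> s bs; exact: latticeN.
- by move=> s s' _ _; exact: oppr_inj.
- by move=> s bs /=; exists (- s); [exact: latticeN|rewrite opprK].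
Qed.

End lattices.

(** * Measurability of suprema, sums and integrals along a path *)

Section path_functionals.
Context (R : realType).
Implicit Types (x y : path R) (t h c : R) (D : set R).

Definition eval_path t x : R := x t.

(** Although [D] is arbitrary, one point of [D] chosen in each rational interval that meets it
    suffices: by continuity, an open condition holding at a point of [D] holds at a chosen point
    nearby. *)
Lemma measurable_exists (D O : set R) : open O ->
  measurable [set x : path R | exists2 t, D t & O (x t)].
Proof.
move=> oO.
pose I (p : rat * rat) := D `&` [set t | ratr p.1 < t < ratr p.2].
rewrite (_ : [set _ | _] = \bigcup_p
    (if pselect (I p !=set0) then [set x : path R | O (x (xget 0 (I p)))] else set0)).
  apply: countable_bigcupT_measurable => [|p]; first exact: countableP.
  case: pselect => //= ?; rewrite -[X in measurable X]setTI.
  by apply: measurable_eval => //; exact: open_measurable.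
apply/seteqP; split => x /=; last first.
  move=> [p _]; case: pselect => //= -[t It] h; exists (xget 0 (I p)) => //.
  by have [] := xgetPex 0 (ex_intro _ t It).
move=> [t Dt Ot].
have : nbhs t (x @^-1` O) by apply: path_continuous; exact: open_nbhs_nbhs.
rewrite -nbhs_ballE => -[e /= e0 he].
have [p /andP[p1 p2]] : exists p, t - e < ratr p < t.
  by have [q] := @rat_in_itvoo R (t - e) t ltac:(by rewrite gtrBl); rewrite in_itv/=; exists q.
have [q /andP[q1 q2]] : exists q, t < ratr q < t + e.
  by have [q] := @rat_in_itvoo R t (t + e) ltac:(by rewrite ltrDl); rewrite in_itv/=; exists q.
exists (p, q) => //.
have It : I (p, q) t by split => //=; rewrite p2 q1.
case: pselect => [?|]/=; last by case; exists t.
have [_ /= /andP[h1 h2]] := xgetPex 0 (ex_intro _ t It).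
apply: he; rewrite /ball/= ltr_norml; apply/andP; split; lra.
Qed.

Lemma measurable_ereal_sup_path (g : R -> R) D : continuous g ->
  measurable_fun setT (fun x : path R => ereal_sup [set (g (x t))%:E | t in D]).
Proof.
move=> cg; apply: (measurability _ (ErealGenOInfty.measurableE R)) => //.
move=> _ [_ [z ->] <-]; rewrite setTI.
rewrite (_ : _ @^-1` _ = [set x : path R | exists2 t, D t & (g @^-1` `]z, +oo[) (x t)]).
  apply: measurable_exists; apply: open_comp; last exact: interval_open.
  by move=> r _; exact: cg.
apply/seteqP; split => x /=; rewrite in_itv/= andbT.
  by move=> /ereal_sup_gt[_ [t Dt <-]]; rewrite lte_fin => ?; exists t => //; rewrite in_itv/= andbT.
move=> [t Dt]; rewrite in_itv/= andbT => zt.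
apply: (@lt_le_trans _ _ (g (x t))%:E); first by rewrite lte_fin.
by apply: ereal_sup_ubound; exists t.
Qed.

Lemma measurable_path_sup D : measurable_fun setT (path_sup eval_path D).
Proof. by apply: measurable_ereal_sup_path; exact: continuous_expR. Qed.

(** Freezing time at the grid point just below it gives a map that is measurable on each strip;
    continuity of the path lets the mesh tend to 0. This gives Tonelli access to time and path
    jointly. *)
Lemma measurable_joint_eval : measurable_fun setT (fun p : R * path R => p.2 p.1).
Proof.
pose f n (p : R * path R) := p.2 ((Num.floor (p.1 * n.+1%:R))%:~R / n.+1%:R).
apply: (@measurable_fun_cvg _ _ _ _ f).
  move=> n; move=> _ Y mY; rewrite setTI.
  rewrite (_ : _ @^-1` _ = \bigcup_(k : int)
     ([set t : R | k%:~R <= t * n.+1%:R < (k + 1)%:~R] `*`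
      [set x : path R | Y (x (k%:~R / n.+1%:R))])).
    apply: countable_bigcupT_measurable => [|k]; first exact: countableP.
    apply: measurableX.
      rewrite (_ : [set _ | _] = [set` `[k%:~R / n.+1%:R, (k + 1)%:~R / n.+1%:R[ ])//.
      by apply/seteqP; split => t /=; rewrite in_itv/= ler_pdivrMr// ltr_pdivlMr.
    by rewrite -[X in measurable X]setTI; exact: measurable_eval.
  apply/seteqP; split => [[t x]|[t x]] /=; rewrite /f/=.
    by move=> h; exists (Num.floor (t * n.+1%:R)) => //; split => //=; exact: floor_itv.
  by move=> [k _ [/= /floor_def <-]].
move=> [t x] _; rewrite /f/=.
apply: (cvg_comp _ (x : R -> R)); last exact: path_continuous.
apply: (@squeeze_cvgr _ _ _ _ (fun n => t - n.+1%:R^-1) (cst t)).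
- near=> n; have n0 : 0 < n.+1%:R :> R by [].
  have /andP[h1 h2] := floor_itv (t * n.+1%:R).
  rewrite ler_pdivlMr// ler_pdivrMr// h1 andbT mulrBl mulVf ?gt_eqF//.
  by rewrite lerBlDr ltW// -intrD1.
- rewrite -[X in _ --> X](subr0 t); apply: cvgB; first exact: cvg_cst.
  exact: cvg_harmonic.
- exact: cvg_cst.
Unshelve. all: by end_near. Qed.

Lemma measurable_path_integral :
  measurable_fun setT (fun x : path R => \int[lebesgue_measure]_t (expR (x t))%:E)%E.
Proof.
apply: (@measurable_fun_fubini_tonelli_G _ _ (measurableTypeR R) (path R) R
  lebesgue_measure (fun p => (expR (p.2 p.1))%:E)).
- apply/measurable_EFinP; apply: measurableT_comp => //.
  exact: measurable_joint_eval.
- by move=> p; rewrite lee_fin expR_ge0.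
Qed.

Lemma measurable_path_sum b : measurable_fun setT (path_sum eval_path b).
Proof.
have [->|b0] := eqVneq b 0.
  by rewrite /path_sum eqxx; exact: measurable_path_integral.
rewrite /path_sum (negbTE b0).
apply: measurable_funeM; apply: measurable_esum; first exact: lattice_countable.
- by move=> t x; rewrite lee_fin expR_ge0.
- move=> t; apply/measurable_EFinP; apply: measurableT_comp => //.
  exact: measurable_eval.
Qed.

Lemma shift_path_continuous h x : continuous (fun t => x (t + h)).
Proof.
move=> t; apply: (@continuous_comp _ _ _ (fun t => t + h) x); last exact: path_continuous.
by apply: (@cvgD _ R^o); [exact: cvg_id|exact: cvg_cst].
Qed.
Definition shift_path h x := Path (@shift_path_continuous h x).

Lemma addc_path_continuous c x : continuous (fun t => x t + c).
Proof. by move=> t; apply: (@cvgD _ R^o); [exact: path_continuous|exact: cvg_cst]. Qed.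
Definition addc_path c x := Path (@addc_path_continuous c x).

Lemma comb_path_continuous (a b : R) x y : continuous (fun t => a * x t + b * y t).
Proof.
move=> t; apply: (@cvgD _ R^o).
  by apply: cvgMr; exact: path_continuous.
by apply: cvgMr; exact: path_continuous.
Qed.
Definition comb_path a b x y := Path (@comb_path_continuous a b x y).

Lemma measurable_shift_path h : measurable_fun setT (shift_path h).
Proof. by apply: measurable_path => t; exact: measurable_eval. Qed.

Lemma measurable_tilt_path h : measurable_fun setT
  (fun x => addc_path (- x h) (shift_path h x)).
Proof.
apply: measurable_path => t /=.
by apply: measurable_funB; exact: measurable_eval.
Qed.

End path_functionals.

(** * Gaussian variables *)

Section gaussian_moments.
Context (R : realType) d (T : measurableType d) (P : probability T R).
Variable (Y : T -> R).
Hypothesis mY : measurable_fun setT Y.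

(** Completing the square: the exponential factor translates the mean by [a s^2]. *)
Lemma normal_pdf_tilt (m s a x : R) : s != 0 ->
  normal_pdf m s x * expR (a * x) =
  expR (a * m + a ^+ 2 * s ^+ 2 / 2) * normal_pdf (m + a * s ^+ 2) s x.
Proof.
move=> s0; rewrite /normal_pdf (negbTE s0) -[LHS]mulrA [RHS]mulrCA; congr (_ * _).
rewrite /normal_fun -!expRD; congr expR.
by field.
Qed.

Lemma gaussian_mgf (m s : R) (a : R) :
  (forall A, measurable A -> pushforward P Y A = gaussian_law m s A) ->
  (\int[P]_w (expR (a * Y w))%:E = (expR (a * m + a ^+ 2 * s ^+ 2 / 2))%:E)%E.
Proof.
move=> law.
have mf : measurable_fun [set: R] (fun x : R => (expR (a * x))%:E).
  by apply/measurable_EFinP; apply: measurableT_comp => //; exact: measurable_funM.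
have f0 (x : R) : (0 <= (expR (a * x))%:E)%E by rewrite lee_fin expR_ge0.
have mYA (A : set R) : measurable A -> measurable (Y @^-1` A).
  by move=> mA; rewrite -[X in measurable X]setTI; exact: mY.
transitivity (\int[P]_x ((1 : R)%:E * (expR (a * Y x))%:E))%E.
  by apply: eq_integral => x _; rewrite mul1e.
have [s0|s0] := eqVneq s 0.
  rewrite (@eq_weighted_integral R _ _ _ _ _ _
    P (\d_m : {measure set R -> \bar R}) (fun=> 1) (fun=> 1) Y id _ _ _ _ _ _ (fun x => (expR (a * x))%:E))//.
    under eq_integral do rewrite mul1e.
    by rewrite integral_dirac// diracT mul1e s0 expr0n mulr0 mul0r addr0.
  move=> A mA; rewrite preimage_id !integral_cst//=; last exact: mYA.
  rewrite !mul1e; have := law _ mA.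
  by rewrite /gaussian_law s0 eqxx.
rewrite (@eq_weighted_integral R _ _ _ _ _ _
  P lebesgue_measure (fun=> 1) (normal_pdf m s) Y id _ _ _ _ _ _ (fun x => (expR (a * x))%:E))//; first last.
- move=> A mA; rewrite preimage_id !integral_cst//=; last exact: mYA.
  rewrite mul1e; have := law _ mA.
  by rewrite /gaussian_law (negbTE s0).
- exact: measurable_normal_pdf.
- exact: normal_pdf_ge0.
under eq_integral do rewrite -EFinM normal_pdf_tilt// EFinM.
rewrite ge0_integralZl_EFin//.
- by rewrite integral_normal_pdf mule1.
- by move=> x _; rewrite lee_fin normal_pdf_ge0.
- by apply/measurable_EFinP; exact: measurable_normal_pdf.
Qed.

Lemma expR_ge1Dx2 (x : R) : 0 <= x -> 1 + x + x ^+ 2 / 2 <= expR x.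
Proof.
move=> x0; apply: (@le_trans _ _ (series (exp_coeff x) 3)).
  rewrite seriesEord /= !big_ord_recl big_ord0 /exp_coeff /= /bump/= expr0 expr1 addr0 addrA.
  by rewrite !fact0 (_ : 2`! = 2)%N// !divr1.
apply: nondecreasing_cvgn_le; last exact: is_cvg_series_exp_coeff.
by apply: nondecreasing_series => k _ _; exact: exp_coeff_ge0.
Qed.

Lemma sinh_ge (x : R) : 0 <= x -> 2 * x <= expR x - expR (- x).
Proof.
move=> x0; have := expR_ge1Dx2 x0; rewrite expRN; set p := expR x => hp.
have p0 : 0 < p := expR_gt0 x.
suff : 2 * x * p <= p ^+ 2 - 1.
  by move=> h; rewrite -(ler_pM2r p0) mulrBl mulVf ?gt_eqF//; rewrite expr2 in h; lra.
(* This product is [(p - x)^2 - (1 + x^2 / 2)^2], so [(p - x)^2 >= 1 + x^2], which is the claim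
   after expanding. *)
have : 0 <= (p - (1 + x + x ^+ 2 / 2)) * (p - x + (1 + x ^+ 2 / 2)).
  by rewrite mulr_ge0//; nra.
have : 0 <= x ^+ 4 by rewrite exprn_ge0.
nra.
Qed.

(** The excess over 2 is the square of [e^(x/2) - e^(- x/2)], bounded below by [sinh_ge] at half the
    argument. *)
Lemma cosh_ge (x : R) : 2 + x ^+ 2 <= expR x + expR (- x).
Proof.
suff h (y : R) : 0 <= y -> 2 + y ^+ 2 <= expR y + expR (- y).
  have [x0|x0] := ger0P x; first exact: h.
  by have := h (- x); rewrite opprK sqrrN [expR (- x) + _]addrC; apply; rewrite oppr_ge0 ltW.
move=> y0; have := @sinh_ge (y / 2) ltac:(by rewrite divr_ge0).
have -> : expR y = expR (y / 2) ^+ 2 by rewrite -expRM_natl; congr expR; field.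
have -> : expR (- y) = expR (- (y / 2)) ^+ 2 by rewrite -expRM_natl; congr expR; field.
have : expR (y / 2) * expR (- (y / 2)) = 1 by rewrite -expRD subrr expR0.
nra.
Qed.

Lemma ler_of_slope (x y C : R) : (forall a, 0 < a <= 1 -> x <= y + a * C) -> x <= y.
Proof.
move=> h; rewrite leNgt; apply/negP => yx.
have C0 : 0 < `|C| + 1 by rewrite ltr_wpDl.
pose a := Num.min 1 ((x - y) / (2 * (`|C| + 1))).
have a0 : 0 < a by rewrite lt_min ltr01 divr_gt0// ?subr_gt0// mulr_gt0.
have := h a; rewrite a0 ge_min lexx/= => /(_ isT).
have : a * C <= a * (`|C| + 1).
  by apply: ler_wpM2l; [exact: ltW|rewrite ler_wpDr// ler_norm].
have : a * (`|C| + 1) <= (x - y) / 2.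
  apply: (@le_trans _ _ ((x - y) / (2 * (`|C| + 1)) * (`|C| + 1))).
    by apply: ler_wpM2r; [exact: ltW|rewrite ge_min lexx orbT].
  by rewrite le_eqVlt; apply/orP; left; apply/eqP; field; rewrite gt_eqF.
lra.
Qed.

(** For [y >= 0] the excess over 2 is [(e^y - 1)^2 / e^y], and [e^y - 1 <= y e^y]. *)
Lemma cosh_le (x : R) : expR x + expR (- x) <= 2 + x ^+ 2 * expR `|x|.
Proof.
suff h (y : R) : 0 <= y -> expR y + expR (- y) <= 2 + y ^+ 2 * expR y.
  have [x0|x0] := ger0P x; first exact: h.
  by have := h (- x); rewrite opprK sqrrN [expR (- x) + _]addrC; apply; rewrite oppr_ge0 ltW.
move=> y0; have h1 := expRB1_le y; have e0 := expR_gt0 y.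
have e1 : 0 <= expR y - 1 by rewrite subr_ge0 -expR0 ler_expR.
have h2 : (expR y - 1) ^+ 2 <= (y * expR y) ^+ 2.
  by rewrite lerXn2r ?nnegrE// mulr_ge0// ltW.
rewrite expRN -(ler_pM2r e0) mulrDl mulVf ?gt_eqF//; nra.
Qed.

Lemma gaussian_integrable : gaussian_variable P Y -> P.-integrable setT (EFin \o Y).
Proof.
move=> [m [s law]].
have mgf a := gaussian_mgf a law.
have mE a : measurable_fun setT (fun w => (expR (a * Y w))%:E).
  by apply/measurable_EFinP; apply: measurableT_comp => //; exact: measurable_funM.
have iE a : P.-integrable setT (fun w => (expR (a * Y w))%:E).
  apply/integrableP; split => //.
  under eq_integral do rewrite gee0_abs ?lee_fin ?expR_ge0//.
  by rewrite mgf ltry.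
apply: (@le_integrable _ _ _ _ _ _ _ (fun w => (expR (1 * Y w) + expR (- 1 * Y w))%:E)) => //.
- exact/measurable_EFinP.
- move=> w _; rewrite /= lee_fin mul1r mulN1r [leRHS]ger0_norm; last by rewrite addr_ge0 ?expR_ge0.
  apply: le_trans (expR_norm_le _).
  by apply: le_trans (expR_ge1Dx _); rewrite lerDr.
- by under eq_fun do rewrite EFinD; apply: integrableD => //; exact: iE.
Qed.

(** The parameters of the law are identified from the moment generating function, with no moment
    integral of the normal density. The mean parameter vanishes because [e^(a Y) >= 1 + a Y]; the
    variance parameter is the second moment by comparing [E (e^(a Y) + e^(- a Y)) = 2 e^(a^2 s^2 /
    2)] with [2 + a^2 E Y^2] to second order as [a] tends to 0. *)
Lemma gaussian_centeredP : gaussian_variable P Y -> ('E_P[Y] = 0)%E ->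
  exists2 v : R, (\int[P]_w (Y w ^+ 2)%:E = v%:E)%E &
    forall a, (\int[P]_w (expR (a * Y w))%:E = (expR (a ^+ 2 * v / 2))%:E)%E.
Proof.
move=> [m [s law]]; rewrite unlock => EY.
have mgf a := gaussian_mgf a law.
have mE a : measurable_fun setT (fun w => (expR (a * Y w))%:E).
  by apply/measurable_EFinP; apply: measurableT_comp => //; exact: measurable_funM.
have iE a : P.-integrable setT (fun w => (expR (a * Y w))%:E).
  apply/integrableP; split => //.
  under eq_integral do rewrite gee0_abs ?lee_fin ?expR_ge0//.
  by rewrite mgf ltry.
have mY2 : measurable_fun setT (fun w => (Y w ^+ 2)%:E).
  by apply/measurable_EFinP; exact: measurable_funX.
have i1 : (\int[P]_w (1 : R)%:E = 1)%E by rewrite integral_cst// mul1e; exact: probability_setT.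
have iY := gaussian_integrable (ex_intro _ m (ex_intro _ s law)).
have m0 : m = 0.
  (* Expectation of [1 + a Y <= e^(a Y)], where [E Y = 0]. *)
  have h a : 0 <= a * m + a ^+ 2 * s ^+ 2 / 2.
    rewrite -ler_expR expR0 -lee_fin -mgf.
    rewrite [leLHS](_ : _ = \int[P]_w ((1 : R)%:E + a%:E * (Y w)%:E))%E; last first.
      rewrite integralD//; last exact: integrableZl.
        by rewrite integralZl// EY mule0 adde0.
      apply/integrableP; split => //.
      by under eq_integral do rewrite gee0_abs ?lee_fin//; rewrite i1 ltry.
    apply: le_integral => //.
    - apply: integrableD => //; last exact: integrableZl.
      apply/integrableP; split => //.
      by under eq_integral do rewrite gee0_abs ?lee_fin//; rewrite i1 ltry.
    - by move=> w _; rewrite -EFinM -EFinD lee_fin expR_ge1Dx.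
  have [s0|s0] := eqVneq s 0.
    have := h m; have := h (- m); rewrite s0 expr0n/= !mulr0 !mul0r !addr0 mulNr.
    by rewrite oppr_ge0 -expr2 => h1 h2; apply/eqP; rewrite -sqrf_eq0 eq_le h1 h2.
  have sp : 0 < s ^+ 2 by rewrite exprn_even_gt0.
  (* The minimizer of the quadratic, where its value is [- m^2 / (2 s^2)]. *)
  have := h (- m / s ^+ 2).
  have -> : - m / s ^+ 2 * m + (- m / s ^+ 2) ^+ 2 * s ^+ 2 / 2 = - (m ^+ 2 / (s ^+ 2 * 2)).
    by field.
  rewrite oppr_ge0 pmulr_lle0 ?invr_gt0 ?(mulr_gt0 sp)// => h1.
  by apply/eqP; rewrite -sqrf_eq0 eq_le h1 sqr_ge0.
rewrite {}m0 in law mgf.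
suff E : (\int[P]_w (Y w ^+ 2)%:E = (s ^+ 2)%:E)%E.
  by exists (s ^+ 2) => // a; rewrite mgf mulr0 add0r.
have up a : (2%:E + (a ^+ 2)%:E * \int[P]_w (Y w ^+ 2)%:E <= (2 * expR (a ^+ 2 * s ^+ 2 / 2))%:E)%E.
  rewrite [leRHS](_ : _ = \int[P]_w ((expR (a * Y w))%:E + (expR (- a * Y w))%:E))%E; last first.
    by rewrite integralD// !mgf sqrrN !mulr0 !add0r -EFinD -mulr2n mulr_natl.
  rewrite [leLHS](_ : _ = \int[P]_w (2%:E + (a ^+ 2)%:E * (Y w ^+ 2)%:E))%E; last first.
    rewrite ge0_integralD//.
    - rewrite integral_cst//= probability_setT mule1 ge0_integralZl_EFin ?sqr_ge0//.
      by move=> x _; rewrite lee_fin sqr_ge0.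
    - by move=> x _; rewrite -EFinM lee_fin mulr_ge0 ?sqr_ge0.
    - exact: emeasurable_funM.
  apply: ge0_le_integral => //.
  - by move=> w _; rewrite -EFinM -EFinD lee_fin addr_ge0// mulr_ge0 ?sqr_ge0.
  - by apply: emeasurable_funD => //; exact: emeasurable_funM.
  - exact: emeasurable_funD.
  - by move=> w _; rewrite -EFinM -!EFinD lee_fin -exprMn mulNr cosh_ge.
have fin : (\int[P]_w (Y w ^+ 2)%:E)%E \is a fin_num.
  rewrite ge0_fin_numE; last by apply: integral_ge0 => w _; rewrite lee_fin sqr_ge0.
  have := up 1; rewrite expr1n mul1e => h.
  apply: le_lt_trans (ltry _); apply: le_trans h.
  by rewrite leeDr// lee_fin.
move: up; rewrite -(fineK fin); set v := fine _ => up.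
have {}up a : a ^+ 2 * v <= 2 * (expR (a ^+ 2 * s ^+ 2 / 2) - 1).
  by have := up a; rewrite -EFinM -EFinD lee_fin; lra.
(* The cubic remainder is controlled by [|Y|^3 <= 3! e^|Y|], and a further [e^|Y|] leads to
   [e^(2 Y) + e^(- 2 Y)], of expectation [2 K]; hence the constant 12. *)
pose K := expR (2 ^+ 2 * s ^+ 2 / 2).
have low a : 0 < a <= 1 -> 2 * (expR (a ^+ 2 * s ^+ 2 / 2) - 1) <= a ^+ 2 * v + a ^+ 3 * (12 * K).
  move=> /andP[a0 a1].
  have a0' := ltW a0.
  have mC : measurable_fun setT (fun w => (a ^+ 3 * 6)%:E *
      ((expR (2 * Y w))%:E + (expR (- 2 * Y w))%:E) : \bar R)%E.
    by apply: emeasurable_funM => //; exact: emeasurable_funD.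
  have mB : measurable_fun setT (fun w => (a ^+ 2)%:E * (Y w ^+ 2)%:E : \bar R)%E.
    exact: emeasurable_funM.
  suff : (\int[P]_w ((expR (a * Y w))%:E + (expR (- a * Y w))%:E) <=
      2%:E + (a ^+ 2 * v)%:E + (a ^+ 3 * (12 * K))%:E)%E.
    rewrite integralD// !mgf sqrrN !mulr0 !add0r -!EFinD lee_fin; lra.
  rewrite [leRHS](_ : _ = \int[P]_w (2%:E + (a ^+ 2)%:E * (Y w ^+ 2)%:E +
     (a ^+ 3 * 6)%:E * ((expR (2 * Y w))%:E + (expR (- 2 * Y w))%:E)))%E; last first.
    rewrite ge0_integralD//; last 3 first.
    - by move=> w _; rewrite -EFinM -EFinD lee_fin addr_ge0// mulr_ge0 ?sqr_ge0.
    - exact: emeasurable_funD.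
    - by move=> w _; rewrite -EFinD -EFinM lee_fin mulr_ge0 ?addr_ge0 ?expR_ge0// mulr_ge0// exprn_ge0.
    rewrite ge0_integralD//; last by move=> x _; rewrite -EFinM lee_fin mulr_ge0 ?sqr_ge0.
    rewrite integral_cst//= probability_setT mule1.
    rewrite ge0_integralZl_EFin ?sqr_ge0//; last first.
      by move=> x _; rewrite lee_fin sqr_ge0.
    rewrite ge0_integralZl_EFin//; last 3 first.
    - by move=> w _; rewrite -EFinD lee_fin addr_ge0 ?expR_ge0.
    - exact: emeasurable_funD.
    - by rewrite mulr_ge0// exprn_ge0.
    rewrite integralD// !mgf sqrrN !mulr0 !add0r -/K -(fineK fin) -/v.
    by rewrite -!EFinD; congr EFin; ring.
  apply: ge0_le_integral => //.
  - by move=> w _; rewrite -EFinD lee_fin addr_ge0 ?expR_ge0.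
  - exact: emeasurable_funD.
  - by apply: emeasurable_funD => //; exact: emeasurable_funD.
  move=> w _; rewrite -!EFinD lee_fin [- a * _]mulNr [- 2 * _]mulNr.
  apply: le_trans (cosh_le _) _.
  rewrite -[leRHS]addrA lerD2l -exprMn.
  set x := a * Y w.
  have e1 : expR `|x| <= 1 + `|x| * expR `|x| by rewrite -lerBlDl; exact: expRB1_le.
  apply: (@le_trans _ _ (x ^+ 2 * (1 + `|x| * expR `|x|))).
    by rewrite ler_wpM2l// sqr_ge0.
  rewrite mulrDr mulr1 lerD2l -real_normK ?num_real// mulrA -exprSr.
  have -> : `|x| ^+ 3 = a ^+ 3 * `|Y w| ^+ 3 by rewrite /x normrM exprMn ger0_norm.
  rewrite -[leLHS]mulrA -[leRHS]mulrA ler_wpM2l ?exprn_ge0//.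
  apply: (@le_trans _ _ (6 * expR `|Y w| * expR `|Y w|)).
    apply: ler_pM; rewrite ?exprn_ge0 ?expR_ge0//.
      exact: (@norm_exp_le_expR _ (Y w) 3).
    by rewrite ler_expR /x normrM ger0_norm// ler_piMl.
  rewrite -[leLHS]mulrA ler_wpM2l// -expRD.
  have -> : `|Y w| + `|Y w| = `|2 * Y w| by rewrite normrM ger0_norm//; ring.
  by rewrite expR_norm_le.
congr EFin; apply/eqP; rewrite eq_le; apply/andP; split.
  apply: (@ler_of_slope _ _ (s ^+ 2 * (s ^+ 2 / 2 * expR (s ^+ 2 / 2)))) => a /andP[a0 a1].
  have ap : 0 < a ^+ 2 by rewrite exprn_gt0.
  have := up a; set u := a ^+ 2 * s ^+ 2 / 2 => h.
  have u0 : 0 <= u by rewrite /u divr_ge0// mulr_ge0 ?sqr_ge0.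
  have us : u <= s ^+ 2 / 2.
    by rewrite /u ler_pM2r// ler_piMl ?sqr_ge0// exprn_ile1// ltW.
  have h1 := expRB1_le u.
  have h2 : v <= s ^+ 2 * expR u.
    rewrite -(ler_pM2l ap); apply: (le_trans h).
    by rewrite (_ : a ^+ 2 * _ = 2 * (u * expR u)) ?ler_pM2l// /u; field.
  apply: (le_trans h2); set D := s ^+ 2 / 2 * _.
  have -> : s ^+ 2 + a * (s ^+ 2 * D) = s ^+ 2 * (1 + a * D) by ring.
  rewrite ler_wpM2l ?sqr_ge0// -lerBlDl; apply: (le_trans h1).
  rewrite /D mulrA; apply: ler_pM; rewrite ?expR_ge0 ?ler_expR//.
  rewrite /u -mulrA ler_wpM2r ?divr_ge0 ?sqr_ge0//.
  by rewrite expr2 ler_piMr// ltW.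
apply: (@ler_of_slope _ _ (12 * K)) => a /andP[a0 a1].
have ap : 0 < a ^+ 2 by rewrite exprn_gt0.
have := low a; rewrite a0 a1 => /(_ isT) h.
have h2 := expR_ge1Dx (a ^+ 2 * s ^+ 2 / 2).
rewrite -(ler_pM2l ap); nra.
Qed.

End gaussian_moments.

(** * Fernique's estimate *)

Section fernique.
Context (R : realType) (Q : probability (path R) R).

Hypothesis gaussQ : forall e : seq (R * R),
  exists2 v : R, (\int[Q]_x (linear_form e x ^+ 2)%:E = v%:E)%E &
    (\int[Q]_x (expR (linear_form e x))%:E = (expR (v / 2))%:E)%E.

Let scale (a : R) (e : seq (R * R)) := [seq (a * p.1, p.2) | p <- e].

Let linear_form_scale a e (x : path R) : linear_form (scale a e) x = a * linear_form e x.
Proof.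
rewrite /linear_form big_map big_distrr/=; apply: eq_bigr => p _.
by rewrite mulrA.
Qed.

Let linear_form_cat e e' (x : path R) :
  linear_form (e ++ e') x = linear_form e x + linear_form e' x.
Proof. by rewrite /linear_form big_cat. Qed.

Let linear_form_comb e a b (x y : path R) :
  linear_form e (comb_path a b x y) = a * linear_form e x + b * linear_form e y.
Proof.
rewrite /linear_form !big_distrr -big_split/=; apply: eq_bigr => p _.
by rewrite mulrDr; congr (_ + _); ring.
Qed.

Lemma measurable_linear_form e : measurable_fun setT (@linear_form R e).
Proof.
rewrite /linear_form; apply: measurable_sum => p.
by apply: measurable_funM => //; exact: measurable_eval.
Qed.

Lemma fubini_tonelli_prod (f g : path R -> \bar R) :
  measurable_fun setT f -> measurable_fun setT g ->
  (forall x, 0 <= f x)%E -> (forall x, 0 <= g x)%E ->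
  (\int[(Q \x Q)]_z (f z.1 * g z.2) = \int[Q]_x f x * \int[Q]_x g x)%E.
Proof.
move=> mf mg f0 g0.
rewrite (@fubini_tonelli1 _ _ _ _ _ Q Q (fun z => f z.1 * g z.2)%E); first last.
- by move=> z; exact: mule_ge0.
- by apply: emeasurable_funM; exact: measurableT_comp.
rewrite /fubini_F/=.
under eq_integral do rewrite ge0_integralZl//.
by rewrite ge0_integralZr// integral_ge0.
Qed.

(** An orthogonal transformation of two independent copies. The triple 3, 4, 5 keeps it rational,
    and with these signs it is its own inverse. *)
Let rotU (z : path R * path R) := comb_path (3 / 5) (4 / 5) z.1 z.2.
Let rotV (z : path R * path R) := comb_path (4 / 5) (- (3 / 5)) z.1 z.2.

Let measurable_rot a b :
  measurable_fun setT (fun z : path R * path R => comb_path a b z.1 z.2).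
Proof.
apply: measurable_path => t /=.
apply: measurable_funD; apply: measurable_funM => //;
  by apply: (measurableT_comp (measurable_eval _)).
Qed.

Let v e := fine (\int[Q]_x (linear_form e x ^+ 2)%:E)%E.

Let vE e : (\int[Q]_x (linear_form e x ^+ 2)%:E = (v e)%:E)%E.
Proof. by rewrite /v; have [w ->] := gaussQ e. Qed.

Let mgf e : (\int[Q]_x (expR (linear_form e x))%:E = (expR (v e / 2))%:E)%E.
Proof. by rewrite /v; have [w -> ->] := gaussQ e. Qed.

Let mE e : measurable_fun setT (fun x : path R => (expR (linear_form e x))%:E).
Proof.
by apply/measurable_EFinP; apply: measurableT_comp => //; exact: measurable_linear_form.
Qed.

Let v_rot e e' : v (scale (3 / 5) e ++ scale (4 / 5) e') +
  v (scale (4 / 5) e ++ scale (- (3 / 5)) e') = v e + v e'.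
Proof.
apply: EFin_inj; rewrite !EFinD -!vE.
have m2 f : measurable_fun setT (fun x : path R => (linear_form f x ^+ 2)%:E).
  by apply/measurable_EFinP; apply: measurable_funX; exact: measurable_linear_form.
have p2 f (x : path R) : (0 <= (linear_form f x ^+ 2)%:E)%E by rewrite lee_fin sqr_ge0.
rewrite -ge0_integralD// -ge0_integralD//.
apply: eq_integral => x _; rewrite -!EFinD !linear_form_cat !linear_form_scale.
by congr EFin; field.
Qed.

Let joint e e' : (\int[(Q \x Q)]_z (expR (linear_form e (rotU z)) *
  expR (linear_form e' (rotV z)))%:E = (expR (v e / 2) * expR (v e' / 2))%:E)%E.
Proof.
transitivity (\int[(Q \x Q)]_z
   ((expR (linear_form (scale (3 / 5) e ++ scale (4 / 5) e') z.1))%:E *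
    (expR (linear_form (scale (4 / 5) e ++ scale (- (3 / 5)) e') z.2))%:E))%E.
  apply: eq_integral => z _; rewrite -EFinM -!expRD /rotU /rotV !linear_form_comb.
  by rewrite !linear_form_cat !linear_form_scale; congr (expR _)%:E; ring.
rewrite (fubini_tonelli_prod (mE _) (mE _)).
- by rewrite !mgf -EFinM -!expRD -!mulrDl v_rot.
- by move=> x; rewrite lee_fin expR_ge0.
- by move=> x; rewrite lee_fin expR_ge0.
Qed.

Let mU : measurable_fun setT rotU. Proof. exact: measurable_rot. Qed.
Let mV : measurable_fun setT rotV. Proof. exact: measurable_rot. Qed.

Let mEr e (X : path R * path R -> path R) : measurable_fun setT X ->
  measurable_fun setT (fun z => expR (linear_form e (X z))).
Proof.
move=> mX; apply: measurableT_comp => //.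
by apply: (measurableT_comp (measurable_linear_form _)).
Qed.

Let intcst (k : R) e : 0 <= k ->
  (Q.-integrable setT (fun x => (k * expR (linear_form e x))%:E)) /\
  (\int[Q]_x (k * expR (linear_form e x))%:E = (k * expR (v e / 2))%:E)%E.
Proof.
move=> k0.
have E : (\int[Q]_x (k * expR (linear_form e x))%:E = (k * expR (v e / 2))%:E)%E.
  under eq_integral do rewrite EFinM.
  by rewrite ge0_integralZl_EFin// mgf.
split => //; apply/integrableP; split.
  by under eq_fun do rewrite EFinM; exact: emeasurable_funM.
under eq_integral do rewrite gee0_abs ?lee_fin ?mulr_ge0 ?expR_ge0//.
by rewrite E ltry.
Qed.

(** The joint Laplace transform of the rotated pair factorizes by orthogonality. Uniqueness is used
    twice: with an exponential of [rotV] as weight it replaces exponentials of [rotU] by the event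
    [A]; with the indicator of [A] as weight it then treats [C]. *)
Lemma rotation_indep (A C : set (path R)) : measurable A -> measurable C ->
  ((Q \x Q) (rotU @^-1` A `&` rotV @^-1` C) = Q A * Q C)%E.
Proof.
move=> mA mC.
have mUA : measurable (rotU @^-1` A) by rewrite -[X in measurable X]setTI; exact: mU.
have mVC : measurable (rotV @^-1` C) by rewrite -[X in measurable X]setTI; exact: mV.
have mI (B : set (path R)) : measurable B ->
    measurable_fun setT (fun x : path R => (\1_B x)%:E : \bar R).
  by move=> mB; apply/measurable_EFinP.
have I0 (B : set (path R)) x : (0 <= (\1_B x)%:E :> \bar R)%E by rewrite lee_fin.
have IA (B : set (path R)) : measurable B -> (\int[Q]_x (\1_B x)%:E = Q B)%E.
  by move=> mB; rewrite integral_indic ?setIT.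
have mid : measurable_fun setT (id : path R -> path R) by [].
have mc (k : R) : measurable_fun setT (fun _ : path R => k) by [].
pose w1 z : R := \1_A (rotU z).
have mw1 : measurable_fun setT w1 by apply: (measurableT_comp (measurable_indic mA)).
have step1 e : (\int[(Q \x Q)]_z (w1 z * expR (linear_form e (rotV z)))%:E =
    (expR (v e / 2))%:E * Q A)%E.
  have := @path_law_unique R _ _ _ _ (Q \x Q)%E Q (fun z => expR (linear_form e (rotV z)))
    (fun=> expR (v e / 2)) rotU id (fun=> expR_ge0 _) (fun=> expR_ge0 _)
    (mEr e mV) (mc _) mU mid _
    (fun x => (\1_A x)%:E) (mI _ mA) (I0 A).
  rewrite /= ge0_integralZl_EFin ?expR_ge0//; last exact: mI.
  rewrite IA// => <-; last first.
    move=> e'; have [i1 i2] := intcst e' (expR_ge0 (v e / 2)).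
    have E : (\int[(Q \x Q)]_z (expR (linear_form e (rotV z)) * expR (linear_form e' (rotU z)))%:E =
        (expR (v e / 2) * expR (v e' / 2))%:E)%E.
      transitivity (expR (v e' / 2) * expR (v e / 2))%:E; last by congr (_%:E); exact: mulrC.
      rewrite -joint.
      by apply: eq_integral => z _; congr (_%:E); exact: mulrC.
    split=> //; last by rewrite E i2.
    apply/integrableP; split.
      apply/measurable_EFinP; apply: measurable_funM; exact: mEr.
    under eq_integral do rewrite gee0_abs ?lee_fin ?mulr_ge0 ?expR_ge0//.
    by rewrite E ltry.
  by apply: eq_integral => z _; rewrite -EFinM mulrC.
have QAfin : (Q A \is a fin_num)%E by exact: fin_num_measure.
have := @path_law_unique R _ _ _ _ (Q \x Q)%E Q w1 (fun=> fine (Q A)) rotV id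
  (fun=> ltac:(by rewrite /w1 indicE ler0n)) (fun=> fine_ge0 (measure_ge0 _ _))
  mw1 (mc _) mV mid _ (fun x => (\1_C x)%:E) (mI _ mC) (I0 C).
rewrite /= ge0_integralZl_EFin ?fine_ge0//; last exact: mI.
rewrite IA// fineK// => <-; last first.
  move=> e; have [i1 i2] := intcst e (fine_ge0 (measure_ge0 Q A)).
  split=> //; last by rewrite i2 step1 EFinM fineK// muleC.
  apply/integrableP; split.
    by apply/measurable_EFinP; apply: measurable_funM => //; exact: mEr.
  under eq_integral do rewrite gee0_abs ?lee_fin ?mulr_ge0 ?expR_ge0//.
  by rewrite step1 -(fineK QAfin) -EFinM ltry.
transitivity (\int[(Q \x Q)]_z (\1_(rotU @^-1` A `&` rotV @^-1` C) z)%:E)%E.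
  by rewrite integral_indic ?setIT//; exact: measurableI.
by apply: eq_integral => z _; rewrite indicI EFinM.
Qed.

End fernique.

(** * Exponential integrability of the supremum on a compact interval *)

Section fernique_tail.
Context (R : realType) (Q : probability (path R) R).

Hypothesis gaussQ : forall e : seq (R * R),
  exists2 v : R, (\int[Q]_x (linear_form e x ^+ 2)%:E = v%:E)%E &
    (\int[Q]_x (expR (linear_form e x))%:E = (expR (v / 2))%:E)%E.

Variable K : R.

Let large (s : R) : set (path R) :=
  [set x | exists2 t, t \in `[- K, K]%R & s < `|x t|].

Let mlarge s : measurable (large s).
Proof.
rewrite (_ : large s = [set x : path R | exists2 t, [set` `[- K, K]%R] t &
    (Num.norm @^-1` [set r : R | s < r]) (x t)])//.
apply: measurable_exists; apply: open_comp; last exact: open_gt.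
by move=> r _; exact: norm_continuous.
Qed.

Let p s : R := fine (Q (large s)).

Let pE s : Q (large s) = (p s)%:E.
Proof. by rewrite /p fineK// fin_num_measure. Qed.

Let p_ge0 s : 0 <= p s. Proof. by rewrite fine_ge0. Qed.

(** If one rotated copy exceeds [t] at a time where the other is at most [s], inverting the rotation
    shows that both original copies exceed [(3 t - 4 s) / 5] there. The bound for the second copy is
    [(4 t - 3 s) / 5], which is larger. *)
Lemma fernique_ineq (s t : R) : 0 <= s -> 0 <= t ->
  (1 - p s) * p t <= p ((3 * t - 4 * s) / 5) ^+ 2.
Proof.
move=> s0 t0; set r := (3 * t - 4 * s) / 5.
rewrite -lee_fin expr2 !EFinM EFinB -!pE.
have -> : (1%:E - Q (large s) = Q (~` large s))%E by rewrite probability_setC.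
rewrite muleC -(rotation_indep gaussQ)//; last exact: measurableC.
rewrite -product_measure1E//; apply: le_measure; rewrite ?inE.
- apply: measurableI.
    rewrite -[X in measurable X]setTI.
    by apply: (_ : measurable_fun setT _) => //; apply: measurable_path => u /=;
      apply: measurable_funD; apply: measurable_funM => //; apply: (measurableT_comp (measurable_eval _)).
  rewrite -[X in measurable X]setTI.
  apply: (_ : measurable_fun setT _) => //; last exact: measurableC.
  by apply: measurable_path => u /=;
    apply: measurable_funD; apply: measurable_funM => //; apply: (measurableT_comp (measurable_eval _)).
- exact: measurableX.
move=> [x y] [/= [u uK hU] hV].
have {}hU : t < `|3 / 5 * x u + 4 / 5 * y u| := hU.
have {}hV : `|4 / 5 * x u + - (3 / 5) * y u| <= s.
  by rewrite leNgt; apply/negP => h; apply: hV; exists u.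
have ex : x u = 3 / 5 * (3 / 5 * x u + 4 / 5 * y u) + 4 / 5 * (4 / 5 * x u + - (3 / 5) * y u) by field.
have ey : y u = 4 / 5 * (3 / 5 * x u + 4 / 5 * y u) - 3 / 5 * (4 / 5 * x u + - (3 / 5) * y u) by field.
move: hU hV ex ey; move: (_ + 4 / 5 * y u) (_ + - (3 / 5) * y u) => U V hU hV ex ey.
have nM (a z : R) : 0 <= a -> `|a * z| = a * `|z| by move=> a0; rewrite normrM ger0_norm.
split; exists u => //=.
  rewrite ex; apply: lt_le_trans (lerB_normD _ _).
  rewrite !nM ?divr_ge0// /r; lra.
rewrite ey; apply: lt_le_trans (lerB_dist _ _).
rewrite !nM ?divr_ge0// /r; lra.
Qed.

Let path_bounded (x : path R) : exists2 M, 0 < M & ~ large M x.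
Proof.
have cK : compact (x @` `[- K, K] : set R^o).
  apply: continuous_compact; last exact: segment_compact.
  by apply: continuous_subspaceT => t; exact: path_continuous.
have [M [_ hM]] := compact_bounded cK.
exists (`|M| + 1); first by rewrite ltr_wpDl.
move=> [t tK]; apply/negP; rewrite -leNgt; apply: hM.
  by rewrite (le_lt_trans (ler_norm M))// ltrDl.
by exists t.
Qed.

Let p_small (eps : R) : 0 < eps -> exists2 s, 0 < s & p s <= eps.
Proof.
move=> e0.
have : Q \o (fun n => large n%:R) @ \oo --> Q (\bigcap_n large n%:R).
  apply: nonincreasing_cvg_mu => //.
  - by rewrite -ge0_fin_numE// fin_num_measure.
  - by apply: bigcapT_measurable.
  - move=> m n mn; apply/subsetPset => x [t tK h]; exists t => //.
    by apply: le_lt_trans h; rewrite ler_nat.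
rewrite (_ : \bigcap_n _ = set0) ?measure0.
  move=> /fine_cvgP[_] /cvgrPdist_le/(_ _ e0)[n _ /(_ n.+1)/=].
  rewrite leqnSn => /(_ isT); rewrite sub0r normrN => h.
  exists n.+1%:R => //; exact: le_trans (ler_norm _) h.
apply/seteqP; split => // x hx.
have [M M0] := path_bounded x; apply.
have [t tK h] := hx (Num.truncn M).+1 I; exists t => //.
by apply: lt_trans h; exact: truncnS_gt.
Qed.

Lemma fernique : 0 <= K ->
  (\int[Q]_x ereal_sup [set (expR `|x t|)%:E | t in [set` `[- K, K]%R]] < +oo)%E.
Proof.
move=> K0.
have [s s0 ps] := p_small (ltac:(by rewrite divr_gt0 ?expR_gt0) : 0 < expR (-1) / 2 :> R).
have ps2 : p s <= 1 / 2.
  by apply: le_trans ps _; rewrite ler_pM2r// -[leRHS]expR0 ler_expR; lra.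
(* The levels solve [(3 t_(n+1) - 4 s) / 5 = t_n] with [t_0 = s]; the fixed point of this recursion
   is [- 2 s]. *)
pose t n : R := 3 * s * (5 / 3) ^+ n - 2 * s.
have tS n : (3 * t n.+1 - 4 * s) / 5 = t n by rewrite /t exprS; field.
have t_ge0 n : 0 <= t n.
  have : 1 <= (5 / 3 : R) ^+ n by rewrite exprn_ege1//; lra.
  rewrite /t; nra.
(* Since [1 - p s >= 1/2], the inequality reads [2 p(t_(n+1)) <= (2 p(t_n))^2]: the tail is squared
   at each level, from [2 p(s) <= e^(-1)] on. *)
have pt n : 2 * p (t n) <= expR (- (2 ^+ n)).
  elim: n => [|n IH].
    by rewrite /t !expr0 (_ : 3 * s * 1 - 2 * s = s); [lra|ring].
  have := fernique_ineq (ltW s0) (t_ge0 n.+1).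
  rewrite tS => h; set E := expR (- 2 ^+ n) in IH.
  have -> : expR (- 2 ^+ n.+1) = E ^+ 2.
    by rewrite /E -expRM_natl; congr expR; rewrite exprS; ring.
  have h1 : 0 <= p (t n.+1) := p_ge0 _.
  have h2 : 0 <= p (t n) := p_ge0 _.
  have : (2 * p (t n)) ^+ 2 <= E ^+ 2 by rewrite lerXn2r ?nnegrE ?mulr_ge0 ?expR_ge0.
  nra.
(* The levels grow like [(5/3)^n] while the tail exponents grow like [2^n]; the ratio is
   [(6/5)^n]. *)
have powB (n : nat) : 1 + n%:R / 5 <= (6 / 5 : R) ^+ n.
  elim: n => [|n IH]; first by rewrite expr0 mul0r addr0.
  rewrite exprS; have : 0 <= n%:R :> R by [].
  by rewrite -natr1; nra.
(* From [n >= 50 s] on, [(6/5)^n >= 10 s], so that [t_(n+1) <= 5 s (5/3)^n] is at most half of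
   [2^n]. *)
pose N := (Num.truncn (50 * s)).+1.
have tN n : (N <= n)%N -> t n.+1 <= 2 ^+ n / 2.
  move=> Nn.
  have h1 : 50 * s <= n%:R.
    by apply: le_trans (ltW (truncnS_gt _)) _; rewrite ler_nat.
  have h2 := powB n.
  have -> : t n.+1 = 5 * s * (5 / 3) ^+ n - 2 * s by rewrite /t exprS; field.
  have -> : (2 : R) ^+ n = (6 / 5) ^+ n * (5 / 3) ^+ n.
    by rewrite -exprMn; congr (_ ^+ _); field.
  have h3 : 0 <= (5 / 3 : R) ^+ n by rewrite exprn_ge0// divr_ge0.
  nra.
have natpow (n : nat) : n%:R <= 2 ^+ n :> R.
  by rewrite -natrX ler_nat ltnW// ltn_expl.
pose r : R := expR (- (1 / 2)).
have r0 : 0 <= r := expR_ge0 _.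
have r1 : r < 1 by rewrite /r expR_lt1; lra.
have term k : expR (t (N + k).+1%N) * p (t (N + k)%N) <= r ^+ k.
  apply: (@le_trans _ _ (expR (2 ^+ (N + k)%N / 2) * expR (- 2 ^+ (N + k)%N))).
    apply: ler_pM; rewrite ?expR_ge0 ?p_ge0//.
      by rewrite ler_expR; apply: tN; exact: leq_addr.
    apply: le_trans (pt _); have := p_ge0 (t (N + k)%N); lra.
  rewrite -expRD /r -expRM_natl ler_expR.
  have : k%:R <= 2 ^+ (N + k)%N :> R.
    by apply: le_trans (natpow (N + k)%N); rewrite ler_nat leq_addl.
  lra.
pose H (x : path R) := ereal_sup [set (expR `|x t|)%:E | t in [set` `[- K, K]%R]].
pose G k (x : path R) : \bar R := ((expR (t (N + k).+1%N))%:E * (\1_(large (t (N + k)%N)) x)%:E)%E.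
have G0 k x : (0 <= G k x)%E by rewrite mule_ge0// lee_fin// expR_ge0.
have mG k : measurable_fun setT (G k).
  by apply: emeasurable_funM => //; exact/measurable_EFinP.
have mS : measurable_fun setT (fun x => \sum_(k <oo) G k x)%E.
  by apply: ge0_emeasurable_sum.
have HG x : (H x <= (expR (t N))%:E + \sum_(k <oo) G k x)%E.
  have [M M0 hM] := path_bounded x.
  (* At the first level that the path does not exceed, either this level is [t N] and the constant
     bounds the supremum, or the previous level is exceeded and its term [G k] alone bounds it. *)
  have exk : exists k, `[< ~ large (t (N + k)%N) x >].
    pose k := (Num.truncn (2 * M / s)).+1.
    exists k; apply/asboolP => -[u uK h]; apply: hM; exists u => //; apply: le_lt_trans h.
    have h1 : 1 + k%:R / 5 <= (5 / 3 : R) ^+ (N + k)%N.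
      apply: (@le_trans _ _ ((6 / 5) ^+ (N + k)%N)); last by rewrite lerXn2r ?nnegrE//; lra.
      apply: le_trans (powB _); rewrite lerD2l ler_pM2r// ler_nat; exact: leq_addl.
    have h2 : 2 * M <= k%:R * s.
      by rewrite -ler_pdivrMr//; exact/ltW/truncnS_gt.
    rewrite /t; nra.
  have Hle k : ~ large (t (N + k)%N) x -> (H x <= (expR (t (N + k)%N))%:E)%E.
    move=> h; apply: ge_ereal_sup => _ [u uK <-]; rewrite lee_fin ler_expR.
    by rewrite leNgt; apply/negP => hu; apply: h; exists u.
  case: (ex_minnP exk) => -[|k] /asboolP hk kmin.
    rewrite addn0 in hk; apply: (@le_trans _ _ (expR (t N))%:E); last by rewrite leeDl//; exact: nneseries_ge0.
    by have := Hle 0%N; rewrite addn0; apply.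
  have lk : large (t (N + k)%N) x.
    apply: contrapT => h; have := kmin k; rewrite ltnn asboolT//.
    by move=> /(_ isT).
  apply: (le_trans (Hle _ hk)); apply: (@le_trans _ _ (G k x)).
    by rewrite /G indicE mem_set// mule1 addnS.
  apply: (@le_trans _ _ (\sum_(j <oo) G j x)%E); last by rewrite leeDr// lee_fin expR_ge0.
  by rewrite (@nneseriesD1 _ _ k)// leeDl// nneseries_ge0.
apply: (@le_lt_trans _ _ (\int[Q]_x ((expR (t N))%:E + \sum_(k <oo) G k x))%E).
  apply: ge0_le_integral => //.
  - move=> x _; apply: (@le_trans _ _ (expR `|x 0|)%:E); first by rewrite lee_fin expR_ge0.
    by apply: ereal_sup_ubound; exists 0 => //=; rewrite in_itv/= oppr_le0 K0.
  - apply: (@measurable_ereal_sup_path _ (fun r => expR `|r|)) => z.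
    by apply: continuous_comp; [exact: norm_continuous|exact: continuous_expR].
  - exact: emeasurable_funD.
  - by move=> x _; exact: HG.
rewrite ge0_integralD//; last by move=> x _; exact: nneseries_ge0.
rewrite integral_cst//= probability_setT mule1 integral_nneseries//.
apply: lte_add_pinfty; first exact: ltry.
apply: (@le_lt_trans _ _ ((1 - r)^-1)%:E); last exact: ltry.
apply: lime_le; first by apply: is_cvg_nneseries => k _ _; exact: integral_ge0.
apply: nearW => n.
apply: (@le_trans _ _ (\sum_(0 <= k < n) (r ^+ k)%:E)%E).
  apply: lee_sum => k _; rewrite /G ge0_integralZl_EFin ?expR_ge0//; last first.
    exact/measurable_EFinP.
  have -> : (\int[Q]_x (\1_(large (t (N + k)%N)) x)%:E = (p (t (N + k)%N))%:E)%E.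
    by rewrite integral_indic ?setIT//; exact: pE.
  by rewrite lee_fin.
rewrite sumEFin lee_fin -[leRHS]mul1r ler_pdivlMr ?subr_gt0//.
suff -> : (\sum_(0 <= k < n) r ^+ k) * (1 - r) = 1 - r ^+ n by rewrite gerBl exprn_ge0.
elim: n => [|n IH]; first by rewrite big_nil expr0 mul0r subrr.
by rewrite big_nat_recr//= mulrDl IH exprS; ring.
Qed.

End fernique_tail.

(** * Gaussian paths with stationary increments *)

Section gaussian_path_law.
Context (R : realType) (Q : probability (path R) R) (sigma2 : R -> R).

Hypothesis gaussQ : forall e : seq (R * R),
  exists2 v : R, (\int[Q]_x (linear_form e x ^+ 2)%:E = v%:E)%E &
    (\int[Q]_x (expR (linear_form e x))%:E = (expR (v / 2))%:E)%E.

Hypothesis incQ : forall s t,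
  (\int[Q]_x ((x t - x s) ^+ 2)%:E = (sigma2 (t - s))%:E)%E.

Hypothesis zeroQ : {ae Q, forall x : path R, x 0 = 0}.

Let int0 : (\int[Q]_x (0 : R)%:E = (0 : R)%:E)%E. Proof. exact: integral0. Qed.

Let mev t : measurable_fun setT (fun x : path R => x t). Proof. exact: measurable_eval. Qed.

Lemma second_moment t : (\int[Q]_x (x t ^+ 2)%:E = (sigma2 t)%:E)%E.
Proof.
rewrite -[t in RHS]subr0 -incQ; apply: ge0_ae_eq_integral => //.
- by apply/measurable_EFinP; exact: measurable_funX.
- by apply/measurable_EFinP; apply: measurable_funX; exact: measurable_funB.
- by move=> x _; rewrite lee_fin sqr_ge0.
- by move=> x _; rewrite lee_fin sqr_ge0.
by move: zeroQ; apply: filterS => x /= -> _; rewrite subr0.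
Qed.

Lemma sigma2N t : sigma2 (- t) = sigma2 t.
Proof.
apply: EFin_inj; rewrite -[t in RHS]subr0 -[- t]sub0r -!incQ.
by apply: eq_integral => x _; rewrite -sqrrN opprB.
Qed.

Let integrableP_sq (f : path R -> R) (v : R) : measurable_fun setT f ->
  (\int[Q]_x (f x ^+ 2)%:E = v%:E)%E -> Q.-integrable setT (fun x => (f x ^+ 2)%:E).
Proof.
move=> mf fv; apply/integrableP; split.
  by apply/measurable_EFinP; exact: measurable_funX.
by under eq_integral do rewrite gee0_abs ?lee_fin ?sqr_ge0//; rewrite fv ltry.
Qed.

Let integrable_prod (f g : path R -> R) : measurable_fun setT f -> measurable_fun setT g ->
  Q.-integrable setT (fun x => (f x ^+ 2)%:E) -> Q.-integrable setT (fun x => (g x ^+ 2)%:E) ->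
  Q.-integrable setT (EFin \o (fun x => f x * g x)).
Proof.
move=> mf mg if2 ig2.
apply: (@le_integrable _ _ _ _ _ _ _ (fun x => (f x ^+ 2)%:E + (g x ^+ 2)%:E)%E) => //.
- by apply/measurable_EFinP; exact: measurable_funM.
- move=> x _; rewrite -EFinD /= lee_fin [leRHS]ger0_norm ?addr_ge0 ?sqr_ge0//.
  rewrite normrM -(real_normK (num_real (f x))) -(real_normK (num_real (g x))).
  have := sqr_ge0 (`|f x| - `|g x|); have := sqr_ge0 (`|f x|); have := sqr_ge0 (`|g x|); nra.
- exact: integrableD.
Qed.

Let isq_lin e : Q.-integrable setT (fun x => (linear_form e x ^+ 2)%:E).
Proof.
have [v h _] := gaussQ e; apply: integrableP_sq h.
exact: measurable_linear_form.
Qed.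

Let isq_ev t : Q.-integrable setT (fun x : path R => (x t ^+ 2)%:E).
Proof. exact: integrableP_sq (second_moment t). Qed.

Lemma covarianceQ s t :
  (\int[Q]_x (x s * x t)%:E = ((sigma2 s + sigma2 t - sigma2 (t - s)) / 2)%:E)%E.
Proof.
have ip : Q.-integrable setT (fun x : path R => (x s * x t)%:E).
  exact: (integrable_prod (mev s) (mev t)).
have : (\int[Q]_x ((x t - x s) ^+ 2)%:E = \int[Q]_x (x s ^+ 2)%:E +
    \int[Q]_x (x t ^+ 2)%:E - 2%:E * \int[Q]_x (x s * x t)%:E)%E.
  rewrite -integralD// -integralZl// -integralB//; last 2 first.
  - exact: integrableD.
  - exact: integrableZl.
  by apply: eq_integral => x _; rewrite -!EFinM -!EFinD /=; congr EFin; ring.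
rewrite incQ !second_moment.
have := integrable_fin_num measurableT ip.
case: (\int[Q]_x _)%E => // r _; rewrite -EFinM -!EFinD => -[->].
by congr EFin; field.
Qed.

Let dot (e f : seq (R * R)) : R :=
  \sum_(p <- e) \sum_(q <- f) p.1 * q.1 * ((sigma2 p.2 + sigma2 q.2 - sigma2 (q.2 - p.2)) / 2).

Let dotE e f : (\int[Q]_x (linear_form e x * linear_form f x)%:E = (dot e f)%:E)%E.
Proof.
have h t : (\int[Q]_x (x t * linear_form f x)%:E =
    (\sum_(q <- f) q.1 * ((sigma2 t + sigma2 q.2 - sigma2 (q.2 - t)) / 2))%:E)%E.
  elim: f => [|q f IH].
    rewrite big_nil -int0; apply: eq_integral => x _.
    by rewrite /linear_form big_nil mulr0.
  transitivity (\int[Q]_x (q.1%:E * (x t * x q.2)%:E + (x t * linear_form f x)%:E))%E.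
    apply: eq_integral => x _; rewrite -EFinM -EFinD; congr EFin.
    by rewrite /linear_form big_cons; ring.
  have i1 : Q.-integrable setT (fun x : path R => (x t * x q.2)%:E).
    exact: (integrable_prod (mev t) (mev q.2)).
  rewrite integralD//; last 2 first.
  - exact: integrableZl.
  - exact: (integrable_prod (mev t) (measurable_linear_form f)).
  by rewrite integralZl// covarianceQ IH big_cons -EFinM -EFinD.
rewrite /dot; elim: e => [|p e IH].
  rewrite big_nil -int0; apply: eq_integral => x _.
  by rewrite /linear_form big_nil mul0r.
transitivity (\int[Q]_x (p.1%:E * (x p.2 * linear_form f x)%:E +
    (linear_form e x * linear_form f x)%:E))%E.
  apply: eq_integral => x _; rewrite -EFinM -EFinD; congr EFin.
  by rewrite {1}/linear_form big_cons -/(linear_form e x); ring.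
have i1 : Q.-integrable setT (fun x : path R => (x p.2 * linear_form f x)%:E).
  exact: (integrable_prod (mev p.2) (measurable_linear_form f)).
rewrite integralD//; last 2 first.
- exact: integrableZl.
- exact: (integrable_prod (measurable_linear_form e) (measurable_linear_form f)).
rewrite integralZl// h IH big_cons -EFinM -EFinD; congr (_ + _)%:E.
by rewrite big_distrr/=; apply: eq_bigr => q _; rewrite [LHS]mulrA.
Qed.

Lemma linear_form_mgf e :
  (\int[Q]_x (expR (linear_form e x))%:E = (expR (dot e e / 2))%:E)%E.
Proof.
have [v h ->] := gaussQ e; congr (expR (_ / 2))%:E.
by apply: EFin_inj; rewrite -h -dotE; apply: eq_integral => x _; rewrite expr2.
Qed.

(** These separate the parts of the covariance form according to their behaviour under time shifts:
    [quad] sees only differences of times, and [weight] drops out of the drifted exponent when the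
    total coefficient [mass] is 1. *)
Let mass (e : seq (R * R)) := \sum_(p <- e) p.1.
Let weight (e : seq (R * R)) := \sum_(p <- e) p.1 * sigma2 p.2.
Let shiftl h (e : seq (R * R)) := [seq (p.1, p.2 + h) | p <- e].
Let quad (e f : seq (R * R)) := \sum_(p <- e) \sum_(q <- f) p.1 * q.1 * sigma2 (q.2 - p.2).

Let dotE2 e f : dot e f = (weight e * mass f + mass e * weight f - quad e f) / 2.
Proof.
rewrite /dot /weight /mass /quad.
elim: e => [|p e IH]; first by rewrite !big_nil; ring.
rewrite !big_cons IH.
suff -> : \sum_(q <- f) p.1 * q.1 * ((sigma2 p.2 + sigma2 q.2 - sigma2 (q.2 - p.2)) / 2) =
   (p.1 * sigma2 p.2 * (\sum_(q <- f) q.1) + p.1 * (\sum_(q <- f) q.1 * sigma2 q.2) -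
    \sum_(q <- f) p.1 * q.1 * sigma2 (q.2 - p.2)) / 2 by field.
elim: {e IH} f => [|q f IH]; first by rewrite !big_nil; ring.
by rewrite !big_cons IH; field.
Qed.

Let sigma2_0 : sigma2 0 = 0.
Proof.
apply: EFin_inj; have := incQ 0 0; rewrite [X in sigma2 X]subrr => <-; rewrite -int0.
by apply: eq_integral => x _; rewrite subrr expr0n.
Qed.

(** As [sigma2 u] is the integral of [x(u)^2], dominated convergence applies near [t]:
    [x(u)^2 <= 2 e^|x(u)|], and the supremum of the latter over a compact interval is integrable by
    Fernique's bound. *)
Lemma sigma2_continuous : continuous sigma2.
Proof.
move=> t.
pose K := `|t| + 1; have K0 : 0 <= K by rewrite addr_ge0.
pose H (x : path R) := ereal_sup [set (expR `|x u|)%:E | u in [set` `[- K, K]%R]].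
have H0 x : (0 <= H x)%E.
  apply: (@le_trans _ _ (expR `|x 0|)%:E); first by rewrite lee_fin expR_ge0.
  by apply: ereal_sup_ubound; exists 0 => //=; rewrite in_itv/= oppr_le0 K0.
have mH : measurable_fun setT H.
  apply: (@measurable_ereal_sup_path _ (fun r => expR `|r|)) => z.
  by apply: continuous_comp; [exact: norm_continuous|exact: continuous_expR].
have iH : Q.-integrable setT H.
  apply/integrableP; split => //.
  by under eq_integral do rewrite gee0_abs//; exact: fernique.
have iG : Q.-integrable setT (EFin \o (fun x => 2 * fine (H x))).
  apply/integrableP; split.
    apply/measurable_EFinP; apply: measurable_funM => //.
    by apply: (measurableT_comp _ mH).
  apply: (@le_lt_trans _ _ (\int[Q]_x (2%:E * H x))%E).
    apply: ge0_le_integral => //.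
    - apply: measurableT_comp => //; apply/measurable_EFinP; apply: measurable_funM => //.
      by apply: (measurableT_comp _ mH).
    - exact: emeasurable_funM.
    move=> x _; rewrite gee0_abs; last by rewrite lee_fin mulr_ge0// fine_ge0.
    rewrite /comp EFinM.
    apply: lee_wpmul2l; first by rewrite lee_fin.
    by have := H0 x; case: (H x) => //= _; rewrite leey.
  rewrite ge0_integralZl_EFin//; apply: lte_mul_pinfty => //.
  exact: fernique.
have bnd (u : R) : u \in `]t - 1, t + 1[%R -> {ae Q, forall x : path R, setT x -> `|x u ^+ 2| <= 2 * fine (H x)}.
  move=> uI; move: (integrable_ae measurableT iH); apply: filterS => x /= /(_ I) fH _.
  rewrite normrX; apply: le_trans (norm_exp_le_expR _ 2) _.
  rewrite ler_wpM2l// -lee_fin fineK//; apply: ereal_sup_ubound; exists u => //=.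
  have := ler_norm t; have := ler_norm (- t); rewrite normrN.
  by move: uI; rewrite !in_itv/= /K => /andP[u1 u2] h1 h2; apply/andP; split; lra.
have c : {in `]t - 1, t + 1[%classic, continuous (fun u => \int[Q]_(x in setT) (x u ^+ 2))%R}.
  apply: (@continuity_under_integral R _ (path R) Q (fun u x => x u ^+ 2) setT measurableT
    (t - 1) (t + 1) _ _ (fun x => 2 * fine (H x))) => //.
  - by move=> u _; exact: isq_ev.
  - apply: aeW => x _ u _; apply: (@continuous_comp _ _ _ (x : R -> R) (fun r => r ^+ 2)).
      exact: path_continuous.
    exact: exprn_continuous.
have -> : sigma2 = (fun u => \int[Q]_(x in setT) (x u ^+ 2))%R.
  by apply/funext => u; rewrite /Rintegral second_moment.
by apply: c; rewrite inE/= in_itv/=; apply/andP; split; lra.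
Qed.

Hypothesis csigma2 : continuous sigma2.

Lemma drift_path_continuous (x : path R) : continuous (fun t => x t - sigma2 t / 2).
Proof.
move=> t; apply: (@cvgB _ R^o); first exact: path_continuous.
by apply: cvgMl; exact: csigma2.
Qed.
Definition drift_path (x : path R) := Path (@drift_path_continuous x).

Lemma measurable_drift_path : measurable_fun setT drift_path.
Proof. by apply: measurable_path => t /=; exact: measurable_funB. Qed.

Lemma drift_linear_form e x : linear_form e (drift_path x) = linear_form e x - weight e / 2.
Proof.
rewrite /linear_form /weight; elim: e => [|p e IH]; first by rewrite !big_nil; ring.
by rewrite !big_cons IH/=; field.
Qed.

Lemma drift_mgf e : (\int[Q]_x (expR (linear_form e (drift_path x)))%:E =
  (expR ((dot e e - weight e) / 2))%:E)%E.
Proof.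
under eq_integral do rewrite drift_linear_form expRD EFinM.
have mE : measurable_fun setT (fun x => (expR (linear_form e x))%:E).
  by apply/measurable_EFinP; apply: measurableT_comp => //; exact: measurable_linear_form.
by rewrite ge0_integralZr// linear_form_mgf -EFinM -expRD; congr (expR _)%:E; field.
Qed.

(** Both sides have explicit Laplace exponents. On the left the combined form has total coefficient
    1, which leaves only half of [quad] in absolute value; splitting off the pivot time [h] in
    [quad e2 e2] recovers the exponent of [e]. *)
Lemma drift_tilt h (F : path R -> \bar R) : measurable_fun setT F ->
  (forall x, (0 <= F x)%E) ->
  (\int[Q]_x ((expR (drift_path x h))%:E *
      F (addc_path (- drift_path x h) (shift_path h (drift_path x)))) =
   \int[Q]_x F (drift_path x))%E.
Proof.
move=> mF F0.
have mD := measurable_drift_path.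
transitivity (\int[Q]_x ((1 : R)%:E * F (drift_path x)))%E; last first.
  by apply: eq_integral => x _; rewrite mul1e.
have mw : measurable_fun setT (fun x => expR (drift_path x h)).
  by apply: measurableT_comp => //; apply: (measurableT_comp (measurable_eval _) mD).
have m1 : measurable_fun setT (fun _ : path R => 1 : R) by [].
have mX := measurableT_comp (measurable_tilt_path h) mD.
apply: (@path_law_unique R _ _ _ _ Q Q (fun x => expR (drift_path x h)) (fun=> 1)
  (fun x => addc_path (- drift_path x h) (shift_path h (drift_path x))) drift_path
  (fun=> expR_ge0 _) (fun=> ler01) mw m1 mX mD _ F mF F0).
move=> e.
(* The density [e^W(h)] contributes 1 at time [h], and subtracting [W(h)] from every coordinate
   contributes [- mass e]. *)
pose e2 := (1 - mass e, h) :: shiftl h e.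
have E x : expR (drift_path x h) *
    expR (linear_form e (addc_path (- drift_path x h) (shift_path h (drift_path x)))) =
    expR (linear_form e2 (drift_path x)).
  rewrite -expRD; congr expR; rewrite /linear_form /e2 big_cons big_map.
  rewrite [X in _ + X = _](_ : _ = \sum_(p <- e) p.1 * drift_path x (p.2 + h) - mass e * drift_path x h).
    by rewrite /=; ring.
  rewrite /mass; elim: {e2} e => [|p e IH]; first by rewrite !big_nil mul0r subrr.
  by rewrite !big_cons IH/=; ring.
have mEe f : measurable_fun setT (fun x => (expR (linear_form f (drift_path x)))%:E).
  apply/measurable_EFinP; apply: measurableT_comp => //.
  by apply: (measurableT_comp (measurable_linear_form f) mD).
have iE f : Q.-integrable setT (fun x => (expR (linear_form f (drift_path x)))%:E).
  apply/integrableP; split => //.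
  under eq_integral do rewrite gee0_abs ?lee_fin ?expR_ge0//.
  by rewrite drift_mgf ltry.
split.
- by under eq_fun do rewrite E.
- by under eq_fun do rewrite mul1r.
under eq_integral do rewrite E.
under [RHS]eq_integral do rewrite mul1r.
rewrite !drift_mgf; congr (expR _)%:E.
have w2 : weight e2 = (1 - mass e) * sigma2 h + weight (shiftl h e).
  by rewrite /weight big_cons.
have m2 : mass e2 = 1.
  by rewrite {1}/mass big_cons big_map/= -/(mass e) subrK.
have qe : quad e2 e2 = 2 * (1 - mass e) * weight e + quad e e.
  rewrite /quad big_cons /= big_cons/= subrr sigma2_0 mulr0 add0r big_map.
  rewrite big_map.
  have -> : \sum_(i <- e) (1 - mass e) * (i.1) * sigma2 (i.2 + h - h) = (1 - mass e) * weight e.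
    by rewrite /weight big_distrr/=; apply: eq_bigr => p _; rewrite addrK mulrA.
  have -> : \sum_(p <- e) \sum_(q <- e2) p.1 * q.1 * sigma2 (q.2 - (p.2 + h)) =
     (1 - mass e) * weight e + quad e e.
    rewrite /weight big_distrr/= /quad -big_split/=; apply: eq_bigr => p _.
    rewrite big_cons/= big_map; congr (_ + _).
      by rewrite opprD addrCA subrr addr0 sigma2N; ring.
    by apply: eq_bigr => q _ /=; rewrite opprD addrACA subrr addr0.
  by rewrite /quad; ring.
by rewrite !dotE2 w2 m2 qe; field.
Qed.

Lemma drift_half_moment t : (\int[Q]_x (expR (drift_path x t / 2))%:E =
  (expR (- sigma2 t / 8))%:E)%E.
Proof.
have := drift_mgf [:: (1 / 2, t)].
under eq_integral do rewrite /linear_form big_seq1/= mulrC mul1r.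
move=> ->; congr (expR _)%:E; rewrite dotE2 /weight /mass /quad !big_seq1/=.
by rewrite subrr sigma2_0; field.
Qed.

Lemma drift_sup_finite K : 0 <= K ->
  (\int[Q]_x path_sup (@eval_path R) [set` `[0, K]%R] (drift_path x) < +oo)%E.
Proof.
move=> K0; apply: le_lt_trans (fernique gaussQ K0).
have s0 t : 0 <= sigma2 t.
  rewrite -lee_fin -second_moment; apply: integral_ge0 => x _.
  by rewrite lee_fin sqr_ge0.
apply: ge0_le_integral => //.
- move=> x _; apply: (@le_trans _ _ (expR (drift_path x 0))%:E); first by rewrite lee_fin expR_ge0.
  by apply: ereal_sup_ubound; exists 0 => //=; rewrite in_itv/= lexx.
- by apply: (measurableT_comp (measurable_path_sup _) measurable_drift_path).
- apply: (@measurable_ereal_sup_path _ (fun r => expR `|r|)) => z.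
  by apply: continuous_comp; [exact: norm_continuous|exact: continuous_expR].
move=> x _; apply: ge_ereal_sup => _ [t /= tK <-].
apply: (@le_trans _ _ (expR `|x t|)%:E).
  rewrite lee_fin ler_expR /eval_path/=; apply: le_trans (ler_norm _).
  by rewrite gerBl divr_ge0.
apply: ereal_sup_ubound; exists t => //=.
by move: tK; rewrite !in_itv/= => /andP[t0 ->]; rewrite andbT (le_trans _ t0)// oppr_le0.
Qed.

End gaussian_path_law.

(** * Homogeneous functionals and mass transport *)

Section translation.
Context (R : realType).

Lemma lebesgue_measure_shift (h : R) (A : set R) : measurable A ->
  lebesgue_measure ((fun t => t + h) @^-1` A) = lebesgue_measure A.
Proof.
move=> mA.
pose g : measurableTypeR R -> measurableTypeR R := fun t => t + h.
have mh : measurable_fun setT g by exact: measurable_funD.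
pose mx := isMeasurableFun.Build _ _ _ _ g mh.
pose f : {mfun measurableTypeR R >-> measurableTypeR R} := HB.pack g mx.
have -> : lebesgue_measure ((fun t => t + h) @^-1` A) = pushforward lebesgue_measure f A by [].
apply/esym/lebesgue_measure_unique => //= _ [[a b]] _ <-.
rewrite /pushforward.
have -> : f @^-1` `]a, b] = `]a - h, b - h]%classic.
  apply/seteqP; split => t /=; rewrite !in_itv/= /f/= ltrBlDr lerBrDr//.
rewrite !lebesgue_measure_itv/= !lte_fin ltrD2r.
by case: ifP => // _; rewrite -!EFinB; congr EFin; ring.
Qed.

Lemma integral_shift (h : R) (D : set R) (f : R -> \bar R) : measurable D ->
  measurable_fun setT f -> (forall t, (0 <= f t)%E) ->
  (\int[lebesgue_measure]_(t in (fun t => t + h)%R @^-1` D) f (t + h)%R =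
   \int[lebesgue_measure]_(t in D) f t)%E.
Proof.
move=> mD mf f0; rewrite integral_mkcond [RHS]integral_mkcond.
have m1 : measurable_fun setT (fun _ : R => 1 : R) by [].
have mh : measurable_fun setT (fun t : R => t + h) by exact: measurable_funD.
have mid : measurable_fun setT (id : R -> R) by [].
have mfD : measurable_fun setT (f \_ D) by apply/(measurable_restrictT _ mD); exact: measurable_funTS.
have := @eq_weighted_integral R _ _ _ _ _ _ (@lebesgue_measure R) (@lebesgue_measure R)
  (fun=> 1) (fun=> 1) (fun t : R => t + h) (id : R -> R) (fun=> ler01) (fun=> ler01) m1 m1 mh mid (f \_ D).
move=> E; transitivity (\int[lebesgue_measure]_t ((1 : R)%:E * (f \_ D) (t + h)%R))%E.
  apply: eq_integral => t _; rewrite mul1e !patchE.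
  by rewrite (_ : (t \in _) = (t + h \in D))//; apply/idP/idP; rewrite !inE.
rewrite E//.
- by apply: eq_integral => t _; rewrite mul1e.
- move=> A mA; rewrite preimage_id !integral_cst//=; last first.
    by rewrite -[X in measurable X]setTI; exact: mh.
  by rewrite !mul1e lebesgue_measure_shift.
- by move=> t; rewrite patchE; case: ifP.
Qed.

End translation.

Section homogeneity.
Context (R : realType).
Implicit Types (x : path R) (c h t b : R) (D : set R).

Local Notation ev := (@eval_path R).

Lemma ge0_esumZr (J : set R) (a : R -> \bar R) (k : R) : countable J -> 0 <= k ->
  (forall t, 0 <= a t)%E ->
  (\esum_(t in J) (a t * k%:E) = (\esum_(t in J) a t) * k%:E)%E.
Proof.
move=> cJ k0 a0; have [e [P eP]] := esum_countable cJ.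
rewrite !eP//; last by move=> t; rewrite mule_ge0.
rewrite muleC -nneseriesZl//; last by move=> i _; case: ifP.
by apply: eq_eseriesr => i _; case: ifP => _; rewrite ?mule0// muleC.
Qed.

Lemma path_sup_addc c D x : D !=set0 ->
  path_sup ev D (addc_path c x) = ((expR c)%:E * path_sup ev D x)%E.
Proof.
move=> D0; rewrite /path_sup -ereal_supZl ?expR_ge0//; last first.
  by apply/set0P; case: D0 => t Dt; exists (expR (x t))%:E; exists t.
congr ereal_sup; apply/seteqP; split => r /=.
  move=> [t Dt <-]; exists (expR (x t))%:E; first by exists t.
  by rewrite -EFinM -expRD addrC.
move=> [_ [t Dt <-] <-]; exists t => //.
by rewrite /eval_path /= expRD mulrC EFinM.
Qed.

Lemma path_sup_shift h D x :
  path_sup ev D (shift_path h x) = path_sup ev [set t + h | t in D] x.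
Proof.
congr ereal_sup; apply/seteqP; split => r /= [t Dt <-].
  by exists (t + h) => //; exists t.
by case: Dt => s Ds <-; exists s.
Qed.

Lemma path_sup_ge0 D x : D !=set0 -> (0 <= path_sup ev D x)%E.
Proof.
move=> [t Dt]; apply: (@le_trans _ _ (expR (x t))%:E); first by rewrite lee_fin expR_ge0.
by apply: ereal_sup_ubound; exists t.
Qed.

Lemma path_sup_le D D' x : D `<=` D' -> (path_sup ev D x <= path_sup ev D' x)%E.
Proof. by move=> DD'; apply: le_ereal_sup => _ [t Dt <-]; exists t => //; exact: DD'. Qed.

Definition lattice_sum b x : \bar R := (\esum_(t in lattice b) (expR (x t))%:E)%E.

Lemma lattice_sumE b x : b != 0 -> path_sum ev b x = (b%:E * lattice_sum b x)%E.
Proof. by move=> b0; rewrite /path_sum (negbTE b0). Qed.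

Lemma lattice_sum_gt0 b x : (0 < lattice_sum b x)%E.
Proof.
apply: (@lt_le_trans _ _ (expR (x 0))%:E); first by rewrite lte_fin expR_gt0.
apply: (@le_trans _ _ (\esum_(t in [set 0%R]) (expR (x t))%:E)%E).
  by rewrite esum_set1// lee_fin expR_ge0.
rewrite /lattice_sum esum_mkcond [leRHS]esum_mkcond; apply: le_esum => t _.
case: ifPn => [|_]; last by case: ifP => // _; rewrite lee_fin expR_ge0.
by rewrite inE => ->; rewrite mem_set//; exact: lattice0.
Qed.

Lemma measurable_lattice_sum b : b != 0 -> measurable_fun setT (lattice_sum b).
Proof.
move=> b0; apply: measurable_esum; first exact: lattice_countable.
- by move=> t x; rewrite lee_fin expR_ge0.
- move=> t; apply/measurable_EFinP; apply: measurableT_comp => //.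
  exact: measurable_eval.
Qed.

Lemma lattice_sum_addc b c x : b != 0 ->
  lattice_sum b (addc_path c x) = (lattice_sum b x * (expR c)%:E)%E.
Proof.
move=> /lattice_countable cb; rewrite /lattice_sum -ge0_esumZr ?expR_ge0//.
by apply: eq_esum => t _; rewrite -EFinM -expRD.
Qed.

Lemma lattice_sum_shift b h x : lattice b h ->
  lattice_sum b (shift_path h x) = lattice_sum b x.
Proof.
by move=> bh; rewrite /lattice_sum (esum_latticeD (fun t => (expR (x t))%:E)).
Qed.

Lemma measurable_expR_path x : measurable_fun setT (fun t => (expR (x t))%:E).
Proof.
apply/measurable_EFinP; apply: measurableT_comp => //.
by apply: continuous_measurable_fun; exact: path_continuous.
Qed.

Definition path_mass x : \bar R := (\int[lebesgue_measure]_t (expR (x t))%:E)%E.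

Lemma path_mass_addc c x : path_mass (addc_path c x) = (path_mass x * (expR c)%:E)%E.
Proof.
rewrite /path_mass; under eq_integral do rewrite expRD EFinM.
rewrite ge0_integralZr// ?lee_fin ?expR_ge0//; exact: measurable_expR_path.
Qed.

Lemma path_mass_shift h x : path_mass (shift_path h x) = path_mass x.
Proof.
rewrite /path_mass -(@integral_shift R h setT (fun t => (expR (x t))%:E))//.
exact: measurable_expR_path.
Qed.

(** Reciprocals are kept real: [fine] sends [+oo] to 0 and [0^-1 = 0], so an infinite sum has
    reciprocal 0. *)
Lemma measurable_fine_inv (f : path R -> \bar R) : measurable_fun setT f ->
  (forall x, 0 <= f x)%E ->
  measurable_fun setT (fun x => ((fine (f x))^-1)%:E).
Proof.
move=> mf f0; apply/measurable_EFinP.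
have -> : (fun x => (fine (f x))^-1) = (fun x => (fine (f x)) `^ (-1)).
  by apply/funext => x; rewrite powR_inv1// fine_ge0.
apply: (@measurableT_comp _ _ _ _ _ _ (fun r : R => r `^ (-1)) _ (fun x => fine (f x))).
  exact: measurable_powR.
exact: measurableT_comp mf.
Qed.

Lemma fine_scale (y : \bar R) (k : R) : 0 < k -> fine (y * k%:E)%E = fine y * k.
Proof.
by move=> k0; case: y => [r| |]//=; rewrite ?gt0_mulye ?gt0_mulNye ?lte_fin// mul0r.
Qed.

End homogeneity.

(** * Change of base point and transport along a lattice *)

Section tilting.
Context (R : realType) (Q : probability (path R) R).
Local Notation ev := (@eval_path R).

(** From here on the law of the path enters through this identity and two moment bounds, its
    Gaussian nature being left behind. *)
Definition tilting := forall h (F : path R -> \bar R), measurable_fun setT F ->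
  (forall x, (0 <= F x)%E) ->
  (\int[Q]_x ((expR (x h))%:E * F (addc_path (- x h) (shift_path h x))) =
   \int[Q]_x F x)%E.

Hypothesis tiltQ : tilting.

Definition homogeneous (F : path R -> \bar R) :=
  forall c x, F (addc_path c x) = ((expR c)%:E * F x)%E.

(** The factor [e^(- x(h))] produced by homogeneity cancels the density: homogeneous functionals see
    a stationary law even though the path does not have one. *)
Lemma homogeneous_stationary h F : homogeneous F -> measurable_fun setT F ->
  (forall x, (0 <= F x)%E) ->
  (\int[Q]_x F (shift_path h x) = \int[Q]_x F x)%E.
Proof.
move=> hF mF F0; rewrite -(tiltQ h mF F0); apply: eq_integral => x _.
by rewrite hF muleA -EFinM -expRD addrN expR0 mul1e.
Qed.

Lemma invariant_tilt h G : (forall c x, G (addc_path c x) = G x) ->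
  measurable_fun setT G -> (forall x, (0 <= G x)%E) ->
  (\int[Q]_x ((expR (x h))%:E * G x) = \int[Q]_x G (shift_path (- h) x))%E.
Proof.
move=> hG mG G0.
have mGs := measurableT_comp mG (measurable_shift_path (- h)).
rewrite -(tiltQ h mGs (fun x => G0 _)).
apply: eq_integral => x _; congr (_ * _)%E.
rewrite -(hG (- x h) x) /=; congr G; apply: pathP => t /=.
by rewrite subrK.
Qed.

Section transport.
Variable b : R.
Hypothesis b0 : b != 0.
Hypothesis finY : {ae Q, forall x, (lattice_sum b x < +oo)%E}.

(** [F] divided by the lattice sum is invariant under adding constants. Splitting [F] in the
    proportions [e^x(t)] over the lattice and tilting each term trades the weight for a translation
    of [F], the lattice sum being invariant under lattice shifts. *)
Lemma mass_transport (F : path R -> \bar R) : homogeneous F -> measurable_fun setT F ->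
  (forall x, (0 <= F x)%E) ->
  (\int[Q]_x F x = \int[Q]_x ((\esum_(t in lattice b) F (shift_path t x)) *
     ((fine (lattice_sum b x))^-1)%:E))%E.
Proof.
move=> hF mF F0.
have cb := lattice_countable b0.
have Y0 x : (0 <= lattice_sum b x)%E by apply: ltW; exact: lattice_sum_gt0.
have Yi0 x : 0 <= (fine (lattice_sum b x))^-1 by rewrite invr_ge0 fine_ge0.
have mYi := measurable_fine_inv (measurable_lattice_sum b0) Y0.
pose G x := (F x * ((fine (lattice_sum b x))^-1)%:E)%E.
have mG : measurable_fun setT G by exact: emeasurable_funM.
have G0 x : (0 <= G x)%E by rewrite /G mule_ge0// lee_fin.
have invG c x : G (addc_path c x) = G x.
  rewrite /G hF lattice_sum_addc// fine_scale ?expR_gt0// invfM EFinM.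
  rewrite [X in (X * _)%E]muleC [(_ * ((expR c)^-1)%:E)%E]muleC muleA.
  by rewrite -[X in (X * _)%E]muleA -EFinM divff ?gt_eqF ?expR_gt0// mule1.
have mE t : measurable_fun setT (fun x : path R => (expR (x t))%:E).
  by apply/measurable_EFinP; apply: measurableT_comp => //; exact: measurable_eval.
have mS (t : R) := measurable_shift_path t.
transitivity (\int[Q]_x (\esum_(t in lattice b) ((expR (x t))%:E * G x)))%E.
  apply: ge0_ae_eq_integral => //.
  - apply: measurable_esum => // [t x|t]; first by rewrite mule_ge0// lee_fin expR_ge0.
    exact: emeasurable_funM.
  - by move=> x _; apply: esum_ge0 => t _; rewrite mule_ge0// lee_fin expR_ge0.
  move: finY; apply: filterS => x Yfin _.
  have Yf : lattice_sum b x \is a fin_num by rewrite ge0_fin_numE.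
  have Yp : 0 < fine (lattice_sum b x) by rewrite fine_gt0// lattice_sum_gt0.
  have e0 t : (0 <= (expR (x t))%:E :> \bar R)%E by rewrite lee_fin expR_ge0.
  rewrite /G; have := F0 x; case: (F x) => [r r0|_|//].
    rewrite -EFinM (@ge0_esumZr _ _ (fun t => (expR (x t))%:E))//; last first.
      by rewrite mulr_ge0.
    rewrite -/(lattice_sum b x) -(fineK Yf) -EFinM; congr EFin.
    by field; rewrite gt_eqF.
  (* Where [F] is infinite, the term at time 0 is already infinite, the reciprocal being
     positive. *)
  rewrite gt0_mulye ?lte_fin ?invr_gt0//; apply/esym/eqP; rewrite -leye_eq.
  apply: (@le_trans _ _ (\esum_(t in [set 0%R]) ((expR (x t))%:E * +oo))%E).
    by rewrite esum_set1 ?mule_ge0// gt0_muley// lte_fin expR_gt0.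
  rewrite esum_mkcond [leRHS]esum_mkcond; apply: le_esum => t _.
  case: ifPn => [|_]; last by case: ifP => // _; rewrite mule_ge0.
  by rewrite inE => ->; rewrite mem_set//; exact: lattice0.
rewrite integral_esum//; last 2 first.
- by move=> t x; rewrite mule_ge0// lee_fin expR_ge0.
- by move=> t; exact: emeasurable_funM.
(* Tilting shifts by [- t]; the reflection of the lattice turns this into a shift by [t]. *)
under eq_esum do rewrite invariant_tilt//.
rewrite (esum_latticeN b (fun t => \int[Q]_x G (shift_path t x)))%E.
rewrite -(integral_esum Q cb (f := fun t x => G (shift_path t x)) (fun t x => G0 _)
  (fun t => measurableT_comp mG (mS t))).
apply: eq_integral => x _; rewrite -(ge0_esumZr cb (Yi0 x) (fun t => F0 (shift_path t x))).
by apply: eq_esum => t bt; rewrite /G lattice_sum_shift.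
Qed.

End transport.
End tilting.

(** * Excess of a block over its past *)

Section lattice_enumeration.
Context (R : realType) (b : R).
Hypothesis b0 : 0 < b.

Lemma esum_lattice_nat (g : R -> \bar R) : (forall t, 0 <= g t)%E ->
  (\esum_(t in lattice b) g t =
   \sum_(n <oo) g (b * n%:R)%R + \sum_(n <oo) g (- (b * n.+1%:R))%R)%E.
Proof.
move=> g0; have bN0 : b != 0 by rewrite gt_eqF.
rewrite (esumID [set t | 0 <= t])//; congr (_ + _)%E.
  rewrite nneseries_esumT//; apply: (@reindex_esum _ _ _ _ _ (fun n : nat => b * n%:R)).
  split.
  - move=> n _; split; last by rewrite /= mulr_ge0// ltW.
    by right; exists n%:Z.
  - by move=> m n _ _ /(mulfI bN0) /eqP; rewrite eqr_nat => /eqP.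
  - move=> t [[/eqP|[z ->]] /=]; first by rewrite (negbTE bN0).
    rewrite pmulr_rge0// ler0z; case: z => // n _.
    by exists n.
rewrite nneseries_esumT//; apply: (@reindex_esum _ _ _ _ _ (fun n : nat => - (b * n.+1%:R))).
split.
- move=> n _; split; last by apply/negP; rewrite -ltNge oppr_lt0 mulr_gt0.
  by right; exists (- n.+1%:Z); rewrite intrN mulrN.
- by move=> m n _ _ /oppr_inj/(mulfI bN0) /eqP; rewrite eqr_nat => /eqP[].
- move=> t [[/eqP|[z ->]] /=]; first by rewrite (negbTE bN0).
  move=> /negP; rewrite pmulr_rge0// ler0z; case: z => // n _.
  by exists n => //; rewrite NegzE intrN mulrN.
Qed.

End lattice_enumeration.

Section blocks.
Context (R : realType).
Implicit Types (x : path R) (t s b : R) (A D : set R).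
Local Notation ev := (@eval_path R).

Lemma path_supU D D' x :
  path_sup ev (D `|` D') x = maxe (path_sup ev D x) (path_sup ev D' x).
Proof.
apply/eqP; rewrite eq_le; apply/andP; split.
  apply: ge_ereal_sup => _ [t [Dt|Dt] <-]; rewrite le_max; apply/orP.
    by left; apply: ereal_sup_ubound; exists t.
  by right; apply: ereal_sup_ubound; exists t.
by rewrite ge_max; apply/andP; split; apply: path_sup_le => t ?; [left|right].
Qed.

Definition before A t := A `&` [set s | s < t].
Definition block A t b := A `&` [set s | t <= s < t + b].

Lemma beforeD A t b : 0 <= b -> before A (t + b) = before A t `|` block A t b.
Proof.
move=> b0; apply/seteqP; split => s.
  move=> [As /= stb]; have [st|ts] := ltP s t; first by left.
  by right; split => //=; rewrite ts.
by move=> [[As /= st]|[As /= /andP[_ st]]]; split => //=; lra.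
Qed.

Definition sup_excess D D' x : \bar R :=
  maxe 0%E (path_sup ev D x - path_sup ev D' x)%E.

(* The amount by which the supremum over [0, b[ exceeds the supremum over the
   negative half-line; its translates telescope to the global supremum. *)
Definition excess A b x : \bar R := sup_excess (block A 0 b) (before A 0) x.

(** A majorant of the global supremum. Its finiteness makes the subtractions in the telescoping
    legitimate and, through its tail, forces the supremum over the remote past to vanish. *)
Definition block_sum b x : \bar R :=
  (\esum_(t in lattice b) path_sup ev (block setT t b) x)%E.

Lemma esum_ge1 (J : set R) (a : R -> \bar R) t : J t -> (forall s, 0 <= a s)%E ->
  (a t <= \esum_(s in J) a s)%E.
Proof.
move=> Jt a0; rewrite -(@esum_set1 _ _ t a (a0 t)) esum_mkcond [leRHS]esum_mkcond.
apply: le_esum => s _; case: ifPn => [|_]; last by case: ifP.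
by rewrite inE => ->; rewrite mem_set.
Qed.

Lemma block_neq0 t b : 0 < b -> block setT t b !=set0.
Proof. by move=> b0; exists t; split => //=; rewrite lexx ltrDl. Qed.

Lemma mem_block_floor b t : 0 < b -> block setT (b * (Num.floor (t / b))%:~R) b t.
Proof.
move=> b0; split => //=; have /andP[h1 h2] := floor_itv (t / b).
rewrite mulrC -ler_pdivlMr// h1/= -[X in _ + X]mul1r -mulrDl -ltr_pdivrMr//.
by rewrite intrD1 in h2.
Qed.

Section telescope.
Variables (A : set R) (b : R) (x : path R).
Hypotheses (b0 : 0 < b) (A0 : A 0)
  (AD : forall s t, A s -> lattice b t -> A (s + t))
  (fin_blocks : (block_sum b x < +oo)%E).

Let bN0 : b != 0. Proof. by rewrite gt_eqF. Qed.

Let block0 t : (0 <= path_sup ev (block setT t b) x)%E.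
Proof. exact/path_sup_ge0/block_neq0. Qed.

Let latt (n : int) : lattice b (b * n%:~R). Proof. by right; exists n. Qed.

Lemma path_sup_setT_le : (path_sup ev setT x <= block_sum b x)%E.
Proof.
apply: ge_ereal_sup => _ [t _ <-].
apply: (@le_trans _ _ (path_sup ev (block setT (b * (Num.floor (t / b))%:~R) b) x)).
  by apply: ereal_sup_ubound; exists t => //; exact: mem_block_floor.
exact: (esum_ge1 (a := fun t => path_sup ev (block setT t b) x)).
Qed.

Let before_neq0 t : before A t !=set0.
Proof.
exists (b * (Num.floor (t / b) - 1)%:~R); split; first by rewrite -[X in A X]add0r; exact: AD.
have [_ /=] := mem_block_floor t b0; rewrite intrB mulrBr mulr1 => /andP[h1 h2].
lra.
Qed.

Let fin_before t : path_sup ev (before A t) x \is a fin_num.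
Proof.
rewrite ge0_fin_numE; last exact: path_sup_ge0.
apply: le_lt_trans fin_blocks; apply: le_trans path_sup_setT_le.
exact: path_sup_le.
Qed.

Lemma path_sup_fin : path_sup ev A x \is a fin_num.
Proof.
rewrite ge0_fin_numE; last by apply: path_sup_ge0; exists 0.
apply: le_lt_trans fin_blocks; apply: le_trans path_sup_setT_le.
exact: path_sup_le.
Qed.

(** The running supremum; each translated excess is its increment over one block. *)
Let a t := fine (path_sup ev (before A t) x).

Let aE t : path_sup ev (before A t) x = (a t)%:E.
Proof. by rewrite fineK. Qed.

Let a_ge0 t : 0 <= a t.
Proof. by rewrite fine_ge0// path_sup_ge0. Qed.

Let a_mono s t : s <= t -> a s <= a t.
Proof.
move=> st; rewrite -lee_fin -!aE; apply: path_sup_le => u [Au /= us].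
by split => //=; exact: lt_le_trans st.
Qed.

Let shift_set t D E : lattice b t -> (forall s, D s <-> E (s + t)) ->
  [set s + t | s in D] = E.
Proof.
move=> bt DE; apply/seteqP; split => s /=; first by move=> [u Du <-]; exact/DE.
by move=> Es; exists (s - t); rewrite ?subrK//; apply/DE; rewrite subrK.
Qed.

Let excess_shift t : lattice b t -> excess A b (shift_path t x) = (a (t + b) - a t)%:E.
Proof.
move=> bt; have inv s : A s <-> A (s + t).
  split=> [As|]; first exact: AD.
  by move=> /AD/(_ (latticeN bt)); rewrite addrK.
rewrite /excess /sup_excess !path_sup_shift (@shift_set t _ (block A t b))//; last first.
  move=> s; split=> -[As] /= /andP[h1 h2]; (split; first by [exact: ((inv s).1 As)|exact: ((inv s).2 As)]);
    by apply/andP; split; lra.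
rewrite (@shift_set t _ (before A t))//; last first.
  by move=> s; split=> -[As] /= h; (split; first by [exact: ((inv s).1 As)|exact: ((inv s).2 As)]) => /=; lra.
have := aE (t + b); rewrite beforeD ?ltW// path_supU !aE.
case: (path_sup ev (block A t b) x) => [q| |] //=.
- rewrite -EFin_max => -[<-]; rewrite -EFinB -EFin_max; congr EFin.
  have [h|h] := leP (a t) q; first by rewrite max_r// subr_ge0.
  by rewrite subrr max_l// subr_le0 ltW.
- by rewrite maxEle leey.
- rewrite maxEle leeNy_eq/= => -[->]; by rewrite subrr maxEle/=.
Qed.

Let cvg_up : (a (b * n%:R))%:E @[n --> \oo] --> path_sup ev A x.
Proof.
have -> : path_sup ev A x = ereal_sup (range (fun n : nat => (a (b * n%:R))%:E)).
  apply/eqP; rewrite eq_le; apply/andP; split.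
    apply: ge_ereal_sup => _ [t At <-].
    pose n := (Num.truncn (`|t| / b)).+1.
    apply: (@le_trans _ _ (a (b * n%:R))%:E); last by apply: ereal_sup_ubound; exists n.
    rewrite -aE; apply: ereal_sup_ubound; exists t => //; split => //=.
    rewrite mulrC -ltr_pdivrMr//; apply: le_lt_trans (truncnS_gt _).
    by rewrite ler_pM2r ?invr_gt0// ler_norm.
  apply: ge_ereal_sup => _ [n _ <-]; rewrite -aE; apply: path_sup_le.
  by move=> t [].
apply: ereal_nondecreasing_cvgn => m n mn; rewrite lee_fin; apply: a_mono.
by rewrite ler_pM2l// ler_nat.
Qed.

(** The supremum before [- b N] is bounded by the sum of the suprema over the blocks lying there, a
    tail of a convergent series. *)
Let cvg_down : a (- (b * n%:R)) @[n --> \oo] --> 0.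
Proof.
pose g n := path_sup ev (block setT (- (b * n.+1%:R)) b) x.
have g0 n : (0 <= g n)%E by exact: block0.
have gfin : (\sum_(0 <= n <oo) g n < +oo)%E.
  apply: le_lt_trans fin_blocks.
  by rewrite /block_sum (esum_lattice_nat b0)// leeDr// nneseries_ge0.
have /= tail := @nneseries_tail_cvg R g xpredT gfin (fun n _ => g0 n).
(* A time below [- b N] lies in the block that starts at [- b m] for some [m > N]; this block has
   index [m - 1] in [g], which is at least [N]. *)
have h N : ((a (- (b * N%:R)))%:E <= \sum_(N <= n <oo) g n)%E.
  rewrite -aE; apply: ge_ereal_sup => _ [t [_ /= tN] <-].
  pose m := `|Num.floor (t / b)|%N.
  have fneg : (Num.floor (t / b) < - N%:Z)%R.
    rewrite -(ltr_int R); apply: le_lt_trans (floor_le _) _.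
    by rewrite ltr_pdivrMr// intrN mulNr mulrC.
  have fE : (Num.floor (t / b))%:~R = - m%:R :> R.
    have fl0 : (Num.floor (t / b) < 0)%R.
      by apply: lt_le_trans fneg _; rewrite oppr_le0.
    have -> : m%:R = m%:Z%:~R :> R by [].
    by rewrite /m ltz0_abs// intrN opprK.
  have Nm : (N < m)%N.
    by rewrite -(ltr_nat R); move: fneg; rewrite -(ltr_int R) fE intrN ltrN2.
  apply: (@le_trans _ _ (g m.-1)).
    apply: ereal_sup_ubound; exists t => //.
    by have := mem_block_floor t b0; rewrite fE mulrN prednK//; exact: leq_ltn_trans Nm.
  rewrite (_ : m.-1 = N + (m.-1 - N))%N; last by rewrite subnKC// -ltnS prednK//; exact: leq_ltn_trans Nm.
  move: (m.-1 - N)%N => k {Nm fE m}.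
  rewrite (@nneseries_split _ g N k.+1)// addnS big_nat_recr ?leq_addr//=.
  by rewrite addeAC leeDr// adde_ge0// ?nneseries_ge0// sume_ge0.
apply/cvgrPdist_le => e e0.
have : \forall n \near \oo, (\sum_(n <= k <oo) g k <= e%:E)%E.
  have [/= + hf] := (fine_cvgP _ _).1 tail.
  move/cvgrPdist_le : hf => /(_ _ e0); apply: filterS2 => n hn fn.
  rewrite -(fineK fn) lee_fin; apply: le_trans hn.
  by rewrite sub0r normrN ler_norm.
apply: filterS => n hn; rewrite sub0r normrN ger0_norm// -lee_fin.
exact: le_trans (h n) hn.
Qed.

(** The nonnegative lattice times contribute the global supremum minus [a 0], the negative ones
    [a 0] minus the limit 0 in the past. *)
Lemma excess_telescope :
  (\esum_(t in lattice b) excess A b (shift_path t x) = path_sup ev A x)%E.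
Proof.
have ex0 t : (0 <= excess A b (shift_path t x))%E by rewrite /excess /sup_excess le_max lexx.
rewrite (esum_lattice_nat b0)//.
have fM := path_sup_fin.
have -> : (\sum_(n <oo) excess A b (shift_path (b * n%:R) x) =
    path_sup ev A x - (a 0)%:E)%E.
  transitivity (\sum_(0 <= n <oo) ((a (b * n.+1%:R))%:E - (a (b * n%:R))%:E))%E.
    apply: eq_eseriesr => n _; rewrite excess_shift; last by right; exists n%:Z.
    by rewrite -EFinB -natr1 mulrDr mulr1.
  have lim := cvg_lim (@ereal_hausdorff R) cvg_up.
  rewrite (@nondecreasing_telescope_sumey _ 0 (fun n => a (b * n%:R))); last 2 first.
  - by rewrite lim.
  - by move=> m n mn; apply: a_mono; rewrite ler_pM2l// ler_nat.
  by rewrite lim mulr0.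
have -> : (\sum_(n <oo) excess A b (shift_path (- (b * n.+1%:R)) x) = (a 0)%:E)%E.
  transitivity (\sum_(0 <= n <oo) ((- a (- (b * n.+1%:R)))%:E - (- a (- (b * n%:R)))%:E))%E.
    apply: eq_eseriesr => n _; rewrite excess_shift; last exact/latticeN/(latt n.+1).
    rewrite -EFinB opprK [in RHS]addrC; congr (a _ - _)%:E.
    by rewrite -natr1; ring.
  have c : (- a (- (b * n%:R)))%:E @[n --> \oo] --> (0 : R)%:E.
    by apply: cvg_EFin; [exact: nearW|rewrite -oppr0; apply: cvgN; exact: cvg_down].
  have lim := cvg_lim (@ereal_hausdorff R) c.
  rewrite (@nondecreasing_telescope_sumey _ 0 (fun n => - a (- (b * n%:R)))); last 2 first.
  - by rewrite lim.
  - by move=> m n mn; rewrite lerN2; apply: a_mono; rewrite lerN2 ler_pM2l// ler_nat.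
  by rewrite lim mulr0 oppr0 -EFinB opprK add0r.
by rewrite subeK.
Qed.

End telescope.

End blocks.

(** * The limit of the Pickands ratios *)

Section block_integrals.
Context (R : realType) (Q : probability (path R) R).
Local Notation ev := (@eval_path R).

Hypothesis tiltQ : tilting Q.
Hypothesis supQ : forall K, 0 <= K ->
  (\int[Q]_x path_sup ev [set` `[0, K]%R] x < +oo)%E.
Hypothesis halfQ : forall b : R, 0 < b ->
  (\esum_(t in lattice b) \int[Q]_x (expR (x t / 2))%:E < +oo)%E.

Lemma ae_fin (f : path R -> \bar R) : measurable_fun setT f -> (forall x, 0 <= f x)%E ->
  (\int[Q]_x f x < +oo)%E -> {ae Q, forall x, (f x < +oo)%E}.
Proof.
move=> mf f0 foo.
have fi : Q.-integrable setT f.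
  by apply/integrableP; split => //; under eq_integral do rewrite gee0_abs//.
move: (integrable_ae measurableT fi); apply: filterS => x /(_ I) ffin.
by rewrite -ge0_fin_numE.
Qed.

(** The half moments make [sum e^(x(t)/2)] almost surely finite, and a sum of squares of nonnegative
    terms is at most the square of their sum. *)
Lemma lattice_sum_finite (b : R) : 0 < b -> {ae Q, forall x, (lattice_sum b x < +oo)%E}.
Proof.
move=> b0; have bN0 : b != 0 by rewrite gt_eqF.
have cb := lattice_countable bN0.
have me t : measurable_fun setT (fun x : path R => (expR (x t / 2))%:E).
  apply/measurable_EFinP; apply: measurableT_comp => //.
  by apply: measurable_funM => //; exact: measurable_eval.
have e0 t (x : path R) : (0 <= (expR (x t / 2))%:E :> \bar R)%E by rewrite lee_fin expR_ge0.
have := @ae_fin (fun x => \esum_(t in lattice b) (expR (x t / 2))%:E)%E.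
move=> /(_ (measurable_esum cb e0 me) (fun x => esum_ge0 (fun t _ => e0 t x))).
rewrite integral_esum// => /(_ (halfQ b0)); apply: filterS => x /= hx.
set s := \esum_(t in _) _ in hx.
have s0 : (0 <= s)%E by apply: esum_ge0.
have sf : s \is a fin_num by rewrite ge0_fin_numE.
apply: (@le_lt_trans _ _ (s * (fine s)%:E)%E); last by rewrite -(fineK sf) -EFinM ltry.
rewrite -ge0_esumZr ?fine_ge0//.
apply: le_esum => t bt; rewrite -EFinM lee_fin.
rewrite [X in expR X](_ : _ = x t / 2 + x t / 2); last by field.
rewrite expRD ler_wpM2l ?expR_ge0// -lee_fin fineK//.
exact: (esum_ge1 (a := fun t => (expR (x t / 2))%:E)).
Qed.

Lemma measurable_block_sum (b : R) : 0 < b -> measurable_fun setT (@block_sum R b).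
Proof.
move=> b0; apply: measurable_esum; first by apply: lattice_countable; rewrite gt_eqF.
- by move=> t x; exact/path_sup_ge0/block_neq0.
- by move=> t; exact: measurable_path_sup.
Qed.

Lemma path_sup_homogeneous (D : set R) : D !=set0 -> homogeneous (path_sup ev D).
Proof. by move=> D0 c x; exact: path_sup_addc. Qed.

Lemma path_sup_block_int (A : set R) (K : R) :
  (\int[Q]_x path_sup ev (block A 0 K) x < +oo)%E.
Proof.
have K0 : 0 <= `|K| by [].
have [->|/set0P ne] := eqVneq (block A 0 K) set0.
  rewrite (_ : path_sup ev set0 = cst -oo%E); first by rewrite integral_cst//= probability_setT mule1.
  by apply/funext => x; rewrite /path_sup image_set0 ereal_sup0.
apply: le_lt_trans (supQ K0); apply: ge0_le_integral => //.
- by move=> x _; exact: path_sup_ge0.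
- exact: measurable_path_sup.
- exact: measurable_path_sup.
move=> x _; apply: path_sup_le => t [_ /= /andP[t0 tK]]; rewrite in_itv/= t0/=.
by have := ler_norm K; lra.
Qed.

(** Transport of the supremum over [[0, b[] gives the expectation of [block_sum] divided by the
    lattice sum. It is finite by the local bound, and the lattice sum is almost surely finite, so
    the numerator is too. *)
Lemma block_sum_finite (b : R) : 0 < b -> {ae Q, forall x, (block_sum b x < +oo)%E}.
Proof.
move=> b0; have bN0 : b != 0 by rewrite gt_eqF.
have cb := lattice_countable bN0.
have ne t := @block_neq0 R t b b0.
have p0 t x : (0 <= path_sup ev (block setT t b) x)%E by exact: path_sup_ge0.
have finY := lattice_sum_finite b0.
have Y0 x : (0 <= @lattice_sum R b x)%E by apply: ltW; exact: lattice_sum_gt0.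
have mYi := measurable_fine_inv (measurable_lattice_sum bN0) Y0.
have mB := measurable_block_sum b0.
have B0 x : (0 <= @block_sum R b x)%E by apply: esum_ge0.
have E x : (\esum_(t in lattice b) path_sup ev (block setT 0 b) (shift_path t x) = block_sum b x)%E.
  apply: eq_esum => t bt; rewrite path_sup_shift; congr (path_sup ev _ x).
  apply/seteqP; split => s /=.
    by move=> [u [_ /= /andP[h1 h2]] <-]; split => //=; apply/andP; split; lra.
  move=> [_ /= /andP[h1 h2]]; exists (s - t); last by rewrite subrK.
  by split => //=; apply/andP; split; lra.
have := path_sup_block_int setT b.
rewrite (mass_transport tiltQ bN0 finY)//; last 2 first.
- exact: path_sup_homogeneous.
- exact: measurable_path_sup.
under eq_integral do rewrite E.
have mf : measurable_fun setT (fun x => block_sum b x * ((fine (lattice_sum b x))^-1)%:E)%E.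
  exact: emeasurable_funM.
have f0 x : (0 <= block_sum b x * ((fine (lattice_sum b x))^-1)%:E)%E.
  by rewrite mule_ge0// lee_fin invr_ge0 fine_ge0.
move=> /(ae_fin mf f0); move: finY; apply: filterS2 => x Yfin.
have Yi : 0 < (fine (lattice_sum b x))^-1.
  by rewrite invr_gt0 fine_gt0// lattice_sum_gt0.
have := B0 x; case: (block_sum b x) => [r _ _|_|//]; first exact: ltry.
by rewrite gt0_mulye// lte_fin.
Qed.

Lemma sup_excess_homogeneous (D E : set R) : D !=set0 -> E !=set0 ->
  homogeneous (sup_excess D E).
Proof.
move=> D0 E0 c x; rewrite /sup_excess !path_sup_addc// maxe_pMr ?lee_fin ?expR_ge0//.
rewrite mule0; congr maxe.
have := path_sup_ge0 x D0; have := path_sup_ge0 x E0.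
case: (path_sup ev D x) (path_sup ev E x) => [r| |] [s| |]//= _ _.
- by rewrite -?EFinB; congr EFin; ring.
- by rewrite !gt0_muley ?lte_fin ?expR_gt0//= gt0_muleNy ?lte_fin ?expR_gt0.
- by rewrite !gt0_muley ?lte_fin ?expR_gt0//= gt0_muley ?lte_fin ?expR_gt0.
- by rewrite !gt0_muley ?lte_fin ?expR_gt0//= gt0_muleNy ?lte_fin ?expR_gt0.
Qed.

Lemma measurable_sup_excess (D E : set R) : measurable_fun setT (sup_excess D E).
Proof.
apply: measurable_maxe => //; apply: emeasurable_funB; exact: measurable_path_sup.
Qed.

Lemma sup_excess_ge0 (D E : set R) (x : path R) : (0 <= sup_excess D E x)%E.
Proof. by rewrite /sup_excess le_max lexx. Qed.

Lemma sup_excess_le (D E : set R) (x : path R) : D !=set0 -> E !=set0 ->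
  (sup_excess D E x <= path_sup ev D x)%E.
Proof.
move=> D0 E0; rewrite /sup_excess ge_max path_sup_ge0//=.
have := path_sup_ge0 x D0; have := path_sup_ge0 x E0.
case: (path_sup ev D x) (path_sup ev E x) => [r| |] [s| |]//= hs hr.
- by rewrite -EFinB lee_fin lerBlDr lerDl -lee_fin.
- by rewrite leNye.
Qed.

End block_integrals.

Lemma maxe_excess (R : realType) (p q : \bar R) : (0 <= p < +oo)%E ->
  (maxe p q = p + maxe 0 (q - p))%E.
Proof.
case: p => [p| |] /andP[]//; rewrite ?ltxx// => p0 _.
case: q => [q| |]//=.
- rewrite -EFinB -!EFin_max -EFinD; congr EFin.
  have [h|h] := leP p q; first by rewrite max_r ?subr_ge0// addrC subrK.
  by rewrite max_l ?addr0// subr_le0 ltW.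
- by rewrite maxEle leey maxEle leey.
- by rewrite maxEle leeNy_eq/= maxEle leeNy_eq/= adde0.
Qed.

Section excess_integrals.
Context (R : realType) (Q : probability (path R) R).
Local Notation ev := (@eval_path R).

Hypothesis tiltQ : tilting Q.
Hypothesis supQ : forall K, 0 <= K ->
  (\int[Q]_x path_sup ev [set` `[0, K]%R] x < +oo)%E.
Hypothesis halfQ : forall b : R, 0 < b ->
  (\esum_(t in lattice b) \int[Q]_x (expR (x t / 2))%:E < +oo)%E.

Variables (A : set R) (b : R).
Hypotheses (b0 : 0 < b) (A0 : A 0)
  (AD : forall s t, A s -> lattice b t -> A (s + t)).

Let bN0 : b != 0. Proof. by rewrite gt_eqF. Qed.

Let latt (n : int) : lattice b (b * n%:~R). Proof. by right; exists n. Qed.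

Let before_neq0 : before A 0 !=set0.
Proof.
exists (b * (-1)%:~R); split; first by rewrite -[X in A X]add0r; exact: AD.
by rewrite /= mulrN1 oppr_lt0.
Qed.

Let block0 n : block A 0 (b * n.+1%:R) !=set0.
Proof. by exists 0; split => //=; rewrite lexx add0r mulr_gt0. Qed.

Let past n := block A (- (b * n.+1%:R)) (b * n.+1%:R).

Let past0 n : past n !=set0.
Proof.
exists (- (b * n.+1%:R)); split; last by rewrite /= lexx ltrDl mulr_gt0.
rewrite -[X in A X]add0r; apply: AD => //.
by apply: latticeN; exact: (latt n.+1).
Qed.

Let block1 : block A 0 b !=set0. Proof. by have := block0 0; rewrite mulr1. Qed.

Let intb : (\int[Q]_x path_sup ev (block A 0 b) x < +oo)%E.
Proof. exact: path_sup_block_int. Qed.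

Lemma excess_integral : (\int[Q]_x excess A b x =
  \int[Q]_x (path_sup ev A x * ((fine (lattice_sum b x))^-1)%:E))%E.
Proof.
have finY := lattice_sum_finite halfQ b0.
have finB := block_sum_finite tiltQ supQ halfQ b0.
have Y0 x : (0 <= @lattice_sum R b x)%E by apply: ltW; exact: lattice_sum_gt0.
have mYi := measurable_fine_inv (measurable_lattice_sum bN0) Y0.
have mE := measurable_sup_excess (block A 0 b) (before A 0).
have E0 x := sup_excess_ge0 (block A 0 b) (before A 0) x.
rewrite (mass_transport tiltQ bN0 finY (sup_excess_homogeneous block1 before_neq0))//.
have cb := lattice_countable bN0.
have Yi0 x : (0 <= ((fine (@lattice_sum R b x))^-1)%:E :> \bar R)%E.
  by rewrite lee_fin invr_ge0 fine_ge0.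
apply: ge0_ae_eq_integral => //.
- apply: emeasurable_funM => //; apply: measurable_esum => // t.
  exact: (measurableT_comp mE (measurable_shift_path t)).
- by apply: emeasurable_funM => //; exact: measurable_path_sup.
- by move=> x _; rewrite mule_ge0//; apply: esum_ge0.
- by move=> x _; rewrite mule_ge0//; apply: path_sup_ge0; exists 0.
move: finB; apply: filterS => x Bx _; congr (_ * _)%E.
exact: excess_telescope.
Qed.

Let u n := (\int[Q]_x sup_excess (block A 0 b) (past n) x)%E.

(** Finite pasts exhaust the negative half-line, and every excess is dominated by the integrable
    supremum over the block itself. *)
Lemma past_excess_cvg : u n @[n --> \oo] --> (\int[Q]_x excess A b x)%E.
Proof.
have finB := block_sum_finite tiltQ supQ halfQ b0.
have mp := @measurable_path_sup R (block A 0 b).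
have ip : Q.-integrable setT (path_sup ev (block A 0 b)).
  apply/integrableP; split => //; under eq_integral do rewrite gee0_abs ?path_sup_ge0//.
  exact: intb.
have [] // := @dominated_convergence _ _ _ Q setT measurableT
  (fun n => sup_excess (block A 0 b) (past n)) (excess A b) (path_sup ev (block A 0 b)).
- by move=> n; exact: measurable_sup_excess.
- exact: measurable_sup_excess.
- move: finB; apply: filterS => x Bx _.
  have fin D : D !=set0 -> path_sup ev D x \is a fin_num.
    move=> D0; rewrite ge0_fin_numE; last exact: path_sup_ge0.
    apply: le_lt_trans Bx; apply: le_trans (path_sup_setT_le _ b0); exact: path_sup_le.
  rewrite /excess /sup_excess -(fineK (fin _ block1)) -(fineK (fin _ before_neq0)).
  have -> : (fun n => maxe 0%E ((fine (path_sup ev (block A 0 b) x))%:E - path_sup ev (past n) x)%E) =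
    (fun n => (Num.max (0:R) (fine (path_sup ev (block A 0 b) x) - fine (path_sup ev (past n) x)))%:E).
    by apply/funext => n; rewrite EFin_max EFinB (fineK (fin _ (past0 n))).
  rewrite -EFinB -EFin_max; apply: cvg_EFin; first exact: nearW.
  set p := fine _; set q := fine _.
  have cm : {for q, continuous ((fun _ : R => 0 : R^o) \max (fun y : R => p - y : R^o))}.
    apply: (@continuous_max R R); first exact: cvg_cst.
    by apply: cvgB; [exact: cvg_cst|exact: cvg_id].
  suff hc : fine (path_sup ev (past n) x) @[n --> \oo] --> q by exact: (cvg_comp _ _ hc cm).
  apply: fine_cvg; rewrite /q fineK ?fin//.
  have -> : path_sup ev (before A 0) x = ereal_sup (range (fun n => path_sup ev (past n) x)).
    apply/eqP; rewrite eq_le; apply/andP; split.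
      apply: ge_ereal_sup => _ [t [At /= tneg] <-].
      pose n := Num.truncn (`|t| / b).
      apply: (@le_trans _ _ (path_sup ev (past n) x)); last by apply: ereal_sup_ubound; exists n.
      apply: ereal_sup_ubound; exists t => //; split => //=.
      rewrite addNr tneg andbT lerNl -ltr0_norm// mulrC -ler_pdivrMr//.
      exact/ltW/truncnS_gt.
    apply: ge_ereal_sup => _ [n _ <-]; apply: path_sup_le.
    by move=> t [At /= /andP[_ h]]; split => //=; rewrite addNr in h.
  apply: ereal_nondecreasing_cvgn => m n mn; apply: path_sup_le => t [At /= /andP[h1 h2]].
  split => //=; rewrite addNr in h2; rewrite addNr h2 andbT; apply: le_trans h1.
  by rewrite lerN2 ler_pM2l// ler_nat.
- apply: aeW => x n _; rewrite gee0_abs ?sup_excess_ge0//; exact: sup_excess_le.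
Qed.

Let F n := (\int[Q]_x path_sup ev (block A 0 (b * n.+1%:R)) x)%E.

(** Adding a block raises the supremum by its excess over what precedes. The excess is homogeneous,
    hence stationary: moving the new block back to the origin turns [[0, tau[] into the past [[-
    tau, 0[]. *)
Lemma path_sup_block_succ n : F n.+1 = (F n + u n)%E.
Proof.
have [tau tauE] : exists tau, b * n.+1%:R = tau by exists (b * n.+1%:R).
have lt_tau : lattice b tau by rewrite -tauE; exact: (latt n.+1).
have pastE : past n = block A (- tau) tau by rewrite /past tauE.
have past_neq0 : block A (- tau) tau !=set0 by rewrite -pastE; exact: past0.
have tau_neq0 : block A 0 tau !=set0 by rewrite -tauE; exact: block0.
have Db : block A 0 (b * n.+2%:R) = block A 0 tau `|` block A tau b.
  have tau0 : 0 < tau by rewrite -tauE mulr_gt0.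
  apply/seteqP; split => s; rewrite /block /= -[n.+2%:R]natr1 mulrDr mulr1 tauE add0r.
    move=> [As /andP[h1 h2]]; have [h|h] := ltP s tau; [left|right]; split => //=;
      by apply/andP; split; lra.
  by move=> [[As /andP[h1 h2]]|[As /andP[h1 h2]]]; split => //=; apply/andP; split; have := b0; lra.
have inv s : A s <-> A (s + tau).
  split=> [As|]; first exact: AD.
  by move=> /AD/(_ (latticeN lt_tau)); rewrite addrK.
have shift (D E : set R) : (forall s, D s <-> E (s + tau)) -> [set s + tau | s in D] = E.
  move=> DE; apply/seteqP; split => s /=; first by move=> [v Dv <-]; exact/DE.
  by move=> Es; exists (s - tau); rewrite ?subrK//; apply/DE; rewrite subrK.
have shiftb : [set s + tau | s in block A 0 b] = block A tau b.
  by apply: shift => s; split=> -[As /= /andP[h1 h2]];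
    (split; first by [exact: ((inv s).1 As)|exact: ((inv s).2 As)]);
    apply/andP; split; lra.
have shiftp : [set s + tau | s in block A (- tau) tau] = block A 0 tau.
  by apply: shift => s; split=> -[As /= /andP[h1 h2]];
    (split; first by [exact: ((inv s).1 As)|exact: ((inv s).2 As)]);
    apply/andP; split; lra.
have uE : u n = (\int[Q]_x sup_excess (block A tau b) (block A 0 tau) x)%E.
  have := homogeneous_stationary tiltQ tau (sup_excess_homogeneous block1 past_neq0)
    (measurable_sup_excess _ _) (fun x => sup_excess_ge0 _ _ x).
  rewrite /u pastE => <-; apply: eq_integral => x _.
  by rewrite /sup_excess !path_sup_shift shiftb shiftp.
rewrite uE /F Db tauE {uE}.
have mp := @measurable_path_sup R (block A 0 tau).
have p0 x : (0 <= path_sup ev (block A 0 tau) x)%E := path_sup_ge0 x tau_neq0.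
have mG := measurable_sup_excess (block A tau b) (block A 0 tau).
have G0 x := sup_excess_ge0 (block A tau b) (block A 0 tau) x.
rewrite -(ge0_integralD Q measurableT (fun x _ => p0 x) mp (fun x _ => G0 x) mG).
have pU x : (0 <= path_sup ev (block A 0 tau `|` block A tau b) x)%E.
  by rewrite path_supU le_max p0.
apply: (ge0_ae_eq_integral measurableT _ _ (fun x _ => pU x)).
- exact: measurable_path_sup.
- exact: emeasurable_funD.
- by move=> x _; rewrite adde_ge0.
have := ae_fin mp p0 (path_sup_block_int supQ A tau); apply: filterS => x px _.
by rewrite path_supU maxe_excess ?p0.
Qed.

Lemma excess_integral_lty : (\int[Q]_x excess A b x < +oo)%E.
Proof.
apply: le_lt_trans intb; apply: ge0_le_integral => //.
- by move=> x _; exact: sup_excess_ge0.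
- exact: measurable_sup_excess.
- exact: measurable_path_sup.
- by move=> x _; exact: sup_excess_le.
Qed.

(** In the transported form the integrand is almost surely positive: the supremum is at least
    [e^x(0)], and the reciprocal is nonzero because the lattice sum is almost surely finite. *)
Lemma excess_integral_gt0 : (0 < \int[Q]_x excess A b x)%E.
Proof.
rewrite excess_integral.
have finY := lattice_sum_finite halfQ b0.
have Y0 x : (0 <= @lattice_sum R b x)%E by apply: ltW; exact: lattice_sum_gt0.
have Yi0 x : (0 <= ((fine (@lattice_sum R b x))^-1)%:E :> \bar R)%E.
  by rewrite lee_fin invr_ge0 fine_ge0.
have mYi := measurable_fine_inv (measurable_lattice_sum bN0) Y0.
have Ax x : (0 < path_sup ev A x)%E.
  apply: (@lt_le_trans _ _ (expR (x 0))%:E); first by rewrite lte_fin expR_gt0.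
  by apply: ereal_sup_ubound; exists 0.
have g0 x : (0 <= path_sup ev A x * ((fine (@lattice_sum R b x))^-1)%:E)%E.
  by rewrite mule_ge0// ltW.
have mg : measurable_fun setT (fun x => path_sup ev A x * ((fine (@lattice_sum R b x))^-1)%:E)%E.
  by apply: emeasurable_funM => //; exact: measurable_path_sup.
rewrite lt0e; apply/andP; split; last exact: integral_ge0.
apply/eqP => I0.
have := (ae_eq_integral_abs Q measurableT mg).1.
under eq_integral do rewrite gee0_abs//.
move=> /(_ I0) h.
suff : Q setT = 0%E by rewrite probability_setT => /eqP; rewrite eqe oner_eq0.
suff : Q.-negligible setT by move=> /negligibleP; exact.
suff : {ae Q, forall x : path R, False} by apply: negligibleS => x _ [].
move: finY h; apply: filterS2 => x Yx /(_ I)/eqP.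
rewrite mule_eq0 gt_eqF//= eqe invr_eq0 gt_eqF// fine_gt0// lattice_sum_gt0//.
Qed.

End excess_integrals.

(** Increments converging to [L] give [f n / n] the limit [L] by Cesaro; [G] is then squeezed
    between neighbouring values of [f]. *)
Lemma mean_growth (R : realType) (b L : R) (f v : nat -> R) (G : R -> R) : 0 < b ->
  (forall n, f n.+1 = f n + v n) -> v n @[n --> \oo] --> L -> (forall n, 0 <= f n) ->
  (forall (n : nat) (t : R), b * n.+1%:R <= t -> f n <= G t) ->
  (forall (n : nat) (t : R), 0 <= t < b * n.+1%:R -> G t <= f n) ->
  t^-1 * G t @[t --> +oo] --> b^-1 * L.
Proof.
move=> b0 fS vL f0 fG Gf.
pose r n := n.+1%:R^-1 * f n.+1.
have fE n : f n = f 0%N + \sum_(0 <= k < n) v k.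
  elim: n => [|n IH]; first by rewrite big_nil addr0.
  by rewrite fS IH big_nat_recr//= addrA.
have rL : r n @[n --> \oo] --> L.
  have -> : r = (fun n => f 0%N * harmonic n + arithmetic_mean v n).
    apply/funext => n; rewrite /r fE /harmonic /arithmetic_mean /series /= mulrDr.
    by congr (_ + _); rewrite mulrC.
  rewrite -[X in _ --> X]add0r -[X in X + _](mulr0 (f 0%N)).
  apply: cvgD; last exact: cesaro.
  by apply: cvgM; [exact: cvg_cst|exact: cvg_harmonic].
(* For [t] in [[b (k + 2), b (k + 3)[] the bounds are [lo k = f (k + 1) / (b (k + 3))] and
   [hi k = f (k + 2) / (b (k + 2))]; since [harmonic n] is [1 / (n + 1)], the correction in [lo] is
   [(k + 1) / (k + 3)]. *)
pose lo m := b^-1 * (r m * (1 - 2%:R * harmonic (m.+2))).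
pose hi m := b^-1 * r m.+1.
have loL : lo m @[m --> \oo] --> b^-1 * L.
  apply: cvgM; first exact: cvg_cst.
  rewrite -[X in _ --> X]mulr1; apply: cvgM => //.
  rewrite -[X in _ --> X](subr0 (1 : R)) -[X in 1 - X](mulr0 (2%:R)).
  apply: cvgB; first exact: cvg_cst.
  apply: cvgM; first exact: cvg_cst.
  by have := @cvg_harmonic R; rewrite -cvg_shiftS -cvg_shiftS.
have hiL : hi m @[m --> \oo] --> b^-1 * L.
  apply: cvgM; first exact: cvg_cst.
  by rewrite cvg_shiftS.
pose m (t : R) := (Num.truncn (t / b)).-2.
have moo : m t @[t --> +oo] --> \oo.
  apply/cvgnyPge => M; near=> t.
  have t0 : 0 <= t / b by rewrite divr_ge0// ltW.
  have : (M.+2 <= Num.truncn (t / b))%N.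
    by rewrite truncn_ge_nat// ler_pdivlMr//; near: t; exact: nbhs_pinfty_ge.
  by rewrite /m; case: (Num.truncn _) => [|[]].
apply: (@squeeze_cvgr _ _ _ _ (lo \o m) (hi \o m)); last 2 first.
- exact: cvg_comp moo loL.
- exact: cvg_comp moo hiL.
near=> t.
have t0 : 0 < t by near: t; exact: nbhs_pinfty_gt.
have tb2 : 2 <= t / b by rewrite ler_pdivlMr//; near: t; exact: nbhs_pinfty_ge.
have := truncn_itv (ltW (divr_gt0 t0 b0)); rewrite /= /m.
have : (2 <= Num.truncn (t / b))%N by rewrite truncn_ge_nat// ltW// divr_gt0.
case: (Num.truncn (t / b)) => [|[|k]]// _ /= /andP[h1 h2].
rewrite ler_pdivlMr// in h1; rewrite ltr_pdivrMr// in h2.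
have f1 := fG k.+1 t; have f2 := Gf k.+2 t.
have {}f1 : f k.+1 <= G t by apply: f1; rewrite mulrC.
have {}f2 : G t <= f k.+2 by apply: f2; rewrite ltW//= mulrC.
apply/andP; split.
- have -> : lo k = (b * k.+3%:R)^-1 * f k.+1.
    rewrite /lo /r /harmonic /= -[k.+3%:R]natr1 -[k.+2%:R]natr1 -[k.+1%:R]natr1.
    have k0 : 0 <= k%:R :> R by [].
    by field; rewrite !gt_eqF//; lra.
  apply: (@le_trans _ _ (t^-1 * f k.+1)).
    by rewrite ler_wpM2r ?f0// lef_pV2 ?posrE ?mulr_gt0// mulrC ltW.
  by rewrite ler_pM2l ?invr_gt0.
- rewrite /hi /r mulrA -invfM; apply: (@le_trans _ _ (t^-1 * f k.+2)).
    by rewrite ler_pM2l ?invr_gt0.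
  by rewrite ler_wpM2r ?f0// lef_pV2 ?posrE ?mulr_gt0// mulrC.
Unshelve. all: by end_near.
Qed.

Section ratio_limit.
Context (R : realType) (Q : probability (path R) R).
Local Notation ev := (@eval_path R).

Hypothesis tiltQ : tilting Q.
Hypothesis supQ : forall K, 0 <= K ->
  (\int[Q]_x path_sup ev [set` `[0, K]%R] x < +oo)%E.
Hypothesis halfQ : forall b : R, 0 < b ->
  (\esum_(t in lattice b) \int[Q]_x (expR (x t / 2))%:E < +oo)%E.

Variables (A : set R) (b : R).
Hypotheses (b0 : 0 < b) (A0 : A 0)
  (AD : forall s t, A s -> lattice b t -> A (s + t)).

Theorem pickands_limit :
  ((u^-1)%:E * \int[Q]_x path_sup ev (A `&` [set` `[0, u]%R]) x)%E @[u --> +oo] -->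
  ((b^-1)%:E * \int[Q]_x (path_sup ev A x * ((fine (lattice_sum b x))^-1)%:E))%E.
Proof.
pose F n := (\int[Q]_x path_sup ev (block A 0 (b * n.+1%:R)) x)%E.
pose v n := (\int[Q]_x sup_excess (block A 0 b) (block A (- (b * n.+1%:R)) (b * n.+1%:R)) x)%E.
pose G u := (\int[Q]_x path_sup ev (A `&` [set` `[0, u]%R]) x)%E.
have b1 : block A 0 b !=set0 by exists 0; split => //=; rewrite lexx add0r.
have sup_le D D' : D !=set0 -> D `<=` D' ->
    (\int[Q]_x path_sup ev D x <= \int[Q]_x path_sup ev D' x)%E.
  move=> [t Dt] DD'; apply: ge0_le_integral => //.
  - by move=> x _; apply: path_sup_ge0; exists t.
  - exact: measurable_path_sup.
  - exact: measurable_path_sup.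
  - by move=> x _; exact: path_sup_le.
have F0 n : (0 <= F n)%E.
  apply: integral_ge0 => x _; apply: path_sup_ge0.
  by exists 0; split => //=; rewrite lexx add0r mulr_gt0.
have Ff n : F n \is a fin_num by rewrite ge0_fin_numE//; exact: path_sup_block_int.
have G0 u : 0 <= u -> (0 <= G u)%E.
  move=> u0; apply: integral_ge0 => x _; apply: path_sup_ge0.
  by exists 0; split => //=; rewrite in_itv/= lexx.
have Gf u : 0 <= u -> G u \is a fin_num.
  move=> u0; rewrite ge0_fin_numE ?G0//; apply: le_lt_trans (supQ u0).
  by apply: sup_le; [exists 0; split => //=; rewrite in_itv/= lexx|move=> t []].
have v0 n : (0 <= v n)%E by apply: integral_ge0 => x _; exact: sup_excess_ge0.
have FS n : F n.+1 = (F n + v n)%E by exact: (path_sup_block_succ tiltQ supQ b0 A0 AD n).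
have vf n : v n \is a fin_num.
  rewrite ge0_fin_numE//; apply: le_lt_trans (path_sup_block_int supQ A (b * n.+2%:R)).
  by rewrite -[leRHS]/(F n.+1) FS leeDr.
rewrite -(excess_integral tiltQ supQ halfQ b0 A0 AD).
have Lfin := excess_integral_lty supQ b0 A0 AD.
have L0 := excess_integral_gt0 tiltQ supQ halfQ b0 A0 AD.
have := past_excess_cvg tiltQ supQ halfQ b0 A0 AD; rewrite -/v.
have Lf : (\int[Q]_x excess A b x)%E \is a fin_num by rewrite ge0_fin_numE// ltW.
rewrite -(fineK Lf) => /fine_cvg vL.
rewrite -EFinM.
have lim := @mean_growth R b _ (fine \o F) (fine \o v) (fine \o G) b0 _ vL.
apply: (@cvg_trans _ ((t^-1 * fine (G t))%:E @[t --> +oo])).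
  apply: near_eq_cvg; near=> t.
  have t0 : 0 <= t by near: t; exact: nbhs_pinfty_ge.
  by rewrite EFinM fineK ?Gf.
apply: cvg_EFin; first exact: nearW.
apply: lim => [n|n|n t bt|n t /andP[t0 tb]] /=.
- by rewrite FS fineD.
- by rewrite fine_ge0.
- have t0 : 0 <= t by apply: le_trans bt; rewrite mulr_ge0// ltW.
  apply: (fine_le (Ff n) (Gf t t0)); apply: sup_le.
    by exists 0; split => //=; rewrite lexx add0r mulr_gt0.
  move=> s [As /=]; rewrite add0r => /andP[s0 sb]; split => //=.
  by rewrite in_itv/= s0/=; apply: ltW; exact: lt_le_trans bt.
- apply: (fine_le (Gf t t0) (Ff n)); apply: sup_le.
    by exists 0; split => //=; rewrite in_itv/= lexx.
  move=> s [As /=]; rewrite in_itv/= => /andP[s0 st]; split => //=.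
  by rewrite s0 add0r; exact: le_lt_trans tb.
Unshelve. all: by end_near.
Qed.

End ratio_limit.

(** * Continuous spacing *)

Section unit_mass.
Context (R : realType).
Implicit Types (x : path R) (h t : R).
Local Notation ev := (@eval_path R).
Local Notation D := `[0, 1[%classic.

Let w t : R := \1_D t.

Let w0 t : 0 <= w t. Proof. by rewrite /w indicE. Qed.

Let mw : measurable_fun setT w.
Proof. by apply: measurable_indic; exact: measurable_itv. Qed.

Let mwE : measurable_fun setT (fun t => (w t)%:E).
Proof. by apply/measurable_EFinP. Qed.

Definition unit_mass x : \bar R := (\int[lebesgue_measure]_t (w t * expR (x t))%:E)%E.

Let mwe x : measurable_fun setT (fun t => (w t * expR (x t))%:E).
Proof.
apply/measurable_EFinP; apply: measurable_funM => //.
by apply/measurable_EFinP; exact: measurable_expR_path.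
Qed.

Let we0 x t : (0 <= (w t * expR (x t))%:E :> \bar R)%E.
Proof. by rewrite lee_fin mulr_ge0// expR_ge0. Qed.

Lemma integral_unit : (\int[lebesgue_measure]_t (w t)%:E = 1 :> \bar R)%E.
Proof.
have mD : measurable (D : set R) by exact: measurable_itv.
have -> : (\int[lebesgue_measure]_t (w t)%:E = lebesgue_measure (D `&` setT))%E.
  exact: integral_indic.
by rewrite setIT lebesgue_measure_itv/= lte_fin ltr01 oppr0 adde0.
Qed.

Lemma measurable_joint_unit : measurable_fun setT
  (fun p : R * path R => (w p.1 * expR (p.2 p.1))%:E).
Proof.
apply/measurable_EFinP; apply: measurable_funM.
  exact: (measurableT_comp mw measurable_fst).
by apply: measurableT_comp => //; exact: measurable_joint_eval.
Qed.

Lemma measurable_unit_mass : measurable_fun setT unit_mass.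
Proof.
apply: (@measurable_fun_fubini_tonelli_G _ _ (measurableTypeR R) (path R) R
  lebesgue_measure (fun p => (w p.1 * expR (p.2 p.1))%:E)).
- exact: measurable_joint_unit.
- by move=> p.
Qed.

Lemma unit_mass_ge0 x : (0 <= unit_mass x)%E.
Proof. exact: integral_ge0. Qed.

Lemma unit_mass_addc c x : unit_mass (addc_path c x) = ((expR c)%:E * unit_mass x)%E.
Proof.
rewrite /unit_mass -ge0_integralZl ?lee_fin ?expR_ge0//; last exact: mwe.
by apply: eq_integral => t _; rewrite -EFinM /= expRD; congr EFin; ring.
Qed.

Lemma unit_mass_le x : (unit_mass x <= path_sup ev (block setT 0 1) x)%E.
Proof.
have S0 := path_sup_ge0 x (block_neq0 0 ltr01).
rewrite -[leRHS]mule1 -integral_unit -ge0_integralZl//; last by move=> t _; rewrite lee_fin.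
apply: ge0_le_integral => //.
- exact: mwe.
- apply: emeasurable_funM; first exact: measurable_cst.
  exact: mwE.
move=> t _; rewrite /w indicE; case: (boolP (t \in D)) => tD.
  rewrite mul1r mule1; apply: ereal_sup_ubound; exists t => //; split => //=.
  by move: tD; rewrite inE /= in_itv/= add0r.
by rewrite mul0r mule0.
Qed.

(** Every time lies in exactly one unit interval with integer left end, namely its floor;
    translation invariance brings each piece back to [[0, 1[]. *)
Lemma path_mass_unit x :
  path_mass x = (\esum_(h in lattice 1) unit_mass (shift_path h x))%E.
Proof.
have c1 : countable (lattice (1 : R)) by exact/lattice_countable/oner_neq0.
pose f h t := (w (t - h) * expR (x t))%:E.
have mf h : measurable_fun setT (f h).
  apply/measurable_EFinP; apply: measurable_funM.
    apply: (measurableT_comp mw (measurable_funB _ _)) => //.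
  by apply/measurable_EFinP; exact: measurable_expR_path.
have f0 h t : (0 <= f h t)%E by rewrite lee_fin mulr_ge0// expR_ge0.
transitivity (\int[lebesgue_measure]_t (\esum_(h in lattice (1:R)) f h t))%E.
  apply: eq_integral => t _.
  have lt : lattice 1 (Num.floor t)%:~R by right; exists (Num.floor t); rewrite mul1r.
  have mem h : lattice 1 h -> (t - h \in D) = (h == (Num.floor t)%:~R).
    move=> [/eqP|[z ->]]; first by rewrite oner_eq0.
    rewrite mul1r eqr_int; apply/idP/eqP => [|->].
      by rewrite inE /= in_itv/= => /andP[h1 h2]; apply/esym/floor_def; rewrite intrD1; apply/andP; split; lra.
    rewrite inE /= in_itv/=; have := floor_itv t; rewrite intrD1 => /andP[h1 h2].
    by apply/andP; split; lra.
  apply/esym; transitivity (\esum_(h in [set (Num.floor t)%:~R : R]) f h t)%E.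
    rewrite esum_mkcond [RHS]esum_mkcond; apply: eq_esum => h _.
    case: ifPn => [|h1]; last first.
      case: ifPn => //; rewrite inE => hE; rewrite hE mem_set// in h1.
    rewrite inE => /mem hm; rewrite /f /w indicE hm.
    case: eqP => [->|ne]; first by rewrite mem_set.
    by rewrite memNset// mul0r.
  by rewrite esum_set1// /f /w indicE mem// eqxx mul1r.
transitivity (\esum_(h in lattice (1:R)) \int[lebesgue_measure]_t f h t)%E.
  exact: (integral_esum (@lebesgue_measure R) c1 f0 mf).
apply: eq_esum => h _.
rewrite -(@integral_shift R h setT (f h))//.
by apply: eq_integral => t _; rewrite /f /= addrK.
Qed.

Lemma path_mass_gt0 x : (0 < path_mass x)%E.
Proof.
rewrite lt0e; apply/andP; split; last first.
  by apply: integral_ge0 => t _; rewrite lee_fin expR_ge0.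
apply/eqP => Z0.
have := (ae_eq_integral_abs (@lebesgue_measure R) measurableT (measurable_expR_path x)).1.
under eq_integral do rewrite gee0_abs ?lee_fin ?expR_ge0//.
move=> /(_ Z0) h.
have : (@lebesgue_measure R).-negligible setT.
  suff : {ae (@lebesgue_measure R), forall x : R, False} by apply: negligibleS => y _ [].
  by move: h; apply: filterS => y /(_ I)/eqP; rewrite eqe gt_eqF// expR_gt0.
move=> /(negligibleP _ measurableT) m0.
have : (@lebesgue_measure R D <= 0)%E.
  by rewrite -m0 le_measure// inE.
by rewrite lebesgue_measure_itv/= lte_fin ltr01 oppr0 adde0 lee_fin ler10.
Qed.

Lemma path_mass_le x : (path_mass x <= block_sum 1 x)%E.
Proof.
rewrite path_mass_unit; apply: le_esum => h lh.
apply: le_trans (unit_mass_le _) _; rewrite path_sup_shift; apply: path_sup_le.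
by move=> _ [s [_ /= /andP[s0 s1]] <-]; split => //=; apply/andP; split; lra.
Qed.

End unit_mass.

Section continuous_spacing.
Context (R : realType) (Q : probability (path R) R).
Local Notation ev := (@eval_path R).

Hypothesis tiltQ : tilting Q.
Hypothesis supQ : forall K, 0 <= K ->
  (\int[Q]_x path_sup ev [set` `[0, K]%R] x < +oo)%E.
Hypothesis halfQ : forall b : R, 0 < b ->
  (\esum_(t in lattice b) \int[Q]_x (expR (x t / 2))%:E < +oo)%E.

(** The ratio [K] of the supremum to the total mass is invariant under shifts and constants. The
    expectation of [unit_mass] times [K] is computed twice: transport sums the unit masses to the
    total mass, which cancels and leaves the lattice formula; tilting at each fixed time in [[0, 1[]
    leaves that of [K]. *)
Lemma lattice_sum_path_mass :
  (\int[Q]_x (path_sup ev setT x * ((fine (lattice_sum 1 x))^-1)%:E) =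
   \int[Q]_x (path_sup ev setT x * ((fine (path_mass x))^-1)%:E))%E.
Proof.
have n1 : (1 : R) != 0 by exact: oner_neq0.
have c1 := lattice_countable n1.
have finY := lattice_sum_finite halfQ ltr01.
have finB := block_sum_finite tiltQ supQ halfQ ltr01.
have Y0 x : (0 <= @lattice_sum R 1 x)%E by apply: ltW; exact: lattice_sum_gt0.
have mYi := measurable_fine_inv (measurable_lattice_sum n1) Y0.
have Z0 x : (0 <= @path_mass R x)%E by exact/ltW/path_mass_gt0.
have mZi := measurable_fine_inv (@measurable_path_integral R) Z0.
have Zi0 x : (0 <= ((fine (@path_mass R x))^-1)%:E :> \bar R)%E by rewrite lee_fin invr_ge0 fine_ge0.
have Yi0 x : (0 <= ((fine (@lattice_sum R 1 x))^-1)%:E :> \bar R)%E by rewrite lee_fin invr_ge0 fine_ge0.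
have T0 : [set: R] !=set0 by exists 0.
pose K x := (path_sup ev setT x * ((fine (path_mass x))^-1)%:E)%E.
have K0 x : (0 <= K x)%E by rewrite mule_ge0// path_sup_ge0.
have mM := @measurable_path_sup R setT.
have mK : measurable_fun setT K by exact: emeasurable_funM.
have Kaddc c x : K (addc_path c x) = K x.
  rewrite /K path_sup_addc// path_mass_addc fine_scale ?expR_gt0// invfM EFinM.
  rewrite [X in (X * _)%E]muleC [(_ * ((expR c)^-1)%:E)%E]muleC muleA.
  by rewrite -[X in (X * _)%E]muleA -EFinM divff ?gt_eqF ?expR_gt0// mule1.
have Kshift h x : K (shift_path h x) = K x.
  rewrite /K path_mass_shift path_sup_shift; congr (path_sup ev _ x * _)%E.
  by apply/seteqP; split => // t _; exists (t - h); rewrite ?subrK.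
have mU := @measurable_unit_mass R.
have U0 := @unit_mass_ge0 R.
pose F x := (unit_mass x * K x)%E.
have F0 x : (0 <= F x)%E by rewrite mule_ge0.
have mF : measurable_fun setT F by exact: emeasurable_funM.
have hF : homogeneous F by move=> c x; rewrite /F Kaddc unit_mass_addc -muleA.
transitivity (\int[Q]_x F x)%E.
  rewrite (mass_transport tiltQ n1 finY hF mF F0).
  have mS := measurable_esum c1 (fun t x => F0 (shift_path t x))
    (fun t => measurableT_comp mF (measurable_shift_path t)).
  have S0 x : (0 <= \esum_(t in lattice (1:R)) F (shift_path t x))%E.
    by apply: esum_ge0 => t _; exact: F0.
  apply: (ge0_ae_eq_integral measurableT).
  - exact: (emeasurable_funM mM mYi).
  - exact: (emeasurable_funM mS mYi).
  - by move=> x _; exact: mule_ge0 (path_sup_ge0 x T0) (Yi0 x).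
  - by move=> x _; exact: mule_ge0 (S0 x) (Yi0 x).
  move: finB; apply: filterS => x Bx _; congr (_ * _)%E.
  have Mf : path_sup ev setT x \is a fin_num.
    rewrite ge0_fin_numE ?path_sup_ge0//; apply: le_lt_trans Bx.
    exact: path_sup_setT_le.
  have Zf : path_mass x \is a fin_num.
    by rewrite ge0_fin_numE//; apply: le_lt_trans Bx; exact: path_mass_le.
  have KE : K x = (fine (path_sup ev setT x) / fine (path_mass x))%:E.
    by rewrite /K -{1}(fineK Mf) EFinM.
  have k0 : 0 <= fine (path_sup ev setT x) / fine (path_mass x).
    by rewrite divr_ge0// fine_ge0// path_sup_ge0.
  transitivity (\esum_(t in lattice 1) (unit_mass (shift_path t x) *
      (fine (path_sup ev setT x) / fine (path_mass x))%:E))%E.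
    rewrite (ge0_esumZr c1 k0 (fun t => U0 (shift_path t x))) -path_mass_unit.
    rewrite -(fineK Mf) -(fineK Zf) -EFinM /=; congr EFin.
    by field; rewrite gt_eqF// fine_gt0// path_mass_gt0 ltey_eq Zf.
  by apply: eq_esum => t _; rewrite /F Kshift KE.
(* After the exchange of integrals, the expectation of [e^x(t) K] does not depend on [t], and the
   interval has length 1. *)
transitivity (\int[lebesgue_measure]_t ((\1_(`[0, 1[%classic) t)%:E * \int[Q]_x K x))%E; last first.
  rewrite ge0_integralZr ?integral_unit ?mul1e//; last exact: integral_ge0.
  by apply/measurable_EFinP; apply: measurable_indic; exact: measurable_itv.
pose f (p : measurableTypeR R * path R) := ((\1_(`[0, 1[%classic) p.1 * expR (p.2 p.1))%:E * K p.2)%E.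
have f0 p : (0 <= f p)%E by rewrite mule_ge0// lee_fin mulr_ge0 ?expR_ge0.
have mf : measurable_fun setT f.
  apply: emeasurable_funM; first exact: measurable_joint_unit.
  exact: (measurableT_comp mK measurable_snd).
transitivity (\int[Q]_x \int[lebesgue_measure]_t f (t, x))%E.
  apply: eq_integral => x _; rewrite /F /unit_mass -ge0_integralZr//.
  apply/measurable_EFinP; apply: measurable_funM.
    by apply: measurable_indic; exact: measurable_itv.
  by apply/measurable_EFinP; exact: measurable_expR_path.
transitivity (\int[lebesgue_measure]_t \int[Q]_x f (t, x))%E.
  by apply/esym; exact: (@fubini_tonelli _ _ (measurableTypeR R) (path R) R lebesgue_measure Q f mf f0).
apply: eq_integral => t _; rewrite /f /=.
under eq_integral do rewrite EFinM -muleA.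
have mg : measurable_fun setT (fun x : path R => (expR (x t))%:E * K x)%E.
  apply: emeasurable_funM => //; apply/measurable_EFinP; apply: measurableT_comp => //.
  exact: measurable_eval.
have g0 (x : path R) : (0 <= (expR (x t))%:E * K x)%E by rewrite mule_ge0// lee_fin expR_ge0.
rewrite (ge0_integralZl Q measurableT mg (fun x _ => g0 x)) ?lee_fin//.
congr (_ * _)%E; rewrite (invariant_tilt tiltQ t Kaddc mK K0).
by apply: eq_integral => x _; rewrite Kshift.
Qed.

End continuous_spacing.

Lemma path_sum_gt0 (R : realType) (eta : R) (x : path R) : 0 <= eta ->
  (0 < path_sum (@eval_path R) eta x)%E.
Proof.
rewrite le_eqVlt => /predU1P[<-|eta0].
  by rewrite /path_sum eqxx; exact: path_mass_gt0.
by rewrite lattice_sumE ?gt_eqF// mule_gt0 ?lte_fin// lattice_sum_gt0.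
Qed.

(** Both inverses vanish at [+oo]; positivity keeps the argument away from 0, where the real inverse
    is 0 by convention. *)
Lemma inve_fine (R : realType) (s : \bar R) : (0 < s)%E -> (s^-1 = ((fine s)^-1)%:E)%E.
Proof.
case: s => [r| |]//=; last by rewrite invr0 invey.
by rewrite lte_fin => r0; rewrite inver gt_eqF.
Qed.

(** * The limit for every admissible pair of spacings *)

Section path_pickands.
Context (R : realType) (Q : probability (path R) R).
Local Notation ev := (@eval_path R).

Hypothesis tiltQ : tilting Q.
Hypothesis supQ : forall K, 0 <= K ->
  (\int[Q]_x path_sup ev [set` `[0, K]%R] x < +oo)%E.
Hypothesis halfQ : forall b : R, 0 < b ->
  (\esum_(t in lattice b) \int[Q]_x (expR (x t / 2))%:E < +oo)%E.

Let limit_value (A : set R) (b : R) (S : path R -> \bar R) :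
  0 < b -> A 0 -> (forall s t, A s -> lattice b t -> A (s + t)) ->
  (forall x, 0 < S x)%E ->
  (b^-1%:E * \int[Q]_x (path_sup ev A x * ((fine (lattice_sum b x))^-1)%:E) =
   \int[Q]_x (path_sup ev A x * ((fine (S x))^-1)%:E))%E ->
  let rhs := (\int[Q]_x (path_sup ev A x / S x))%E in
  ((u^-1)%:E * \int[Q]_x path_sup ev (A `&` [set` `[0, u]%R]) x)%E @[u --> +oo] --> rhs
  /\ (0 < rhs < +oo)%E.
Proof.
move=> b0 A0 AD S0 eqS rhs.
have {}eqS : rhs = (b^-1%:E * \int[Q]_x excess A b x)%E.
  rewrite (excess_integral tiltQ supQ halfQ b0 A0 AD) eqS; apply: eq_integral => x _.
  by rewrite inve_fine.
split.
  rewrite eqS (excess_integral tiltQ supQ halfQ b0 A0 AD).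
  exact: (pickands_limit tiltQ supQ halfQ b0 A0 AD).
have L0 := excess_integral_gt0 tiltQ supQ halfQ b0 A0 AD.
have Loo := excess_integral_lty supQ b0 A0 AD.
have bi : (0 < b^-1%:E)%E by rewrite lte_fin invr_gt0.
by rewrite eqS mule_gt0// lte_mul_pinfty// ltW.
Qed.

Let lattice_value (A : set R) (b : R) : 0 < b -> A !=set0 ->
  (b^-1%:E * \int[Q]_x (path_sup ev A x * ((fine (lattice_sum b x))^-1)%:E) =
   \int[Q]_x (path_sup ev A x * ((fine (path_sum ev b x))^-1)%:E))%E.
Proof.
move=> b0 A0; have bN0 : b != 0 by rewrite gt_eqF.
have Y0 x : (0 <= @lattice_sum R b x)%E by apply: ltW; exact: lattice_sum_gt0.
have mYi := measurable_fine_inv (measurable_lattice_sum bN0) Y0.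
have mA := @measurable_path_sup R A.
have g0 x : (0 <= path_sup ev A x * ((fine (@lattice_sum R b x))^-1)%:E)%E.
  by rewrite mule_ge0 ?path_sup_ge0// lee_fin invr_ge0 fine_ge0.
have bi : (0 <= b^-1%:E :> \bar R)%E by rewrite lee_fin invr_ge0 ltW.
rewrite -(ge0_integralZl Q measurableT (emeasurable_funM mA mYi) (fun x _ => g0 x) bi).
apply: eq_integral => x _; rewrite lattice_sumE// muleC -muleA; congr (_ * _)%E.
by rewrite -EFinM [in RHS]muleC fine_scale// invfM.
Qed.

Theorem path_pickands (delta eta : R) :
  (delta = 0 /\ 0 <= eta) \/ (0 < delta /\ exists k : nat, (0 < k)%N /\ eta = k%:R * delta) ->
  let rhs := (\int[Q]_x (path_sup ev (lattice delta) x / path_sum ev eta x))%E in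
  ((u^-1)%:E * \int[Q]_x path_sup ev (lattice delta `&` [set` `[0, u]%R]) x)%E
    @[u --> +oo] --> rhs
  /\ (0 < rhs < +oo)%E.
Proof.
have l0 : lattice (0 : R) = setT by apply/seteqP; split => // t _; left.
have sum0 b (x : path R) : 0 < b -> (0 < path_sum ev b x)%E.
  by move=> b0; apply/path_sum_gt0/ltW.
move=> [[-> eta0]|[d0 [k [k0 ->]]]].
  (* On the whole line every spacing is admissible: for [eta = 0] the auxiliary spacing 1 matches
     the unit mass, otherwise [eta] itself is taken. *)
  have [<-|ne] := eqVneq 0 eta.
    apply: (limit_value ltr01) => //; rewrite ?l0//.
      by move=> x; rewrite /path_sum eqxx; exact: path_mass_gt0.
    rewrite invr1 mul1e (lattice_sum_path_mass tiltQ supQ halfQ).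
    by apply: eq_integral => x _; rewrite /path_sum eqxx.
  have {}eta0 : 0 < eta by rewrite lt_neqAle ne.
  apply: (limit_value eta0) => //; rewrite ?l0//; first by move=> x; exact: sum0.
  by apply: lattice_value; rewrite //; exists 0.
have kd : 0 < k%:R * delta by rewrite mulr_gt0// ltr0n.
apply: (limit_value kd).
- exact: lattice0.
- move=> s t ds [/eqP|[z ->]]; first by rewrite gt_eqF.
  by apply: latticeD => //; right; exists (k%:Z * z); rewrite intrM; ring.
- by move=> x; exact: sum0.
by apply: lattice_value => //; exists 0; exact: lattice0.
Qed.

End path_pickands.

(** * Summability of the moments *)

Section summability.
Context (R : realType).

Lemma nneseries_lty_dominated (g h : nat -> R) (C M : R) (N : nat) : 0 <= C ->
  (forall n, 0 <= g n) -> (forall n, 0 <= h n) ->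
  (forall n, (N <= n)%N -> g n <= C * h n) ->
  (forall n, \sum_(0 <= k < n) h k <= M) ->
  (\sum_(0 <= n <oo) (g n)%:E < +oo)%E.
Proof.
move=> C0 g0 h0 gh hM.
rewrite (@nneseries_split _ (fun n => (g n)%:E) 0 N); last by move=> k _; rewrite lee_fin.
rewrite add0n sumEFin; apply: lte_add_pinfty; first exact: ltry.
apply: (@le_lt_trans _ _ (C * M)%:E); last exact: ltry.
apply: lime_le.
  by apply: is_cvg_nneseries => n _ _; rewrite lee_fin.
apply: nearW => n; rewrite sumEFin lee_fin.
apply: (@le_trans _ _ (\sum_(N <= k < n) C * h k)).
  rewrite big_nat_cond [leRHS]big_nat_cond; apply: ler_sum => k; rewrite andbT => /andP[Nk _]; exact: gh.
rewrite -mulr_sumr ler_wpM2l//; apply: le_trans (hM n).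
have [Nn|/ltnW nN] := leqP N n; last by rewrite big_geq// sumr_ge0.
by rewrite [leRHS](big_cat_nat (leq0n N) Nn)//= lerDr sumr_ge0.
Qed.

(* Telescoping against [n ^ (- e)]. *)
Lemma riemann_partial_le (e : R) n : 0 < e ->
  \sum_(0 <= k < n) expR (- (1 + e) * ln k.+2%:R) <= e^-1.
Proof.
move=> e0; pose q k : R := expR (- e * ln k.+1%:R).
have step k : e * expR (- (1 + e) * ln k.+2%:R) <= q k - q k.+1.
  have k0 : 0 < k.+2%:R :> R by [].
  have lnk : ln (k.+1%:R : R) <= ln k.+2%:R - k.+2%:R^-1.
    rewrite -ler_expR expRD !lnK ?posrE// expRN.
    have h := expR_ge1Dx (- k.+2%:R^-1 : R).
    rewrite -expRN; apply: le_trans (ler_wpM2l (ltW k0) h).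
    by rewrite mulrDr mulrN divff ?gt_eqF// mulr1 -[k.+2%:R]natr1 addrK.
  have -> : expR (- (1 + e) * ln k.+2%:R) = q k.+1 * k.+2%:R^-1.
    by rewrite /q -[X in _ * X^-1](lnK k0) -expRN -expRD; congr expR; ring.
  apply: (@le_trans _ _ (q k.+1 * (expR (e * k.+2%:R^-1) - 1))).
    rewrite mulrCA ler_pM2l ?expR_gt0//.
    by rewrite lerBrDl; exact: expR_ge1Dx.
  rewrite mulrBr mulr1 lerD2r /q -expRD ler_expR.
  have := ler_wpM2l (ltW e0) lnk.
  by move: (k.+2%:R^-1) (ln k.+1%:R) (ln k.+2%:R) => z l1 l2; lra.
have tele : e * \sum_(0 <= k < n) expR (- (1 + e) * ln k.+2%:R) <= q 0%N - q n.
  elim: n => [|n IH]; first by rewrite big_nil mulr0 subrr.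
  by rewrite big_nat_recr//= mulrDr; have := step n; lra.
rewrite -(ler_pM2l e0) divff ?gt_eqF//; apply: (le_trans tele).
have : 0 <= q n by exact: expR_ge0.
by rewrite /q ln1 mulr0 expR0; lra.
Qed.

Lemma lattice_moment_finite (sigma2 : R -> R) (e b : R) : 0 < e -> 0 < b ->
  (forall t, sigma2 (- t) = sigma2 t) ->
  (\forall t \near +oo, 8 * (1 + e) * ln t <= sigma2 t) ->
  (\esum_(t in lattice b) (expR (- sigma2 t / 8))%:E < +oo)%E.
Proof.
move=> e0 b0 sN [M [_ Mg]].
pose N := (Num.truncn (`|M| / b)).+1.
have bN n : (N <= n)%N -> expR (- sigma2 (b * n.+2%:R) / 8) <=
    expR (- (1 + e) * ln b) * expR (- (1 + e) * ln n.+2%:R).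
  move=> Nn; rewrite -expRD ler_expR -mulrDr -lnM ?posrE//.
  have : 8 * (1 + e) * ln (b * n.+2%:R) <= sigma2 (b * n.+2%:R).
    apply: Mg; apply: le_lt_trans (ler_norm _) _.
    rewrite -ltr_pdivrMl// mulrC; apply: lt_le_trans (truncnS_gt _) _.
    by rewrite ler_nat; apply: leq_trans Nn _; rewrite -addn2 leq_addr.
  lra.
pose g n : \bar R := (expR (- sigma2 (b * n%:R) / 8))%:E.
have g0 n : (0 <= g n)%E by rewrite /g lee_fin expR_ge0.
have fin : (\sum_(0 <= n <oo) g n < +oo)%E.
  (* Two terms are set aside so that the others are indexed by [n + 2], as in the comparison
     series. *)
  rewrite (@nneseries_split _ g 0 2)// add0n; apply: lte_add_pinfty.
    by rewrite !big_nat_recr//= big_nil add0e -EFinD ltry.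
  rewrite -nneseries_addn//.
  have -> : (\sum_(0 <= i <oo) g (i + 2)%N =
      \sum_(0 <= i <oo) (expR (- sigma2 (b * i.+2%:R) / 8))%:E)%E.
    by apply: eq_eseriesr => i _; rewrite /g addn2.
  apply: (nneseries_lty_dominated (C := expR (- (1 + e) * ln b))
    (h := fun n => expR (- (1 + e) * ln n.+2%:R)) (M := e^-1) (N := N)).
  - exact: expR_ge0.
  - by move=> n; exact: expR_ge0.
  - by move=> n; exact: expR_ge0.
  - exact: bN.
  - by move=> n; exact: riemann_partial_le.
rewrite (esum_lattice_nat b0); last by move=> t; rewrite lee_fin expR_ge0.
apply: lte_add_pinfty; first exact: fin.
have -> : (\sum_(0 <= n <oo) (expR (- sigma2 (- (b * n.+1%:R)) / 8))%:E =
    \sum_(0 <= n <oo) g (n + 1)%N)%E.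
  by apply: eq_eseriesr => n _; rewrite /g sN addn1.
rewrite nneseries_addn//; apply: le_lt_trans fin.
by rewrite [leRHS](@nneseries_split _ g 0 1)// add0n leeDr// sume_ge0.
Qed.

End summability.

Lemma logarithmic_growth (R : realType) (sigma2 l : R -> R) (c : R) :
  0 < c -> c <= 1 -> 0 < c ^+ 2 + 8 * c - 8 ->
  (\forall t \near +oo, c * l t <= sigma2 t <= l t) ->
  ((8 / (c ^+ 2 + 8 * c - 8))%:E < limf_einf (fun t : R => (l t / ln t)%:E) +oo%R)%E ->
  exists2 e : R, 0 < e & \forall t \near +oo, 8 * (1 + e) * ln t <= sigma2 t.
Proof.
move=> c0 c1 k0 bnd; rewrite limf_einfE => /ereal_sup_gt[_ [V FV <-] hV].
set k := c ^+ 2 + 8 * c - 8 in k0 hV.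
(* The infimum over a neighbourhood of infinity serves as [K]; when it is [+oo], any real above the
   threshold does. *)
have [K kK KV] : exists2 K : R, 8 / k < K & forall t, V t -> K <= l t / ln t.
  have lb t : V t -> (ereal_inf [set (l t / ln t)%:E | t in V] <= (l t / ln t)%:E)%E.
    by move=> Vt; apply: ereal_inf_lbound; exists t.
  move: hV lb; case: (ereal_inf _) => [r| |]// hV lb.
    by exists r; [rewrite -lte_fin|move=> t /lb; rewrite lee_fin].
  exists (8 / k + 1); first by rewrite ltrDl.
  by move=> t /lb.
have kc : 8 <= c * (8 / k).
  have : 0 <= (c + 8) * (1 - c) by rewrite mulr_ge0 ?subr_ge0// addr_ge0// ltW.
  rewrite mulrA ler_pdivlMr// /k; lra.
have cK : 8 < c * K by apply: le_lt_trans kc _; rewrite ltr_pM2l.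
(* The strict excess of [c K] over 8 is converted into the exponent gained beyond 1. *)
exists (c * K / 8 - 1); first by lra.
near=> t.
have t1 : 1 < t by near: t; exact: nbhs_pinfty_gt.
have lt0 : 0 < ln t by rewrite ln_gt0.
have Vt : V t by near: t.
have /andP[h _] : c * l t <= sigma2 t <= l t by near: t.
apply: le_trans h; have := KV t Vt; rewrite ler_pdivlMr// => h.
have -> : 8 * (1 + (c * K / 8 - 1)) * ln t = c * (K * ln t) by field.
by rewrite ler_pM2l.
Unshelve. all: by end_near.
Qed.

(** * From the process to its path law *)

Section lower_integral.
Import HBNNSimple.
Context d (T : measurableType d) (R : realType) (P : {measure set T -> \bar R}).

(* [g] need not be measurable: the integral is then a lower integral. *)
Lemma integral_off_null (N : set T) (f g : T -> \bar R) :
  measurable N -> P N = 0%E -> measurable_fun setT f ->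
  (forall w, 0 <= f w)%E -> (forall w, 0 <= g w)%E ->
  (forall w, ~ N w -> g w = f w) -> (\int[P]_w g w = \int[P]_w f w)%E.
Proof.
move=> mN N0 mf f0 g0 gf.
have offN : {ae P, forall w, ~ N w} by exists N; split => // w /contrapT.
apply/eqP; rewrite eq_le; apply/andP; split.
  rewrite [leLHS]ge0_integralTE//; apply: ge_ereal_sup => _ [h /= hg <-].
  rewrite -integralT_nnsfun; apply: ae_ge0_le_integral => //.
  - by move=> w _; rewrite lee_fin.
  - exact/measurable_EFinP.
  - by move: offN; apply: filterS => w Nw _; rewrite -gf.
(* Set to 0 on [N], the measurable function lies below [g] everywhere, so its simple minorants are
   minorants of [g]. *)
pose f' := f \_ (~` N).
have f'0 w : (0 <= f' w)%E by rewrite /f' patchE; case: ifP.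
have mf' : measurable_fun setT f'.
  by apply/(measurable_restrictT _ (measurableC mN)); exact: measurable_funTS.
have -> : (\int[P]_w f w = \int[P]_w f' w)%E.
  apply: ge0_ae_eq_integral => //; move: offN; apply: filterS => w Nw _.
  by rewrite /f' patchE mem_set.
rewrite ge0_integralTE// ge0_integralTE//; apply: le_ereal_sup => _ [h /= hf <-].
exists h => //= w; apply: le_trans (hf w) _; rewrite /f' patchE.
by case: ifPn => // /[!inE] Nw; rewrite gf.
Qed.

End lower_integral.

Section path_law.
Context d (T : measurableType d) (R : realType) (P : probability T R).

Lemma path_law (X : T -> path R) : measurable_fun setT X ->
  exists2 Q : probability (path R) R,
    forall F, measurable_fun setT F -> (forall x, 0 <= F x)%E ->
      (\int[Q]_x F x = \int[P]_w F (X w))%E &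
    forall A, measurable A -> Q A = P (X @^-1` A).
Proof.
move=> mX; pose mix := isMeasurableFun.Build _ _ _ _ _ mX.
pose X' : {mfun T >-> path R} := HB.pack X mix.
exists (distribution P X') => // F mF F0.
have := @ge0_integral_pushforward _ _ _ _ _ _ mX P setT F measurableT mF (fun x _ => F0 x).
by rewrite preimage_setT.
Qed.

End path_law.

Section gaussian_paths.
Context d (T : measurableType d) (R : realType) (P : probability T R) (B : R -> {RV P >-> R}).
Hypotheses (gaussB : gaussian_process P B) (centB : centered P B)
  (contB : sample_continuous P B) (statB : stationary_increments P B)
  (W0 : {ae P, forall w, drifted P B 0 w = 0}).

Local Notation sigma2 := (variance_function P B).
Local Notation ev := (@eval_path R).

Let mB t : measurable_fun setT (B t). Proof. exact: measurable_funPT. Qed.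

Let gaussB1 t : gaussian_variable P (B t).
Proof.
have := gaussB (fun _ : 'I_1 => 1) (fun _ => t).
by under eq_fun do rewrite big_ord1 mul1r.
Qed.

Let intB t : P.-integrable setT (EFin \o B t).
Proof. exact: gaussian_integrable. Qed.

Let int0 t : (\int[P]_w (B t w)%:E = 0)%E.
Proof. by rewrite -(centB t) unlock. Qed.

Lemma second_moment_variance t : (\int[P]_w (B t w ^+ 2)%:E = (sigma2 t)%:E)%E.
Proof.
have [v E _] := gaussian_centeredP (mB t) (gaussB1 t) (centB t).
rewrite /variance_function /variance unlock centB/= unlock /= E.
suff -> : (\int[P]_x (((B t \- cst 0) * (B t \- cst 0)) x)%:E = v%:E)%E by [].
by rewrite -E; apply: eq_integral => w _; rewrite expr2 -[in RHS](subr0 (B t w)).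
Qed.

(** [W(0) = 0] makes [B(0)] almost surely equal to the constant [sigma^2(0) / 2]; centering forces
    this constant to be 0. *)
Lemma process_at0 : {ae P, forall w, B 0 w = 0}.
Proof.
have h : sigma2 0 = 0.
  have : (\int[P]_w (B 0 w)%:E = \int[P]_w (sigma2 0 / 2)%:E)%E.
    apply: ae_eq_integral => //.
    - by apply/measurable_EFinP.
    - move: W0; apply: filterS => w; rewrite /drifted => /eqP; rewrite subr_eq0 => /eqP h _.
      by rewrite h.
  rewrite int0 integral_cst//= probability_setT mule1 => -[]; lra.
by move: W0; apply: filterS => w; rewrite /drifted h mul0r subr0.
Qed.

Lemma increment_second_moment s t :
  (\int[P]_w ((B t w - B s w) ^+ 2)%:E = (sigma2 (t - s))%:E)%E.
Proof.
rewrite -second_moment_variance.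
transitivity (\int[P]_w ((B (t - s) w - B 0 w) ^+ 2)%:E)%E; last first.
  apply: ge0_ae_eq_integral => //.
  - by apply/measurable_EFinP; apply: measurable_funX; exact: measurable_funB.
  - by apply/measurable_EFinP; exact: measurable_funX.
  - by move=> w _; rewrite lee_fin sqr_ge0.
  - by move=> w _; rewrite lee_fin sqr_ge0.
  - by move: process_at0; apply: filterS => w /= -> _; rewrite subr0.
pose X w := B t w - B s w; pose Y w := B (t - s) w - B 0 w.
have mX : measurable_fun setT X by exact: measurable_funB.
have mY : measurable_fun setT Y by exact: measurable_funB.
have m1 : measurable_fun setT (fun _ : T => 1 : R) by [].
have law (A : set R) : measurable A -> P (X @^-1` A) = P (Y @^-1` A).
  move=> mA.
  have := statB (fun _ : 'I_1 => 0) (fun=> t - s) s (A := [set v | A (tnth v ord0)]).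
  rewrite /pushforward /increments /= => h; move: h.
  have -> : (fun w => [tuple B (t - s + s) w - B (0 + s) w  | _ < 1]) @^-1` [set v : 1.-tuple R | A (tnth v ord0)] = X @^-1` A.
    by apply/seteqP; split => w; rewrite /= tnth_mktuple subrK add0r.
  have -> : (fun w => [tuple B (t - s + 0) w - B (0 + 0) w  | _ < 1]) @^-1` [set v : 1.-tuple R | A (tnth v ord0)] = Y @^-1` A.
    by apply/seteqP; split => w; rewrite /= tnth_mktuple !addr0.
  apply; rewrite -[X in measurable X]setTI.
  exact: (measurable_tnth ord0 measurableT mA).
have := @eq_weighted_integral R _ _ _ _ _ _ P P (fun=> 1) (fun=> 1) X Y
  (fun=> ler01) (fun=> ler01) m1 m1 mX mY (fun z => (z ^+ 2)%:E).
under eq_integral do rewrite mul1e.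
under [in X in _ -> _ -> _ -> _ = X]eq_integral do rewrite mul1e.
apply.
- move=> A mA; rewrite !integral_cst//= ?mul1e ?law//.
    by rewrite -[X in measurable X]setTI; exact: mY.
  by rewrite -[X in measurable X]setTI; exact: mX.
- by apply/measurable_EFinP; exact: measurable_funX.
- by move=> z; rewrite lee_fin sqr_ge0.
Qed.

Let null_set : exists N : set T, [/\ measurable N, P N = 0%E &
  forall w, ~ N w -> continuous (fun t => B t w)].
Proof. by have [N [mN N0 sN]] := contB; exists N; split => // w Nw; apply: contrapT => /sN. Qed.

(** On a measurable null set containing the discontinuous trajectories, the zero path is
    substituted; measurability of coordinates survives because that set is measurable. *)
Lemma continuous_version : exists (N : set T) (X : T -> path R),
  [/\ measurable N, P N = 0%E, measurable_fun setT X &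
    forall w, ~ N w -> forall t, X w t = B t w].
Proof.
have [N [mN N0 cN]] := null_set.
pose X w : path R := match pselect (~ N w) with
  | left h => Path (cN w h) | right _ => Path (@path0_continuous R) end.
exists N, X; split => //; last by move=> w Nw t; rewrite /X; case: pselect.
apply: measurable_path => t.
have -> : (fun w => X w t) = (B t) \_ (~` N).
  apply/funext => w; rewrite patchE /X; case: pselect => /= Nw; first by rewrite mem_set.
  by rewrite memNset// => /(_ _).
apply/(measurable_restrictT _ (measurableC mN)); exact: measurable_funTS.
Qed.

Lemma linear_form_gaussian (e : seq (R * R)) :
  exists2 v : R, (\int[P]_w ((\sum_(p <- e) p.1 * B p.2 w) ^+ 2)%:E = v%:E)%E &
    (\int[P]_w (expR (\sum_(p <- e) p.1 * B p.2 w))%:E = (expR (v / 2))%:E)%E.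
Proof.
pose Y w := \sum_(p <- e) p.1 * B p.2 w.
have mY : measurable_fun setT Y.
  by apply: measurable_sum => p; exact: measurable_funM.
have gY : gaussian_variable P Y.
  have := gaussB (fun i : 'I_(size e) => (nth (0, 0) e i).1) (fun i => (nth (0, 0) e i).2).
  suff -> : Y = (fun w => \sum_(i < size e) (nth (0, 0) e i).1 * B (nth (0, 0) e i).2 w) by [].
  by apply/funext => w; rewrite /Y (big_nth (0, 0)) big_mkord.
have EY : ('E_P[Y] = 0)%E.
  rewrite unlock /Y.
  transitivity (\int[P]_w \sum_(p <- e) (p.1%:E * (B p.2 w)%:E))%E.
    by apply: eq_integral => w _; rewrite -sumEFin; apply: eq_bigr => p _; rewrite EFinM.
  rewrite integral_sum//; last by move=> p; apply: integrableZl => //; exact: intB.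
  by rewrite big1// => p _; rewrite integralZl ?int0 ?mule0//; exact: intB.
have [v E2 mgf] := gaussian_centeredP mY gY EY.
exists v => //; have := mgf 1; rewrite expr1n mul1r => <-.
by apply: eq_integral => w _; rewrite mul1r.
Qed.

End gaussian_paths.

Theorem theorem2 (d : measure_display) (T : measurableType d) (R : realType)
    (P : probability T R) (B : R -> {RV P >-> R})
    (gaussB : gaussian_process P B)
    (centB : centered P B)
    (contB : sample_continuous P B)
    (statB : stationary_increments P B)
    (W0 : {ae P, forall w, drifted P B 0 w = 0})
    (l : R -> R) (c : R)
    (l_ge0 : forall t, 0 <= t -> 0 <= l t)
    (l_mono : exists t0 : R, forall s t, t0 <= s -> s <= t -> l s <= l t)
    (c_gt0 : 0 < c) (c_le1 : c <= 1)
    (c_cond : 0 < c ^+ 2 + 8 * c - 8)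
    (l_bounds : \forall t \near +oo,
       c * l t <= variance_function P B t <= l t)
    (l_ratio : forall k : nat, (0 < k)%N ->
       l t / l (t + k%:R) @[t --> +oo] --> (1 : R))
    (l_growth : ((8 / (c ^+ 2 + 8 * c - 8))%:E <
       limf_einf (fun t : R => (l t / ln t)%:E) +oo%R)%E)
    (delta eta : R)
    (delta_eta : (delta = 0 /\ 0 <= eta) \/
       (0 < delta /\ exists k : nat, (0 < k)%N /\ eta = k%:R * delta)) :
  let W := drifted P B in
  let rhs := (\int[P]_w (path_sup W (lattice delta) w / path_sum W eta w))%E in
  [/\ cvg (pickands_ratio P W delta u @[u --> +oo]),
      pickands_constant P W delta = rhs &
      (0 < rhs < +oo)%E].

Proof.
move=> W rhs.
have eta0 : 0 <= eta.
  by case: delta_eta => [[]//|[d0 [k [k0 ->]]]]; rewrite mulr_ge0// ltW.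
have [N [X [mN N0 mX XB]]] := continuous_version contB.
have offN : {ae P, forall w, ~ N w} by exists N; split => // w /contrapT.
have [Q QE QA] := path_law P mX.
have mlf e : measurable_fun setT (@linear_form R e) by exact: measurable_linear_form.
have formB e w : ~ N w -> linear_form e (X w) = \sum_(p <- e) p.1 * B p.2 w.
  by move=> Nw; apply: eq_bigr => p _; rewrite XB.
have msum (e : seq (R * R)) : measurable_fun setT (fun w => \sum_(p <- e) p.1 * B p.2 w).
  by apply: measurable_sum => p; apply: measurable_funM => //; exact: measurable_funPT.
have lawB (G : R -> \bar R) e : measurable_fun setT G -> (forall y, 0 <= G y)%E ->
    (\int[Q]_x G (linear_form e x) = \int[P]_w G (\sum_(p <- e) p.1 * B p.2 w)%R)%E.
  move=> mG G0; rewrite QE//; last exact: measurableT_comp mG (mlf e).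
  apply: ge0_ae_eq_integral => //.
  - exact: measurableT_comp mG (measurableT_comp (mlf e) mX).
  - exact: measurableT_comp mG (msum e).
  - by move: offN; apply: filterS => w Nw _; rewrite formB.
have m2 : measurable_fun setT (fun y : R => (y ^+ 2)%:E).
  by apply/measurable_EFinP; exact: measurable_funX.
have me : measurable_fun setT (fun y : R => (expR y)%:E) by exact/measurable_EFinP.
have gaussQ e : exists2 v : R, (\int[Q]_x (linear_form e x ^+ 2)%:E = v%:E)%E &
    (\int[Q]_x (expR (linear_form e x))%:E = (expR (v / 2))%:E)%E.
  have [v E2 E1] := linear_form_gaussian gaussB centB e.
  exists v; first by rewrite (lawB (fun y => (y ^+ 2)%:E))// => y; rewrite lee_fin sqr_ge0.
  by rewrite (lawB (fun y => (expR y)%:E))// => y; rewrite lee_fin expR_ge0.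
have incQ s t : (\int[Q]_x ((x t - x s) ^+ 2)%:E = (variance_function P B (t - s))%:E)%E.
  rewrite -(increment_second_moment gaussB centB statB W0).
  have E (x : path R) : x t - x s = linear_form [:: (1, t); (-1, s)] x.
    by rewrite /linear_form !big_cons big_nil addr0 mul1r mulN1r.
  under eq_integral do rewrite E.
  rewrite (lawB (fun y => (y ^+ 2)%:E))//; last by move=> y; rewrite lee_fin sqr_ge0.
  by apply: eq_integral => w _; rewrite !big_cons big_nil addr0 mul1r mulN1r.
have zeroQ : {ae Q, forall x : path R, x 0 = 0}.
  have m0 : measurable [set x : path R | x 0 <> 0].
    rewrite (_ : [set _ | _] = setT `&` (fun x : path R => x 0) @^-1` (~` [set 0])); last first.
      by rewrite setTI.
    by apply: measurable_eval => //; exact: measurableC.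
  exists [set x : path R | x 0 <> 0]; split => //.
  rewrite QA//; have h : {ae P, forall w, X w 0 = 0}.
    move: (process_at0 centB W0) offN; apply: filterS2 => w B0 Nw.
    by rewrite XB.
  have mXm : measurable (X @^-1` [set x : path R | x 0 <> 0]).
    by rewrite -[X in measurable X]setTI; exact: mX.
  by apply/(negligibleP P mXm); move: h; apply: negligibleS => w /=.
have cs := sigma2_continuous gaussQ incQ zeroQ.
have mD := measurable_drift_path cs.
(* [Q] is the law of the continuous version of [B], and [Q2] that of [W]; the drift can be
   subtracted inside the path space once the variance is known to be continuous. *)
have [Q2 Q2E _] := path_law Q mD.
have tiltQ2 : tilting Q2.
  move=> h F mF F0; rewrite !Q2E//.
  - exact: (drift_tilt gaussQ incQ zeroQ cs h mF F0).
  - apply: emeasurable_funM.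
      by apply/measurable_EFinP; apply: measurableT_comp => //; exact: measurable_eval.
    exact: measurableT_comp mF (measurable_tilt_path h).
  - by move=> x; rewrite mule_ge0// lee_fin expR_ge0.
have supQ2 K : 0 <= K -> (\int[Q2]_x path_sup (@eval_path R) [set` `[0, K]%R] x < +oo)%E.
  move=> K0; rewrite Q2E; first exact: (drift_sup_finite gaussQ incQ zeroQ cs K0).
  - exact: measurable_path_sup.
  - by move=> x; apply: path_sup_ge0; exists 0; rewrite /= in_itv/= lexx.
have halfQ2 b : 0 < b -> (\esum_(t in lattice b) \int[Q2]_x (expR (x t / 2))%:E < +oo)%E.
  move=> b0; have [e e0 He] := logarithmic_growth c_gt0 c_le1 c_cond l_bounds l_growth.
  have := lattice_moment_finite e0 b0 (sigma2N incQ) He.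
  congr (_ < _)%E; apply: eq_esum => t _; rewrite Q2E.
  - by rewrite (drift_half_moment gaussQ incQ zeroQ cs).
  - apply/measurable_EFinP; apply: measurableT_comp => //.
    by apply: measurable_funM => //; exact: measurable_eval.
  - by move=> x; rewrite lee_fin expR_ge0.
have [lim pos] := path_pickands tiltQ2 supQ2 halfQ2 delta_eta.
(* Functionals of the original process may fail to be measurable on the null set [N]; agreement with
   a measurable path functional outside [N] still fixes their integral. *)
have law2 (F : path R -> \bar R) (g : T -> \bar R) : measurable_fun setT F ->
    (forall x, 0 <= F x)%E -> (forall w, 0 <= g w)%E ->
    (forall w, ~ N w -> g w = F (drift_path cs (X w))) ->
    (\int[P]_w g w = \int[Q2]_x F x)%E.
  move=> mF F0 g0 gF; have mFD := measurableT_comp mF mD.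
  rewrite Q2E// QE//.
  exact: (integral_off_null mN N0 (measurableT_comp mFD mX) (fun w => F0 _) g0 gF).
have supW D w : ~ N w -> path_sup W D w = path_sup (@eval_path R) D (drift_path cs (X w)).
  move=> Nw; congr ereal_sup; apply: eq_imagel => t _.
  by rewrite /W /drifted /eval_path /= XB.
have sumW w : ~ N w -> path_sum W eta w = path_sum (@eval_path R) eta (drift_path cs (X w)).
  move=> Nw; have E t : W t w = drift_path cs (X w) t by rewrite /W /drifted /= XB.
  by rewrite /path_sum; case: ifP => _; [apply: eq_integral => t _|congr (_ * _)%E; apply: eq_esum => t _]; rewrite E.
have supW0 D w : D !=set0 -> (0 <= path_sup W D w)%E.
  move=> [t Dt]; apply: (@le_trans _ _ (expR (W t w))%:E); first by rewrite lee_fin expR_ge0.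
  by apply: ereal_sup_ubound; exists t.
have sumW0 w : (0 <= path_sum W eta w)%E.
  rewrite /path_sum; case: ifP => _; first by apply: integral_ge0 => t _; rewrite lee_fin expR_ge0.
  by rewrite mule_ge0 ?lee_fin//; apply: esum_ge0 => t _; rewrite lee_fin expR_ge0.
have ld : lattice delta !=set0 by exists 0; exact: lattice0.
have rhsE : rhs = (\int[Q2]_x (path_sup (@eval_path R) (lattice delta) x / path_sum (@eval_path R) eta x))%E.
  apply: law2.
  - have -> : (fun x => path_sup (@eval_path R) (lattice delta) x / path_sum (@eval_path R) eta x)%E =
      (fun x => path_sup (@eval_path R) (lattice delta) x * ((fine (path_sum (@eval_path R) eta x))^-1)%:E)%E.
      by apply/funext => x; rewrite inve_fine// path_sum_gt0.
    apply: emeasurable_funM; first exact: measurable_path_sup.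
    apply: measurable_fine_inv; first exact: measurable_path_sum.
    by move=> x; exact/ltW/path_sum_gt0.
  - by move=> x; rewrite mule_ge0 ?path_sup_ge0// inve_ge0 ltW// path_sum_gt0.
  - by move=> w; rewrite mule_ge0 ?supW0// inve_ge0.
  - by move=> w Nw; rewrite supW// sumW.
have ratioW : pickands_ratio P W delta u @[u --> +oo] --> rhs.
  rewrite rhsE; apply: cvg_trans lim; apply: near_eq_cvg; near=> u.
  have u0 : 0 <= u by near: u; exact: nbhs_pinfty_ge.
  have ne : lattice delta `&` `[0, u] !=set0.
    by exists 0; split; [exact: lattice0|rewrite /= in_itv/= lexx].
  rewrite /pickands_ratio; congr (_ * _)%E; apply/esym/law2.
  - exact: measurable_path_sup.
  - by move=> x; exact: path_sup_ge0.
  - by move=> w; exact: supW0.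
  - by move=> w Nw; exact: supW.
split; first by apply/cvg_ex; exists rhs.
  exact/cvg_lim.
by rewrite rhsE.
Unshelve. all: by end_near.
Qed.
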